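(* If $C^e\in\mathcal{S}$ (the distribution of $C^e$ is subexponential), then the relative error of the corrected discard approximation satisfies $$R_{d,\epsilon}(u)=1-\frac{\tilde\psi_{d,\epsilon}(u)}{\psi_\epsilon(u)}\;\longrightarrow\;\frac{\epsilon\theta}{1-\delta+\epsilon\delta}\qquad\text{as }u\to\infty.$$
   Context: Fix $\lambda>0$ and $\epsilon\in[0,1]$. Let $B$ be a nonnegative random variable with a phase-type distribution and $C$ a nonnegative random variable with a heavy-tailed distribution ($\mathbb{E}e^{rC}=\infty$ for all $r>0$), both with finite positive means. Classical Cramér–Lundberg model: premiums flow in at rate 1, claims arrive according to a Poisson process $\{N_\epsilon(t)\}$ of rate $\lambda$, and the claim sizes $U_{\epsilon,i}$ are i.i.d., independent of $N_\epsilon$, distributed as $B$ with probability $1-\epsilon$ and as $C$ with probability $\epsilon$. Let $M_\epsilon=\sup_{t\ge0}\big(\sum_{i=1}^{N_\epsilon(t)}U_{\epsilon,i}-t\big)$ and let $\psi_\epsilon(u)=\mathbb{P}(M_\epsilon>u)$ be the ruin probability with initial capital $u\ge0$. Put $\delta=\lambda\mathbb{E}B$, $\theta=\lambda\mathbb{E}C$, $\rho_\epsilon=(1-\epsilon)\delta+\epsilon\theta$. Standing assumption: $\rho_\epsilon<1$. For a nonnegative random variable with distribution $F$ and mean $\mu_F\in(0,\infty)$, its stationary excess distribution is $F^e(u)=\frac1{\mu_F}\int_0^u(1-F(t))\,dt$; $C^e$ has the stationary excess distribution of $C$. Discard base model: $M^\bullet_\epsilon$ is the supremum over $t\ge 0$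 of (total claims up to $t$) $-\,t$ when claims arrive as a Poisson process of rate $(1-\epsilon)\lambda$ with i.i.d. sizes distributed as $B$; $\psi^\bullet_\epsilon(u)=\mathbb{P}(M^\bullet_\epsilon>u)$. The $M^\bullet_{\epsilon,i}$ are copies of $M^\bullet_\epsilon$, $C^e_1$ is a copy of $C^e$, all mutually independent. Corrected discard approximation: $$\tilde\psi_{d,\epsilon}(u)=\psi^\bullet_\epsilon(u)+\frac{\epsilon\theta}{1-\delta+\epsilon\delta}\big(\mathbb{P}(M^\bullet_{\epsilon,0}+M^\bullet_{\epsilon,1}+C^e_1>u)-\mathbb{P}(M^\bullet_{\epsilon,0}>u)\big).$$ A distribution $F$ on $[0,\infty)$ belongs to the class $\mathcal{S}$ of subexponential distributions iff $\lim_{u\to\infty}\frac{1-F^{*n}(u)}{1-F(u)}=n$ for $n=1,2,\dots$, where $F^{*n}$ is the $n$-fold convolution. *)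

(* Defs.v *)
From mathcomp Require Import all_boot all_order all_algebra finmap.
From mathcomp Require Import all_classical all_reals all_analysis measurable_realfun.

Set Implicit Arguments.
Unset Strict Implicit.
Unset Printing Implicit Defensive.

Import Order.TTheory GRing.Theory Num.Theory.
Import numFieldNormedType.Exports.

Local Open Scope classical_set_scope.
Local Open Scope ring_scope.

Definition same_law (R : realType) (d1 d2 d : measure_display)
    (T1 : measurableType d1) (T2 : measurableType d2) (E : measurableType d)
    (P1 : probability T1 R) (X1 : T1 -> E)
    (P2 : probability T2 R) (X2 : T2 -> E) : Prop :=
  forall A : set E, measurable A -> P1 (X1 @^-1` A) = P2 (X2 @^-1` A).

Definition mutually_independent (R : realType) (d d' : measure_display)
    (T : measurableType d) (E : measurableType d') (P : probability T R)
    (I : choiceType) (X : I -> T -> E) : Prop :=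
  forall (J : {fset I}) (A : I -> set E), (forall i, measurable (A i)) ->
    P (\bigcap_(i in [set` J]) (X i @^-1` A i)) =
    (\prod_(i <- J) P (X i @^-1` A i))%E.

(* The sets may be taken to be the whole space, so the pairwise product rules
   are included. *)
Definition independent3 (R : realType) (d d1 d2 d3 : measure_display)
    (T : measurableType d) (E1 : measurableType d1) (E2 : measurableType d2)
    (E3 : measurableType d3) (P : probability T R)
    (X : T -> E1) (Y : T -> E2) (Z : T -> E3) : Prop :=
  forall (A : set E1) (B : set E2) (C : set E3),
    measurable A -> measurable B -> measurable C ->
    P (X @^-1` A `&` Y @^-1` B `&` Z @^-1` C) =
    (P (X @^-1` A) * P (Y @^-1` B) * P (Z @^-1` C))%E.

(* Independence of the sigma-algebras generated by (X i), i in D, and by all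
   the Y j, stated on the generating pi-systems of finite-dimensional
   cylinders. *)
Definition independent_families (R : realType) (d d1 d2 : measure_display)
    (T : measurableType d) (E1 : measurableType d1) (E2 : measurableType d2)
    (P : probability T R) (I1 I2 : choiceType) (D : set I1)
    (X : I1 -> T -> E1) (Y : I2 -> T -> E2) : Prop :=
  forall (J : {fset I1}) (K : {fset I2}) (A : I1 -> set E1) (B : I2 -> set E2),
    [set` J] `<=` D ->
    (forall i, measurable (A i)) -> (forall j, measurable (B j)) ->
    let XA := \bigcap_(i in [set` J]) (X i @^-1` A i) in
    let YB := \bigcap_(j in [set` K]) (Y j @^-1` B j) in
    P (XA `&` YB) = (P XA * P YB)%E.

(* Only the values N t with 0 <= t are constrained. The rate may be 0, in which
   case [poisson_prob 0 _] is the Dirac mass at 0 and N vanishes almost surely.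
   The second argument of [poisson_prob] is a dummy. *)
Definition poisson_process (R : realType) (d : measure_display)
    (T : measurableType d) (P : probability T R) (rate : R)
    (N : R -> {RV P >-> nat}) : Prop :=
  [/\ forall w, N 0 w = 0%N,
      forall w (s t : R), 0 <= s -> s <= t -> (N s w <= N t w)%N,
      forall w (t : R), 0 <= t -> \forall s \near t^'+, N s w = N t w,
      forall t : nat -> R, 0 <= t 0%N ->
        {homo t : i j / (i <= j)%N >-> i <= j} ->
        mutually_independent P (fun i w => (N (t i.+1) w - N (t i) w)%N) &
      forall (s t : R) (A : set nat), 0 <= s -> s <= t ->
        P ((fun w => (N t w - N s w)%N) @^-1` A) =
        poisson_prob (rate * (t - s)) 0 A].

(* Claims arrive at the epochs of N, with sizes U 0, U 1, ... of law F. *)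
Definition cramer_lundberg (R : realType) (d : measure_display)
    (T : measurableType d) (P : probability T R) (rate : R)
    (F : set R -> \bar R) (N : R -> {RV P >-> nat}) (U : nat -> {RV P >-> R})
    : Prop :=
  [/\ poisson_process rate N,
      mutually_independent P U,
      forall i (A : set R), measurable A -> P (U i @^-1` A) = F A &
      independent_families P [set t : R | 0 <= t] N U].

Definition max_claim_surplus (R : realType) (T : Type)
    (N : R -> T -> nat) (U : nat -> T -> R) (w : T) : \bar R :=
  ereal_sup [set (\sum_(i < N t w) U i w - t)%:E | t in [set t : R | 0 <= t]].

Definition ruin_prob (R : realType) (d : measure_display)
    (T : measurableType d) (P : probability T R)
    (N : R -> {RV P >-> nat}) (U : nat -> {RV P >-> R}) (u : R) : R :=
  fine (P [set w | (u%:E < max_claim_surplus N U w)%E]).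

Definition mixture (R : realType) (eps : R) (F G : set R -> \bar R)
    (A : set R) : \bar R :=
  ((1 - eps)%:E * F A + eps%:E * G A)%E.

Definition expmx (R : realType) (p : nat) (A : 'M[R]_p.+1) : 'M[R]_p.+1 :=
  \matrix_(i, j) limn (series (fun k : nat => (k`!%:R^-1 *: A ^+ k) i j)).

(* Law of the absorption time of a Markov jump process with p.+1 transient
   states, initial law alpha on these (the defect 1 - sum alpha is an atom at 0)
   and intensity matrix S restricted to them. Nonsingularity of S says that all
   these states are transient. *)
Definition phase_type (R : realType)
    (F : probability R R) : Prop :=
  exists (p : nat) (alpha : 'rV[R]_p.+1) (S : 'M[R]_p.+1),
    [/\ (forall i, 0 <= alpha 0 i) /\ \sum_i alpha 0 i <= 1,
        forall i j, i != j -> 0 <= S i j,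
        forall i, \sum_j S i j <= 0,
        S \in unitmx &
        F `]-oo, 0%R[%classic = 0%E /\
        forall t : R, 0 <= t ->
          F `]-oo, t]%classic =
          (1 - (alpha *m expmx (t *: S) *m const_mx 1 : 'M[R]_1) 0 0)%:E].

Definition heavy_tailed (R : realType) (d : measure_display)
    (T : measurableType d) (P : probability T R) (X : {RV P >-> R}) : Prop :=
  forall r : R, 0 < r -> mmt_gen_fun P X r = +oo%E.

(* Vanishes for u < 0. *)
Definition excess_cdf (R : realType) (d : measure_display)
    (T : measurableType d) (P : probability T R) (X : {RV P >-> R}) (u : R)
    : R :=
  (fine 'E_P[X])^-1 *
  \int[@lebesgue_measure R]_(t in `[0, u]) (1 - fine (cdf X t)).

Fixpoint conv_pow (R : realType) (F : probability R R)
    (n : nat) (A : set R) : \bar R :=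
  if n is m.+1 then (\int[F]_(x in setT) conv_pow F m [set y | A ((x : R) + y)%R])%E
  else \d_(0 : R) A.

Definition subexponential (R : realType)
    (F : probability R R) : Prop :=
  F `[0%R, +oo[%classic = 1%E /\
  forall n : nat, (0 < n)%N ->
    (1 - fine (conv_pow F n `]-oo, u]%classic)) /
    (1 - fine (F `]-oo, u]%classic)) @[u --> +oo] --> (n%:R : R).

(* Main.v *)
(** With [k y = rate * P(claim > y)] and [rho = \int_0^oo k < 1], a ruin
    probability satisfies the defective renewal equation
      [f v = rho - \int_0^v k + \int_0^v f (v - y) * k y dy].
    It is obtained by conditioning the claim surplus, observed on a grid of
    mesh [h], on the number of claims in the first time step, integrating the
    resulting inequalities over the capital and letting [h] tend to 0.
    A comparison argument for this equation shows that the ruin probability of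
    the base model decays exponentially, and that
      [psi_eps u / P(Ce > u)] tends to [alpha = eps theta / (1 - rho_eps)].
    As the [M_i] are light-tailed, [P(M_0 + M_1 + Ce > u) ~ P(Ce > u)], so with
    [kappa = eps theta / (1 - delta + eps delta)] the relative error tends to
    [1 - kappa / alpha = kappa]. If [eps = 0], both ruin probabilities coincide
    and are positive. *)

From HB Require Import structures.
Require Import Defs.
From mathcomp Require Import all_boot all_order all_algebra finmap.
From mathcomp Require Import all_classical all_reals all_analysis measurable_realfun.
From mathcomp Require Import ring lra.

Import Order.TTheory GRing.Theory Num.Theory.
Import numFieldNormedType.Exports.

Local Open Scope classical_set_scope.
Local Open Scope ring_scope.

Set Implicit Arguments.
Unset Strict Implicit.
Unset Printing Implicit Defensive.

(** * Integrals and convolutions on compact intervals *)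

(** Such asymptotics are often read off a geometric compound sum, with a uniform bound on
    convolution powers. Here they are drawn from the renewal equation itself: subtracting
    [alpha * K], with [K] the tail of the excess law, leaves a forcing term o([K]), and as the
    kernel has mass [rho < 1], each substitution contracts the bound on the quotient by [K]. One
    comparison principle with a constant or an exponential weight yields uniqueness and exponential
    decay; with weight [K] it starts the heavy-tailed limit. The claim process is given by its
    increments over deterministic times, hence the grid. Survival need not be differentiable in the
    capital, hence the integration: a shift of the capital by [h] then survives only as boundary
    terms, which can be divided by [h]. The integrated equation still contains the unknown survival
    probability at capital 0; it is bounded below through finite horizons and above through large
    capital. Long-tailedness of the excess law is obtained by pinching its twofold convolution, and
    it controls every error relative to [K]. *)

Section lebesgue_affine.
Context {R : realType}.
Local Notation mu := (@lebesgue_measure R).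

Lemma measurable_add_cst (c : R) : measurable_fun (setT : set (measurableTypeR R))
    ((fun x => c + x) : _ -> measurableTypeR R).
Proof. by apply: measurable_funD => //; exact: measurable_cst. Qed.

Lemma measurable_sub_cst (c : R) : measurable_fun (setT : set (measurableTypeR R))
    ((fun x => c - x) : _ -> measurableTypeR R).
Proof. by apply: measurable_funB => //; exact: measurable_cst. Qed.

Lemma lebesgue_measure_shift (c : R) (A : set R) : measurable A ->
  mu ((fun x => c + x) @^-1` A) = mu A.
Proof.
move=> mA; have mf := measurable_add_cst c.
pose f : {mfun (measurableTypeR R) >-> (measurableTypeR R)} :=
  HB.pack (_ : measurableTypeR R -> measurableTypeR R) (isMeasurableFun.Build _ _ _ _ _ mf).
apply/esym; apply: (@lebesgue_measure_unique R (pushforward mu f)) => // X [[a b] _ <-] /=.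
rewrite /pushforward /= (_ : _ @^-1` _ = `]a - c, b - c]%classic).
  rewrite !lebesgue_measure_itv/= !lte_fin ltrD2r; case: ifP => // _.
  by rewrite -!EFinD; congr EFin; ring.
by apply/seteqP; split => x /=; rewrite !in_itv/= ltrBlDl lerBrDl.
Qed.

Lemma lebesgue_measure_reflect (c : R) (A : set R) : measurable A ->
  mu ((fun x => c - x) @^-1` A) = mu A.
Proof.
move=> mA; have mf := measurable_sub_cst c.
pose f : {mfun (measurableTypeR R) >-> (measurableTypeR R)} :=
  HB.pack (_ : measurableTypeR R -> measurableTypeR R) (isMeasurableFun.Build _ _ _ _ _ mf).
apply/esym; apply: (@lebesgue_measure_unique R (pushforward mu f)) => // X [[a b] _ <-] /=.
rewrite /pushforward /= (_ : _ @^-1` _ = `[c - b, c - a[%classic).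
  rewrite !lebesgue_measure_itv/= !lte_fin ltrD2l ltrN2; case: ifP => // _.
  by rewrite -!EFinD; congr EFin; ring.
by apply/seteqP; split => x /=; rewrite !in_itv/=; lra.
Qed.

Lemma Rintegral_shift (c : R) (D : set R) (f : R -> R) : measurable D ->
  measurable_fun setT f ->
  mu.-integrable ((fun x => c + x) @^-1` D) (EFin \o (fun x => f (c + x))) ->
  \int[mu]_(x in D) f x = \int[mu]_(x in (fun x => c + x) @^-1` D) f (c + x).
Proof.
move=> mD mf fi; rewrite /Rintegral; congr fine.
have mc := measurable_add_cst c.
pose g : {mfun (measurableTypeR R) >-> (measurableTypeR R)} :=
  HB.pack (_ : measurableTypeR R -> measurableTypeR R) (isMeasurableFun.Build _ _ _ _ _ mc).
rewrite -(@integral_pushforward _ _ _ _ R g mc mu D (EFin \o f))//; last first.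
  exact/measurable_EFinP.
by apply: eq_measure_integral => A mA _; exact/esym/lebesgue_measure_shift.
Qed.

Lemma Rintegral_reflect (c : R) (D : set R) (f : R -> R) : measurable D ->
  measurable_fun setT f ->
  mu.-integrable ((fun x => c - x) @^-1` D) (EFin \o (fun x => f (c - x))) ->
  \int[mu]_(x in D) f x = \int[mu]_(x in (fun x => c - x) @^-1` D) f (c - x).
Proof.
move=> mD mf fi; rewrite /Rintegral; congr fine.
have mc := measurable_sub_cst c.
pose g : {mfun (measurableTypeR R) >-> (measurableTypeR R)} :=
  HB.pack (_ : measurableTypeR R -> measurableTypeR R) (isMeasurableFun.Build _ _ _ _ _ mc).
rewrite -(@integral_pushforward _ _ _ _ R g mc mu D (EFin \o f))//; last first.
  exact/measurable_EFinP.
by apply: eq_measure_integral => A mA _; exact/esym/lebesgue_measure_reflect.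
Qed.

End lebesgue_affine.

Section bounded_measurable.
Context {R : realType}.
Local Notation mu := (@lebesgue_measure R).
Implicit Types (f g k : R -> R).

(** This class is stable under every operation used below and integrable on each compact interval,
    so integrability reduces to membership. *)
Definition bmeas f := measurable_fun setT f /\ exists M : R, forall x : R, `|f x| <= M.

Lemma bmeas_cst c : bmeas (fun _ => c).
Proof. by split; [exact: measurable_cst|exists `|c|]. Qed.

Lemma bmeasD f g : bmeas f -> bmeas g -> bmeas (fun x => f x + g x).
Proof.
move=> [mf [M fM]] [mg [N gN]]; split; first exact: measurable_funD.
by exists (M + N) => x; rewrite (le_trans (ler_normD _ _))// lerD.
Qed.

Lemma bmeasM f g : bmeas f -> bmeas g -> bmeas (fun x => f x * g x).
Proof.
move=> [mf [M fM]] [mg [N gN]]; split; first exact: measurable_funM.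
by exists (M * N) => x; rewrite normrM ler_pM.
Qed.

Lemma bmeasZ c f : bmeas f -> bmeas (fun x => c * f x).
Proof. by move=> bf; exact: bmeasM (bmeas_cst c) bf. Qed.

Lemma bmeasN f : bmeas f -> bmeas (fun x => - f x).
Proof.
move=> [mf [M fM]]; split; first exact: measurableT_comp.
by exists M => x; rewrite normrN.
Qed.

Lemma bmeasB f g : bmeas f -> bmeas g -> bmeas (fun x => f x - g x).
Proof. by move=> bf /bmeasN bg; exact: bmeasD. Qed.

Lemma bmeas_norm f : bmeas f -> bmeas (fun x => `|f x|).
Proof.
move=> [mf [M fM]]; split; first exact: measurableT_comp.
by exists M => x; rewrite normr_id.
Qed.

Lemma bmeas_comp f (h : R -> R) : measurable_fun setT h -> bmeas f ->
  bmeas (fun x => f (h x)).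
Proof.
move=> mh [mf [M fM]]; split; first exact: (measurableT_comp mf).
by exists M => x; exact: fM.
Qed.

Lemma bmeas_subr f c : bmeas f -> bmeas (fun x => f (c - x)).
Proof. by apply: bmeas_comp; apply: measurable_funB => //; exact: measurable_cst. Qed.

Lemma bmeas_addl f c : bmeas f -> bmeas (fun x => f (c + x)).
Proof. by apply: bmeas_comp; apply: measurable_funD => //; exact: measurable_cst. Qed.

Lemma bmeas_nonincreasing f M : nonincreasing_fun f -> (forall x : R, 0 <= f x <= M) ->
  bmeas f.
Proof.
move=> ndf fM; split; first exact: nonincreasing_measurable.
by exists M => x; have /andP[f0 ?] := fM x; rewrite ger0_norm.
Qed.

Lemma bmeas_nondecreasing f M : nondecreasing_fun f -> (forall x : R, 0 <= f x <= M) ->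
  bmeas f.
Proof.
move=> ndf fM; split; first exact: nondecreasing_measurable.
by exists M => x; have /andP[f0 ?] := fM x; rewrite ger0_norm.
Qed.

Lemma bmeas_integrable (a b : R) f : bmeas f ->
  mu.-integrable `[a, b] (EFin \o f).
Proof.
move=> [mf [M fM]]; apply: measurable_bounded_integrable => //.
- by rewrite /= lebesgue_measure_itv/=; case: ifP => // _; rewrite -EFinB ltry.
- exact: measurable_funTS.
- by exists M; split => //= r Mr x _; rewrite (le_trans (fM x))// ltW.
Qed.

Lemma cintD (a b : R) f g : bmeas f -> bmeas g ->
  \int[mu]_(x in `[a, b]) (f x + g x) =
  \int[mu]_(x in `[a, b]) f x + \int[mu]_(x in `[a, b]) g x.
Proof. by move=> bf bg; apply: RintegralD => //; exact: bmeas_integrable. Qed.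

Lemma cintB (a b : R) f g : bmeas f -> bmeas g ->
  \int[mu]_(x in `[a, b]) (f x - g x) =
  \int[mu]_(x in `[a, b]) f x - \int[mu]_(x in `[a, b]) g x.
Proof. by move=> bf bg; apply: RintegralB => //; exact: bmeas_integrable. Qed.

Lemma cintZ (a b c : R) f : bmeas f ->
  \int[mu]_(x in `[a, b]) (c * f x) = c * \int[mu]_(x in `[a, b]) f x.
Proof. by move=> bf; apply: RintegralZl => //; exact: bmeas_integrable. Qed.

Lemma cint_cst (a b c : R) : a <= b -> \int[mu]_(x in `[a, b]) c = c * (b - a).
Proof.
move=> ab; rewrite Rintegral_cst//= lebesgue_measure_itv/= lte_fin.
case: ifPn => [_|]; first by rewrite -EFinB.
by rewrite -leNgt => ba; rewrite (@le_anti _ _ b a) ?ab ?ba// subrr !mulr0.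
Qed.

Lemma le_cint (a b : R) f g : bmeas f -> bmeas g ->
  (forall x : R, a <= x <= b -> f x <= g x) ->
  \int[mu]_(x in `[a, b]) f x <= \int[mu]_(x in `[a, b]) g x.
Proof.
by move=> bf bg fg; apply: le_Rintegral => //; exact: bmeas_integrable.
Qed.

Lemma cint_ge0 (a b : R) f : (forall x : R, a <= x <= b -> 0 <= f x) ->
  0 <= \int[mu]_(x in `[a, b]) f x.
Proof. by move=> f0; apply: Rintegral_ge0 => x /=; rewrite in_itv/=; exact: f0. Qed.

Lemma eq_cint (a b : R) f g : (forall x : R, a <= x <= b -> f x = g x) ->
  \int[mu]_(x in `[a, b]) f x = \int[mu]_(x in `[a, b]) g x.
Proof.
by move=> fg; apply: eq_Rintegral => x; rewrite inE/= in_itv/=; exact: fg.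
Qed.

Lemma cint_split (a b c : R) f : bmeas f -> a <= b -> b <= c ->
  \int[mu]_(x in `[a, c]) f x =
  \int[mu]_(x in `[a, b]) f x + \int[mu]_(x in `[b, c]) f x.
Proof.
move=> bf ab bc; apply/eqP; rewrite addrC -subr_eq; apply/eqP.
rewrite Rintegral_itvB//; last exact: bmeas_integrable.
apply: Rintegral_itv_obnd_cbnd.
apply: (@integrableS _ _ _ mu `[b, c]%classic) => //.
  exact: subset_itv_oc_cc.
exact: bmeas_integrable.
Qed.

Lemma cint_shift (a b c : R) f : bmeas f ->
  \int[mu]_(x in `[a, b]) f (c + x) = \int[mu]_(x in `[c + a, c + b]) f x.
Proof.
move=> bf.
have E : (fun x => c + x) @^-1` `[c + a, c + b]%classic = `[a, b]%classic.
  by apply/seteqP; split => x /=; rewrite !in_itv/= !lerD2l.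
rewrite -[in LHS]E -Rintegral_shift//; first exact: bf.1.
by rewrite E; exact: (bmeas_integrable _ _ (bmeas_addl _ bf)).
Qed.

Lemma cint_reflect (u : R) f : bmeas f ->
  \int[mu]_(x in `[0, u]) f (u - x) = \int[mu]_(x in `[0, u]) f x.
Proof.
move=> bf.
have E : (fun x => u - x) @^-1` `[0, u]%classic = `[0, u]%classic.
  by apply/seteqP; split => x /=; rewrite !in_itv/=; lra.
rewrite -[in LHS]E -Rintegral_reflect//; first exact: bf.1.
by rewrite E; exact: (bmeas_integrable _ _ (bmeas_subr _ bf)).
Qed.

Lemma le_cint_itv (a b c d : R) f : bmeas f -> (forall x : R, 0 <= f x) ->
  c <= a -> b <= d ->
  \int[mu]_(x in `[a, b]) f x <= \int[mu]_(x in `[c, d]) f x.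
Proof.
move=> bf f0 ca bd; have [ba|ab] := ltP b a.
  rewrite set_itv_ge; last by rewrite bnd_simp -ltNge.
  by rewrite Rintegral_set0 cint_ge0.
rewrite (cint_split bf ca (le_trans ab bd)) (cint_split bf ab bd).
by rewrite -[leLHS]add0r lerD ?cint_ge0// lerDl cint_ge0.
Qed.

(** Convolution on the half-line of functions that live on the whole line: cutting at [0] and [u]
    hides their values at negative arguments. *)
Definition conv f k u : R := \int[mu]_(y in `[0, u]) (f (u - y) * k y).

Lemma bmeas_conv f k u : bmeas f -> bmeas k -> bmeas (fun y => f (u - y) * k y).
Proof. by move=> bf bk; apply: bmeasM => //; exact: bmeas_subr. Qed.

Lemma convDr f k k' u : bmeas f -> bmeas k -> bmeas k' ->
  conv f (fun x => k x + k' x) u = conv f k u + conv f k' u.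
Proof.
move=> bf bk bk'; rewrite /conv -cintD; try exact: bmeas_conv.
by apply: eq_cint => x _; rewrite mulrDr.
Qed.

Lemma convZl c f k u : bmeas f -> bmeas k ->
  conv (fun x => c * f x) k u = c * conv f k u.
Proof.
move=> bf bk; rewrite /conv -cintZ; last exact: bmeas_conv.
by apply: eq_cint => x _; rewrite mulrA.
Qed.

Lemma convZr c f k u : bmeas f -> bmeas k ->
  conv f (fun x => c * k x) u = c * conv f k u.
Proof.
move=> bf bk; rewrite /conv -cintZ; last exact: bmeas_conv.
by apply: eq_cint => x _; rewrite mulrCA.
Qed.

Lemma convBl f g k u : bmeas f -> bmeas g -> bmeas k ->
  conv (fun x => f x - g x) k u = conv f k u - conv g k u.
Proof.
move=> bf bg bk; rewrite /conv -cintB; try exact: bmeas_conv.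
by apply: eq_cint => x _; rewrite mulrBl.
Qed.

Lemma le_conv f g k u : bmeas f -> bmeas g -> bmeas k -> (forall x : R, 0 <= k x) ->
  (forall x : R, 0 <= x <= u -> f x <= g x) -> conv f k u <= conv g k u.
Proof.
move=> bf bg bk k0 fg; apply: le_cint; try exact: bmeas_conv.
by move=> x /andP[x0 xu]; rewrite ler_wpM2r// fg// subr_ge0 xu gerBl.
Qed.

Lemma conv_ge0 f k u : (forall x : R, 0 <= f x) -> (forall x : R, 0 <= k x) ->
  0 <= conv f k u.
Proof. by move=> f0 k0; apply: cint_ge0 => x _; rewrite mulr_ge0. Qed.

Lemma norm_conv_le f k u : bmeas f -> bmeas k -> (forall x : R, 0 <= k x) ->
  `|conv f k u| <= conv (fun x => `|f x|) k u.
Proof.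
move=> bf bk k0; have bi := bmeas_integrable 0 u (bmeas_conv u bf bk).
have mD : measurable (`[0, u]%classic : set (measurableTypeR R)) by exact: measurable_itv.
apply: (le_trans (le_normr_Rintegral mD bi)).
rewrite le_eqVlt; apply/orP; left; apply/eqP; apply: eq_cint => x _.
by rewrite normrM (ger0_norm (k0 x)).
Qed.

Lemma conv1 k u : bmeas k -> conv (fun _ => 1) k u = \int[mu]_(y in `[0, u]) k y.
Proof. by move=> bk; apply: eq_cint => x _; rewrite mul1r. Qed.

End bounded_measurable.

(** * Renewal inequalities *)

Section renewal_inequality.
Context {R : realType}.
Local Notation mu := (@lebesgue_measure R).
Implicit Types (d r k K : R -> R).

(* By induction on n, d <= (A + q^n B) K, where B K bounds d on [0, U]. *)
Lemma renewal_comparison d r k K (u0 A q : R) :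
  bmeas d -> bmeas k -> bmeas K -> (forall x : R, 0 <= k x) ->
  nonincreasing_fun K -> (forall x : R, 0 < K x) -> 0 <= q < 1 -> 0 <= A ->
  (forall u : R, 0 <= u < u0 -> d u <= A * K u) ->
  (forall u : R, 0 <= u -> u0 <= u -> d u <= r u + conv d k u) ->
  (forall u : R, 0 <= u -> u0 <= u -> conv K k u <= q * K u) ->
  (forall u : R, 0 <= u -> u0 <= u -> r u <= (1 - q) * A * K u) ->
  forall u : R, 0 <= u -> d u <= A * K u.
Proof.
move=> bd bk bK k0 niK Kgt0 /andP[q0 q1] A0 dlt drec Krec rK U U0.
have [M dM] := bd.2.
have M0 : 0 <= M by rewrite (le_trans _ (dM 0)).
pose B : R := M / K U.
have Kge0 x : 0 <= K x by exact: ltW.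
have B0 : 0 <= B by rewrite divr_ge0.
have H n (u : R) : 0 <= u <= U -> d u <= (A + q ^+ n * B) * K u.
  elim: n u => [|n IH] u /andP[u0_ uU].
    rewrite expr0 mul1r (le_trans (ler_norm _))// (le_trans (dM u))//.
    have -> : M = B * K U by rewrite /B divfK// gt_eqF.
    rewrite (@le_trans _ _ (B * K u)) ?ler_wpM2l ?niK//.
    by rewrite ler_wpM2r ?lerDr.
  have [uu0|uu0] := ltP u u0.
    apply: (le_trans (dlt u _)); first by rewrite u0_.
    by rewrite ler_wpM2r// lerDl mulr_ge0// exprn_ge0.
  rewrite (le_trans (drec u u0_ uu0))//.
  have c1 : conv d k u <= (A + q ^+ n * B) * conv K k u.
    rewrite -convZl//; apply: le_conv => //; first exact: bmeasZ.
    by move=> x /andP[x0 xu]; apply: IH; rewrite x0 (le_trans xu).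
  have c2 : (A + q ^+ n * B) * conv K k u <= (A + q ^+ n * B) * (q * K u).
    by apply: ler_wpM2l; [rewrite addr_ge0// mulr_ge0// exprn_ge0|exact: Krec].
  rewrite (le_trans (lerD (rK u u0_ uu0) (le_trans c1 c2)))//.
  by rewrite exprS; nra.
have qn : A * K U + (q ^+ n * B) * K U @[n --> \oo] --> A * K U + (0 * B) * K U.
  apply: cvgD; first exact: cvg_cst.
  apply: cvgMl; apply: cvgMl; apply: cvg_expr.
  by rewrite ger0_norm.
rewrite mul0r mul0r addr0 in qn.
apply: (ler_cvg_to (cvg_cst (d U)) qn); apply: nearW => n.
by rewrite -mulrDl H// U0 lexx.
Qed.

(** A bound [d <= b K] valid from some point on improves itself. On [[0, u - L]] it may be inserted
    into the convolution, which costs a factor close to [q]; on the window [[u - L, u]] only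
    boundedness of [d] is at hand, but there [k] has mass o([K]). Iterating drives [b] to 0. *)
Lemma renewal_vanishing d r k K (q : R) :
  bmeas d -> bmeas k -> bmeas K -> (forall x : R, 0 <= d x) -> (forall x : R, 0 <= k x) ->
  nonincreasing_fun K -> (forall x : R, 0 < K x) -> 0 <= q < 1 ->
  (forall u : R, 0 <= u -> d u <= r u + conv d k u) ->
  r u / K u @[u --> +oo] --> 0 ->
  conv K k u / K u @[u --> +oo] --> q ->
  (forall L : R, 0 <= L ->
    (\int[mu]_(y in `[u - L, u]) k y) / K u @[u --> +oo] --> 0) ->
  d u / K u @[u --> +oo] --> 0.
Proof.
move=> bd bk bK d0 k0 niK Kgt0 /andP[q0 q1] drec rK cK kK.
(* The ratio [conv K k / K] reaches [q] only in the limit; a [p] strictly between [q] and 1 bounds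
   it from some point on. *)
pose p := (1 + q) / 2.
have qp : q < p by rewrite /p; lra.
have p1 : p < 1 by rewrite /p; lra.
have p0 : 0 <= p by rewrite /p; lra.
have [M dM] := bd.2.
have M0 : 0 <= M by rewrite (le_trans _ (dM 0)).
have Kge0 x : 0 <= K x by exact: ltW.
have Kp : \forall u \near +oo, conv K k u <= p * K u.
  near=> u; rewrite -ler_pdivrMr//; near: u.
  exact: (cvgr_le q).
have rle e : 0 < e -> \forall u \near +oo, r u <= e * K u.
  move=> e0; near=> u; rewrite -ler_pdivrMr//; near: u.
  exact: (cvgr_le 0).
have [A A0 dA] : exists2 A, 0 <= A & forall u : R, 0 <= u -> d u <= A * K u.
  have [u0 [_ Hu0]] : \forall u \near +oo, conv K k u <= p * K u /\ r u <= 1 * K u.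
    by near=> u; split; near: u => //; exact: rle.
  pose u1 := `|u0| + 1.
  (* The first summand dominates [d] before [u1], where [K >= K u1]; the second makes
     [(1 - p) * A >= 1], which absorbs [r <= K]. *)
  pose A := M / K u1 + (1 - p)^-1.
  have A0 : 0 <= A by rewrite addr_ge0 ?divr_ge0 ?invr_ge0 ?subr_ge0// ltW.
  have u01 u : u1 <= u -> u0 < u.
    by apply: lt_le_trans; rewrite (le_lt_trans (ler_norm _))// ltrDl.
  exists A => // u uge0.
  apply: (renewal_comparison (r := r) (k := k) (u0 := u1) (q := p)) => //.
  - by rewrite p0.
  - move=> x /andP[x0 xu1]; rewrite (le_trans (ler_norm _))// (le_trans (dM x))//.
    have E : M = M / K u1 * K u1 by rewrite divfK// gt_eqF.
    rewrite {1}E; apply: ler_pM => //; first by rewrite divr_ge0.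
      by rewrite /A lerDl invr_ge0 subr_ge0 ltW.
    by apply: niK; exact: ltW.
  - by move=> x x0 _; exact: drec.
  - by move=> x _ /u01/Hu0[].
  - move=> x _ /u01/Hu0[_ /le_trans]; apply; apply: ler_wpM2r => //.
    rewrite /A mulrDr divff ?gt_eqF ?subr_gt0// lerDr.
    by rewrite mulr_ge0 ?divr_ge0// subr_ge0 ltW.
have improve b e : 0 < e -> 0 <= b -> (\forall u \near +oo, d u <= b * K u) ->
    \forall u \near +oo, d u <= (p * b + e) * K u.
  move=> e0 b0 [L0 [_ HL0]]; pose L := `|L0| + 1.
  have L_ge0 : 0 <= L by rewrite addr_ge0.
  have Lp u : L <= u -> d u <= b * K u.
    move=> Lu; apply: HL0; apply: lt_le_trans Lu.
    by rewrite (le_lt_trans (ler_norm _))// ltrDl.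
  have e2 : 0 < e / 2 by rewrite divr_gt0.
  have M1 : 0 < M + 1 by lra.
  have e2M : 0 < e / 2 / (M + 1) by exact: divr_gt0.
  near=> u.
  have uL : L <= u by near: u; apply: nbhs_pinfty_ge; exact: num_real.
  have u0 : 0 <= u by exact: le_trans uL.
  rewrite (le_trans (drec u u0))//.
  have H1 : r u <= e / 2 * K u by near: u; exact: rle.
  have H2 : conv K k u <= p * K u by near: u.
  have H3 : \int[mu]_(y in `[u - L, u]) k y <= e / 2 / (M + 1) * K u.
    by rewrite -ler_pdivrMr//; near: u; apply: (cvgr_le 0) => //; exact: kK.
  have uL0 : 0 <= u - L by rewrite subr_ge0.
  have uLu : u - L <= u by rewrite gerBl.
  have H4 : conv d k u <= b * conv K k u + M * \int[mu]_(y in `[u - L, u]) k y.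
    rewrite /conv (cint_split (bmeas_conv u bd bk) uL0 uLu).
    rewrite lerD//; last first.
      rewrite -cintZ//; apply: le_cint; [exact: bmeas_conv|exact: bmeasZ|].
      by move=> x _; rewrite ler_wpM2r// (le_trans (ler_norm _)).
    rewrite -cintZ; last exact: bmeas_conv.
    apply: (@le_trans _ _ (\int[mu]_(x in `[0, u - L]) (b * (K (u - x) * k x)))).
      apply: le_cint; [exact: bmeas_conv|by apply: bmeasZ; exact: bmeas_conv|].
      by move=> x /andP[x0 xuL]; rewrite mulrA ler_wpM2r// Lp//; lra.
    apply: le_cint_itv => //; first by apply: bmeasZ; exact: bmeas_conv.
    by move=> x; rewrite !mulr_ge0.
  have H5 : M * \int[mu]_(y in `[u - L, u]) k y <= e / 2 * K u.
    rewrite (le_trans (ler_wpM2l M0 H3))//.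
    rewrite mulrA; apply: ler_wpM2r => //.
    by rewrite mulrA ler_pdivrMr// mulrC ler_wpM2l ?lerDl// ltW.
  have H6 := ler_wpM2l b0 H2.
  move: H1 H4 H5 H6; set I := (\int[mu]_(_ in _) _); set c := conv K k u.
  by nra.
have H n e : 0 < e -> \forall u \near +oo, d u <= (p ^+ n * A + e) * K u.
  move=> e0; elim: n => [|n IH].
    exists 0; split => // u u0; rewrite expr0 mul1r.
    by rewrite (le_trans (dA u (ltW u0)))// ler_wpM2r ?lerDl 1?ltW.
  (* Each round may spend [(1 - p) * e]: with the contracted error [p * e] this gives back [e], so
     errors do not accumulate. *)
  have -> : p ^+ n.+1 * A + e = p * (p ^+ n * A + e) + (1 - p) * e.
    by rewrite exprS; ring.
  apply: improve => //; first by rewrite mulr_gt0// subr_gt0.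
  by rewrite addr_ge0 ?mulr_ge0 ?exprn_ge0// ltW.
apply/cvgrPdist_le => e e0.
have e2 : 0 < e / 2 by rewrite divr_gt0.
have [n Hn] : exists n, p ^+ n * A <= e / 2.
  have qn : p ^+ n * A @[n --> \oo] --> 0 * A.
    by apply: cvgMl; apply: cvg_expr; rewrite ger0_norm.
  rewrite mul0r in qn.
  have [N _ HN] : \forall n \near \oo, p ^+ n * A <= e / 2 by exact: (cvgr_le 0).
  by exists N; exact: HN (leqnn N).
near=> u; rewrite sub0r normrN ger0_norm ?divr_ge0//.
rewrite ler_pdivrMr//.
have : d u <= (p ^+ n * A + e / 2) * K u by near: u; exact: H.
move=> /le_trans; apply; apply: ler_wpM2r => //; rewrite [leRHS]splitr lerD2r.
Unshelve. all: by end_near. Qed.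

End renewal_inequality.

(** * Conditioning on the first time step *)

Section pi_system.
Context {R : realType} {d : measure_display} {T : measurableType d}.
Variable P : probability T R.

(** As functions of [A] both sides are finite measures, the restriction of [P] to [D] and a multiple
    of [P], so agreement on the pi-system [G] suffices. *)
Lemma indep_sigma (G : set (set T)) (D : set T) : measurable D ->
  G `<=` measurable -> setI_closed G -> G setT ->
  (forall A, G A -> P (A `&` D) = (P A * P D)%E) ->
  forall A, <<s G >> A -> P (A `&` D) = (P A * P D)%E.
Proof.
move=> mD Gm GI GT GP.
have cge0 : 0 <= fine (P D) by rewrite fine_ge0.
pose c : {nonneg R} := NngNum cge0.
have E A : mscale c P A = (P A * P D)%E.
  by rewrite /mscale/= fineK ?fin_num_measure// muleC.
move=> A sA; rewrite -E -/(mrestr P mD A).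
apply: (g_sigma_algebra_measure_unique G Gm (fun=> setT)) => //.
- by rewrite bigcup_const.
- by move=> B GB; rewrite [RHS]E -GP.
- by move=> _; rewrite /= /mrestr setTI ltey_eq fin_num_measure.
Qed.

(** The same uniqueness for image measures. With [D] an event of the first time step, [f] the
    remaining path and [g] the whole one, this is the form in which the process restarts. *)
Lemma law_eq_scale {d' : measure_display} {E : measurableType d'}
    (G : set (set E)) (D : set T) (f g : T -> E) (c : R) :
  measurable D -> measurable = <<s G >> -> setI_closed G -> G setT ->
  measurable_fun setT f -> measurable_fun setT g -> 0 <= c ->
  (forall S, G S -> P (D `&` f @^-1` S) = (c%:E * P (g @^-1` S))%E) ->
  forall S, measurable S -> P (D `&` f @^-1` S) = (c%:E * P (g @^-1` S))%E.
Proof.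
move=> mD mG GI GT mf mg c0 GP.
pose c' : {nonneg R} := NngNum c0.
move=> S mS; rewrite setIC.
apply: (@measure_unique _ _ _ G (fun=> setT) mG GI _ _
  (pushforward (mrestr P mD) f) (mscale c' (pushforward P g))) => //=.
- by rewrite bigcup_const.
- by move=> B GB; rewrite /pushforward/= /mrestr setIC GP.
- by move=> _; rewrite /pushforward/= /mrestr ltey_eq fin_num_measure// preimage_setT setTI.
Qed.

End pi_system.

(** * Paths of the discretized claim process *)

Section path_space.
Context {R : realType}.

(* A path x records the numbers x.1 of claims in successive time steps and the
   successive claim sizes x.2. *)
Definition path_cyl : set (set ((nat -> nat) * (nat -> R))) :=
  [set S | exists (L : nat) (C : nat -> set nat) (B : nat -> set R),
    (forall i, measurable (B i)) /\
    S = [set x | forall i, (i < L)%N -> C i (x.1 i) /\ B i (x.2 i)]].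

Definition path := g_sigma_algebraType path_cyl.

Lemma path_cylT : path_cyl setT.
Proof.
exists 0%N, (fun=> setT), (fun=> setT); split => //.
by apply/seteqP; split => x.
Qed.

Lemma path_cylI : setI_closed path_cyl.
Proof.
move=> _ _ [L [C [B [mB ->]]]] [L' [C' [B' [mB' ->]]]].
(* Cylinders of different lengths: the full space on the missing coordinates brings both to length
   [maxn L L']. *)
pose ext (T : Type) (L : nat) (A : nat -> set T) i := if (i < L)%N then A i else setT.
exists (maxn L L'), (fun i => ext _ L C i `&` ext _ L' C' i),
  (fun i => ext _ L B i `&` ext _ L' B' i); split.
  by move=> i; apply: measurableI; rewrite /ext; case: ifP.
apply/seteqP; split => x /=.
  move=> [H1 H2] i _; rewrite /ext.
  split; split; case: ifPn => // iL; by [case: (H1 i iL)|case: (H2 i iL)].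
move=> H; split=> i iL; have := H i; rewrite leq_max iL ?orbT => /(_ isT);
  by rewrite /ext iL => -[[? ?] [? ?]].
Qed.

Lemma measurable_to_path d (T : measurableType d) (a : nat -> T -> nat)
    (b : nat -> T -> R) :
  (forall i, measurable_fun setT (a i)) -> (forall i, measurable_fun setT (b i)) ->
  measurable_fun setT (fun w => (a ^~ w, b ^~ w) : path).
Proof.
move=> ma mb; apply: (@measurability _ _ T path setT _ path_cyl) => // _ [_ [L [C [B [mB ->]]]] <-].
rewrite setTI (_ : _ @^-1` _ =
  \bigcap_i (if (i < L)%N then a i @^-1` C i `&` b i @^-1` B i else setT)).
  apply: bigcapT_measurable => i; case: ifP => // _; apply: measurableI.
    by rewrite -[X in measurable X]setTI; exact: ma.
  by rewrite -[X in measurable X]setTI; exact: mb.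
apply/seteqP; split => w /= H i; first by move=> _; case: ifP => // /H.
by move=> iL; have := H i I; rewrite iL.
Qed.

Definition path_count (k : nat) (x : path) : nat := \sum_(j < k) x.1 j.

Definition path_claims (k : nat) (x : path) : R := \sum_(i < path_count k x) x.2 i.

Lemma measurable_path_fst i : measurable_fun setT (fun x : path => x.1 i).
Proof.
move=> _ C _; rewrite setTI; apply: sub_sigma_algebra.
exists i.+1, (fun j => if j == i then C else setT), (fun=> setT); split => //.
apply/seteqP; split => x /=; first by move=> Cx j _; case: eqP => // ->.
by move=> /(_ i); rewrite ltnSn eqxx => /(_ isT)[].
Qed.

Lemma measurable_path_snd i : measurable_fun setT (fun x : path => x.2 i).
Proof.
move=> _ B mB; rewrite setTI; apply: sub_sigma_algebra.
exists i.+1, (fun=> setT), (fun j => if j == i then B else setT); split => //.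
  by move=> j; case: ifP.
apply/seteqP; split => x /=; first by move=> Cx j _; case: eqP => // ->.
by move=> /(_ i); rewrite ltnSn eqxx => /(_ isT)[].
Qed.

Lemma path_count0 (x : path) : path_count 0 x = 0%N.
Proof. by rewrite /path_count big_ord0. Qed.

Lemma path_countS k (x : path) : path_count k.+1 x = (path_count k x + x.1 k)%N.
Proof. by rewrite /path_count big_ord_recr. Qed.

Lemma measurable_path_count k : measurable_fun setT (path_count k).
Proof.
elim: k => [|k IH].
  rewrite (_ : path_count 0 = cst 0%N); first exact: measurable_cst.
  by apply/funext => x; exact: path_count0.
move=> _ C _; rewrite setTI (_ : _ @^-1` _ = \bigcup_n \bigcup_m
   (if (n + m)%N \in C then
    (path_count k @^-1` [set n]) `&` ((fun x : path => x.1 k) @^-1` [set m])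
    else set0)).
  apply: bigcupT_measurable => n; apply: bigcupT_measurable => m.
  case: ifP => // _; apply: measurableI.
    by rewrite -[X in measurable X]setTI; exact: IH.
  by rewrite -[X in measurable X]setTI; exact: measurable_path_fst.
apply/seteqP; split => x /=; rewrite path_countS.
  move=> Cx; exists (path_count k x) => //; exists (x.1 k) => //.
  by rewrite mem_set.
by move=> [n _ [m _]]; case: ifPn => //; rewrite inE => + [-> ->].
Qed.

Lemma measurable_path_claims_le d (T : measurableType d) (k : nat)
    (p : T -> path) (f : T -> R) :
  measurable_fun setT p -> measurable_fun setT f ->
  measurable [set w | path_claims k (p w) <= f w].
Proof.
move=> mp mf; rewrite (_ : [set _ | _] = \bigcup_n
  ((path_count k \o p) @^-1` [set n] `&`
   [set w | \sum_(i < n) (p w).2 i <= f w])).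
  apply: bigcupT_measurable => n; apply: measurableI.
    rewrite -[X in measurable X]setTI.
    exact: (measurableT_comp (measurable_path_count k) mp).
  rewrite -[X in measurable X]setTI; apply: measurable_fun_ler => //.
  apply: measurable_sum => i; exact: (measurableT_comp (measurable_path_snd i) mp).
apply/seteqP; split => w /=; first by exists (path_count k (p w)).
by move=> [n _ [/= <-]].
Qed.

End path_space.
Arguments path R : clear implicits.

Section iota_fset.
Context {R : realType}.

Lemma bigcap_seq_fset T (L : nat) (F : nat -> set T) :
  \bigcap_(i in [set` seq_fset tt (iota 0 L)]) F i =
  [set w | forall i, (i < L)%N -> F i w].
Proof.
have E i : (i \in seq_fset tt (iota 0 L)) = (i < L)%N by rewrite seq_fsetE mem_iota.
apply/seteqP; split => w H i Hi; apply: H.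
  exact: etrans (E i) Hi.
exact: etrans (esym (E i)) Hi.
Qed.

Lemma prod_seq_fset (L : nat) (F : nat -> \bar R) :
  (\prod_(i <- seq_fset tt (iota 0 L)) F i = \prod_(i < L) F i)%E.
Proof.
rewrite (perm_big (iota 0 L)); last first.
  by rewrite (perm_trans (seq_fset_perm _ _))// undup_id// iota_uniq.
by rewrite -[in iota 0 L](subn0 L) -/(index_iota 0 L) big_mkord.
Qed.

End iota_fset.

(** * The law of the path after one time step *)

Section claims_paths.
Context {R : realType} {d : measure_display} {T : measurableType d}.
Variables (P : probability T R) (rate : R) (F : set R -> \bar R).
Variables (N : R -> {RV P >-> nat}) (U : nat -> {RV P >-> R}).
Hypothesis clNU : cramer_lundberg rate F N U.
Variable h : R.
Hypothesis h0 : 0 <= h.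

Definition count_incr i w := (N (i.+1%:R * h) w - N (i%:R * h) w)%N.

Let N0 : forall w, N 0 w = 0%N.
Proof. by case: clNU => -[]. Qed.

Let Nmono w (s t : R) : 0 <= s -> s <= t -> (N s w <= N t w)%N.
Proof. by case: clNU => -[_ H _ _ _] _ _ _; exact: H. Qed.

Lemma N_count_incr k w : N (k%:R * h) w = (\sum_(j < k) count_incr j w)%N.
Proof.
elim: k => [|k IH]; first by rewrite mul0r N0 big_ord0.
rewrite big_ord_recr/= -IH subnKC//; apply: Nmono.
  by rewrite mulr_ge0.
by rewrite ler_wpM2r// ler_nat.
Qed.

(** The independence hypothesis speaks of the values [N t], a path of their increments. This
    pi-system is the one of the hypothesis, and increments are measurable for the sigma-algebra it
    generates. *)
Let times_cyl : set (set T) := [set S | exists (J : {fset R}) (A : R -> set nat),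
  [set` J] `<=` [set t : R | 0 <= t] /\ S = \bigcap_(t in [set` J]) (N t @^-1` A t)].

Let mN t (A : set nat) : measurable (N t @^-1` A).
Proof. exact: measurable_funPTI. Qed.

Let mU i (A : set R) : measurable A -> measurable (U i @^-1` A).
Proof. by move=> mA; exact: measurable_funPTI. Qed.

Let times_cyl_m : times_cyl `<=` measurable.
Proof.
by move=> _ [J [A [_ ->]]]; apply: fin_bigcap_measurable => // *; exact: mN.
Qed.

Let times_cylT : times_cyl setT.
Proof.
exists fset0, (fun=> setT); split; first by move=> t /=; rewrite inE.
by apply/seteqP; split => // w _ t /=; rewrite inE.
Qed.

Let times_cylI : setI_closed times_cyl.
Proof.
move=> _ _ [J [A [J0 ->]]] [J' [A' [J0' ->]]].
exists (J `|` J')%fset, (fun t => (if t \in J then A t else setT) `&`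
  (if t \in J' then A' t else setT)); split.
  by move=> t /=; rewrite inE => /orP[]; [exact: J0|exact: J0'].
apply/seteqP; split => w /=.
  by move=> [H1 H2] t _; split; case: ifPn => // tJ; [exact: H1|exact: H2].
move=> H; split => t /= tJ; have := H t; rewrite /= inE tJ ?orbT => /(_ isT);
  by case.
Qed.

Let incr_sigma i (C : set nat) : <<s times_cyl >> (count_incr i @^-1` C).
Proof.
pose G := g_sigma_algebraType times_cyl.
have NG t A : 0 <= t -> measurable (N t @^-1` A : set G).
  move=> t0; apply: sub_sigma_algebra; exists [fset t]%fset, (fun=> A); split.
    by move=> s /=; rewrite inE => /eqP ->.
  apply/seteqP; split => w /=; first by move=> NA s /=; rewrite inE => /eqP ->.
  by move=> /(_ t); apply; rewrite /= inE.
rewrite (_ : _ @^-1` _ = \bigcup_n \bigcup_m (if (n - m)%N \in C then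
  N (i.+1%:R * h) @^-1` [set n] `&` N (i%:R * h) @^-1` [set m] else set0)).
  apply: (@bigcupT_measurable _ G) => n; apply: (@bigcupT_measurable _ G) => m.
  by case: ifP => // _; apply: (@measurableI _ G); apply: NG; rewrite mulr_ge0.
apply/seteqP; split => w /=.
  move=> Cx; exists (N (i.+1%:R * h) w) => //; exists (N (i%:R * h) w) => //.
  by rewrite mem_set.
by move=> [n _ [m _]]; case: ifPn => //; rewrite inE /count_incr => nmC [-> ->].
Qed.

Let mincr i C : measurable (count_incr i @^-1` C).
Proof.
exact: (smallest_sub (@sigma_algebra_measurable _ T) times_cyl_m) (incr_sigma i C).
Qed.

Let q (C : set nat) := poisson_prob (rate * h) 0 C.

(** The product depends on the sets of the cylinder but not on the position of the path, which is
    the source of the renewal property. Counts and sizes are separated by [indep_sigma], after which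
    each family is independent by itself. *)
Lemma count_claims_law (L L' : nat) (C : nat -> set nat) (B : nat -> set R) :
  (forall i, measurable (B i)) ->
  P ([set w | forall i, (i < L)%N -> C i (count_incr i w)] `&`
     [set w | forall i, (i < L')%N -> B i (U i w)]) =
  (\prod_(i < L) q (C i) * \prod_(i < L') F (B i))%E.
Proof.
case: clNU => -[_ _ _ indN lawN] indU lawU indNU mB.
set EN := [set w | _]; set EU := [set w | _].
have EUE : EU = \bigcap_(i in [set` seq_fset tt (iota 0 L')]) (U i @^-1` B i).
  by rewrite bigcap_seq_fset.
have ENE : EN = \bigcap_(i in [set` seq_fset tt (iota 0 L)]) (count_incr i @^-1` C i).
  by rewrite bigcap_seq_fset.
have mEU : measurable EU.
  by rewrite EUE; apply: fin_bigcap_measurable => // *; exact: mU.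
rewrite (indep_sigma mEU times_cyl_m times_cylI times_cylT); last 2 first.
- move=> _ [J [A [J0 ->]]]; rewrite EUE.
  exact: (indNU J (seq_fset tt (iota 0 L')) A B J0 (fun i => Logic.I) mB).
- rewrite ENE.
  by apply: (@fin_bigcap_measurable _ (g_sigma_algebraType times_cyl)) => // *; exact: incr_sigma.
congr (_ * _)%E.
- rewrite ENE.
  have := indN (fun i => i%:R * h).
  rewrite /= mul0r lexx => /(_ isT).
  have ht : {homo (fun i : nat => i%:R * h) : i j / (i <= j)%N >-> i <= j}.
    by move=> i j ij; rewrite ler_wpM2r// ler_nat.
  move=> /(_ ht) /(_ (seq_fset tt (iota 0 L)) C (fun=> Logic.I)) ->.
  rewrite prod_seq_fset; apply: eq_bigr => i _.
  rewrite lawN ?mulr_ge0 ?ht//.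
  by rewrite -mulrBl -natrB// subSnn mul1r.
- by rewrite EUE indU// prod_seq_fset; apply: eq_bigr => i _; exact: lawU.
Qed.

Definition claims_path (n m : nat) (w : T) : path R :=
  ((fun i => count_incr (n + i)%N w), (fun i => U (m + i)%N w)).

Lemma measurable_claims_path n m : measurable_fun setT (claims_path n m).
Proof.
apply: (@measurable_to_path _ _ _ (fun i => count_incr (n + i)) (fun i => U (m + i)%N)) => i.
- by move=> _ C _; rewrite setTI; exact: mincr.
- exact: measurable_funPT.
Qed.

(* After a first time step with no claim (resp. one claim), the remaining path
   has the law of the whole path. *)
Lemma claims_path_law0 (S : set (path R)) : measurable S ->
  P (N h @^-1` [set 0%N] `&` claims_path 1 0 @^-1` S) =
  (q [set 0%N] * P (claims_path 0 0 @^-1` S))%E.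
Proof.
have q0 : q [set 0%N] \is a fin_num by rewrite fin_num_measure.
move=> mS; rewrite -[in RHS](fineK q0).
apply: (@law_eq_scale _ _ _ P _ (path R) path_cyl) mS => //.
- exact: path_cylI.
- exact: path_cylT.
- exact: measurable_claims_path.
- exact: measurable_claims_path.
- exact: fine_ge0.
move=> _ [L [C [B [mB ->]]]]; rewrite fineK//.
(* Prescribing [0] claims in the first step lengthens the cylinder by one coordinate, so that both
   sides become instances of [count_claims_law]. *)
pose C' i := if i is j.+1 then C j else [set 0%N].
transitivity (P ([set w | forall i, (i < L.+1)%N -> C' i (count_incr i w)] `&`
     [set w | forall i, (i < L)%N -> B i (U i w)])).
  congr (P _); apply/seteqP; split => w /=.
    move=> [Nh H]; split=> i; last by move=> /H[].
    by case: i => [_|i /H[]//]; rewrite /= /count_incr mul1r mul0r N0 subn0.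
  move=> [H1 H2]; split.
    by have := H1 0%N isT; rewrite /= /count_incr mul1r mul0r N0 subn0.
  by move=> i iL; split; [exact: (H1 i.+1)|exact: H2].
rewrite count_claims_law// big_ord_recl/= -muleA -count_claims_law//.
congr (_ * P _)%E; apply/seteqP; split => w /=.
  by move=> [H1 H2] i iL; split; [exact: H1|exact: H2].
by move=> H; split=> i /H[].
Qed.

Lemma claims_path_law1 (A : set R) (S : set (path R)) : measurable A -> measurable S ->
  P (N h @^-1` [set 1%N] `&` U 0%N @^-1` A `&` claims_path 1 1 @^-1` S) =
  (q [set 1%N] * F A * P (claims_path 0 0 @^-1` S))%E.
Proof.
move=> mA mS.
have FA : F A = P (U 0%N @^-1` A) by case: clNU => _ _ ->.
have q1 : (q [set 1%N] * F A)%E \is a fin_num.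
  by rewrite FA fin_numM// fin_num_measure//; exact: mU.
rewrite -[in RHS](fineK q1).
apply: (@law_eq_scale _ _ _ P _ (path R) path_cyl) mS => //.
- by apply: measurableI; [exact: mN|exact: mU].
- exact: path_cylI.
- exact: path_cylT.
- exact: measurable_claims_path.
- exact: measurable_claims_path.
- by rewrite fine_ge0// mule_ge0// FA.
move=> _ [L [C [B [mB ->]]]]; rewrite fineK//.
pose C' i := if i is j.+1 then C j else [set 1%N].
pose B' i := if i is j.+1 then B j else A.
transitivity (P ([set w | forall i, (i < L.+1)%N -> C' i (count_incr i w)] `&`
     [set w | forall i, (i < L.+1)%N -> B' i (U i w)])).
  congr (P _); apply/seteqP; split => w /=.
    move=> [[Nh UA] H]; split; last by case=> [_|i /H[]].
    by case=> [_|i /H[]//]; rewrite /= /count_incr mul1r mul0r N0 subn0.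
  move=> [H1 H2]; split; first split.
  - by have := H1 0%N isT; rewrite /= /count_incr mul1r mul0r N0 subn0.
  - exact: (H2 0%N).
  by move=> i iL; split; [exact: (H1 i.+1)|exact: (H2 i.+1)].
rewrite count_claims_law//; last by case.
rewrite !big_ord_recl/= muleACA -count_claims_law//.
congr (_ * P _)%E; apply/seteqP; split => w /=.
  by move=> [H1 H2] i iL; split; [exact: H1|exact: H2].
by move=> H; split=> i /H[].
Qed.

End claims_paths.

Section poisson_small.
Context {R : realType}.

Lemma poisson_prob_set1_0 (r : R) : 0 <= r ->
  poisson_prob r 0 [set 0%N] = (expR (- r))%:E.
Proof.
rewrite le_eqVlt => /predU1P[<-|r0].
  by rewrite /poisson_prob ltxx diracE mem_set// oppr0 expR0.
by rewrite /poisson_prob r0 esum_set1 ?lee_fin ?poisson_pmf_ge0// /poisson_pmf r0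
  expr0 fact0 invr1 !mul1r.
Qed.

Lemma poisson_prob_set1_1 (r : R) : 0 <= r ->
  poisson_prob r 0 [set 1%N] = (r * expR (- r))%:E.
Proof.
rewrite le_eqVlt => /predU1P[<-|r0].
  by rewrite /poisson_prob ltxx diracE memNset// mul0r.
by rewrite /poisson_prob r0 esum_set1 ?lee_fin ?poisson_pmf_ge0// /poisson_pmf r0
  expr1 (_ : 1%N`! = 1%N)// invr1 mulr1.
Qed.

End poisson_small.

(** * Inequalities from the first time step *)

Section first_step.
Context {R : realType} {d : measure_display} {T : measurableType d}.
Variables (P : probability T R) (rate : R) (F : set R -> \bar R).
Variables (N : R -> {RV P >-> nat}) (U : nat -> {RV P >-> R}).
Hypothesis clNU : cramer_lundberg rate F N U.
Hypothesis rate0 : 0 <= rate.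
Variable h : R.
Hypothesis h0 : 0 <= h.
Local Notation cpath := (claims_path N U h).

(** [H] collects the grid steps at which solvency is tested: all of them for the infinite horizon,
    an initial segment for a finite one. *)
Definition grid_safe (H : set nat) (u : R) : set T :=
  [set w | forall k, H k -> \sum_(i < N (k%:R * h) w) U i w <= u + k%:R * h].

Definition grid_survival (H : set nat) (u : R) : R := fine (P (grid_safe H u)).

Definition path_safe (H : set nat) (u : R) : set (path R) :=
  [set x | forall k, H k -> path_claims k x <= u + k%:R * h].

(** The capital [f w] varies with [w] because a first claim leaves [u + h - U 0 w]. *)
Lemma measurable_path_safe_comp d' (T' : measurableType d') (H : set nat)
    (p : T' -> path R) (f : T' -> R) : measurable_fun setT p -> measurable_fun setT f ->
  measurable [set w | path_safe H (f w) (p w)].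
Proof.
move=> mp mf; rewrite (_ : [set _ | _] = \bigcap_k (if `[< H k >] then
  [set w | path_claims k (p w) <= f w + k%:R * h] else setT)).
  apply: bigcapT_measurable => k; case: ifP => // _.
  apply: measurable_path_claims_le => //.
  by apply: measurable_funD => //; exact: measurable_cst.
apply/seteqP; split => w /= Hw k; first by move=> _; case: asboolP => // /Hw.
by move=> Hk; have := Hw k Logic.I; case: asboolP.
Qed.

Lemma measurable_path_safe H u : measurable (path_safe H u).
Proof.
exact: (@measurable_path_safe_comp _ (path R) H id (fun=> u)).
Qed.

Lemma grid_safeE H u : grid_safe H u = cpath 0 0 @^-1` path_safe H u.
Proof.
apply/seteqP; split => w /= Hw k Hk; have := Hw k Hk;
  by rewrite /path_claims /path_count /= (N_count_incr clNU).
Qed.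

Lemma measurable_grid_safe H u : measurable (grid_safe H u).
Proof.
rewrite grid_safeE -[X in measurable X]setTI.
exact: (measurable_claims_path N U h0 0 0 measurableT (measurable_path_safe H u)).
Qed.

Lemma grid_survivalE H u : P (grid_safe H u) = (grid_survival H u)%:E.
Proof. by rewrite fineK// fin_num_measure//; exact: measurable_grid_safe. Qed.

Lemma grid_survival_bounds H u : 0 <= grid_survival H u <= 1.
Proof.
rewrite fine_ge0//= -lee_fin -grid_survivalE.
exact: probability_le1 (measurable_grid_safe H u).
Qed.

Lemma grid_survival_nd H : nondecreasing_fun (grid_survival H).
Proof.
move=> u v uv; rewrite -lee_fin -!grid_survivalE le_measure ?inE//;
  try exact: measurable_grid_safe.
by move=> w Hw k Hk; rewrite (le_trans (Hw k Hk))// lerD2r.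
Qed.

Lemma grid_survival_lt0 (H : set nat) u : H 0%N -> u < 0 -> grid_survival H u = 0.
Proof.
move=> H0 u0; rewrite /grid_survival (_ : grid_safe H u = set0) ?measure0//.
apply/seteqP; split => w // /(_ _ H0).
have N0 : N 0 w = 0%N by case: clNU => -[].
by rewrite mul0r N0 big_ord0 addr0 leNgt u0.
Qed.

Lemma path_count_shift w k m n :
  path_count k.+1 (cpath 0 m w) = (N h w + path_count k (cpath 1 n w))%N.
Proof.
rewrite /path_count big_ord_recl; congr addn.
have N0 : N 0 w = 0%N by case: clNU => -[].
by rewrite /= /count_incr mul1r mul0r N0 subn0.
Qed.

Lemma path_claimsS0 w k : N h w = 0%N ->
  path_claims k.+1 (cpath 0 0 w) = path_claims k (cpath 1 0 w).
Proof. by move=> Nh; rewrite /path_claims (path_count_shift w k 0 0) Nh. Qed.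

Lemma path_claimsS1 w k : N h w = 1%N ->
  path_claims k.+1 (cpath 0 0 w) = U 0%N w + path_claims k (cpath 1 1 w).
Proof.
by move=> Nh; rewrite /path_claims (path_count_shift w k 0 1) Nh add1n big_ord_recl.
Qed.

(** During the first step the premium [h] is earned and no claim ([step0]) or one claim ([step1]) is
    paid. Two or more claims have probability of order [h ^+ 2], negligible even after division by
    [h]. *)
Definition step0 (H : set nat) (u : R) : set T :=
  N h @^-1` [set 0%N] `&` cpath 1 0 @^-1` path_safe H (u + h).

Definition step1 (H : set nat) (u : R) : set T :=
  N h @^-1` [set 1%N] `&`
  [set w | path_safe H (u + h - U 0%N w) (cpath 1 1 w)].

Lemma measurable_step0 H u : measurable (step0 H u).
Proof.
apply: measurableI; first exact: measurable_funPTI.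
rewrite -[X in measurable X]setTI.
by apply: (measurable_claims_path N U h0 1 0) => //; exact: measurable_path_safe.
Qed.

Lemma measurable_step1 H u : measurable (step1 H u).
Proof.
apply: measurableI; first exact: measurable_funPTI.
apply: measurable_path_safe_comp.
  exact: (measurable_claims_path N U h0 1 1).
apply: measurable_funB; first exact: measurable_cst.
exact: measurable_funPT.
Qed.

Let E0 : poisson_prob (rate * h) 0 [set 0%N] = (expR (- (rate * h)))%:E.
Proof. by rewrite poisson_prob_set1_0// mulr_ge0. Qed.

Let E1 : poisson_prob (rate * h) 0 [set 1%N] = (rate * h * expR (- (rate * h)))%:E.
Proof. by rewrite poisson_prob_set1_1// mulr_ge0. Qed.

Lemma step0_prob H u :
  P (step0 H u) = (expR (- (rate * h)) * grid_survival H (u + h))%:E.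
Proof.
rewrite /step0 (claims_path_law0 clNU h0)//; last exact: measurable_path_safe.
by rewrite E0 EFinM -grid_survivalE grid_safeE.
Qed.

(** On [N h = 1] the first claim and the remaining path have, by uniqueness on rectangles, a
    multiple of the product law; the integral over the first claim is the section formula of the
    product measure. *)
Lemma step1_prob H u :
  P (step1 H u) = ((rate * h * expR (- (rate * h)))%:E *
    \int[distribution P (U 0%N)]_x (grid_survival H (u + h - x))%:E)%E.
Proof.
pose V := mfun_Sub (mem_set (measurable_claims_path N U h0 0 0)) : {mfun T >-> path R}.
pose S : set (R * path R) := [set z | path_safe H (u + h - z.1) z.2].
have mS : measurable S.
  apply: measurable_path_safe_comp; first exact: measurable_snd.
  by apply: measurable_funB; [exact: measurable_cst|exact: measurable_fst].
pose G : set (set (R * path R)) := [set A `*` B | A in measurable & B in measurable].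
have mN1 : measurable (N h @^-1` [set 1%N]) by exact: measurable_funPTI.
pose f w : R * path R := (U 0%N w, cpath 1 1 w).
have mf : measurable_fun setT f.
  by apply: measurable_fun_pair; [exact: measurable_funPT|exact: (measurable_claims_path N U h0 1 1)].
have c0 : 0 <= rate * h * expR (- (rate * h)) by rewrite !mulr_ge0// expR_ge0.
pose m1 : {measure set R -> \bar R} := distribution P (U 0%N).
transitivity ((mscale (NngNum c0) (distribution P (U 0%N) \x distribution P V)%E) S).
  rewrite /step1 setIC.
  have mG : (measurable : set (set (R * path R))) = <<s G >>.
    by rewrite measurable_prod_measurableType.
  have GI : setI_closed G.
    move=> _ _ [A mA [B mB <-]] [A' mA' [B' mB' <-]]; rewrite -setXI.
    by exists (A `&` A'); [exact: measurableI|exists (B `&` B') => //; exact: measurableI].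
  apply: (@measure_unique _ _ _ G (fun=> setT) mG GI _ _
    (pushforward (mrestr P mN1) f)
    (mscale (NngNum c0) (distribution P (U 0%N) \x distribution P V)%E)) => //=.
  - by move=> _; exists setT => //; exists setT => //; rewrite setXTT.
  - by rewrite bigcup_const.
  - move=> _ [A mA [B mB <-]].
    rewrite /pushforward /mrestr /mscale/= product_measure1E//=.
    transitivity (P (N h @^-1` [set 1%N] `&` U 0%N @^-1` A `&` cpath 1 1 @^-1` B)).
      congr (P _); apply/seteqP; split => w /=; first by move=> [[? ?] ?].
      by move=> [[? ?] ?].
    rewrite (claims_path_law1 clNU h0)// E1 muleA.
    have -> : F A = P (U 0%N @^-1` A) by case: clNU => _ _ ->.
    by [].
  - by move=> _; rewrite /pushforward /mrestr/= ltey_eq fin_num_measure// preimage_setT setTI.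
rewrite /mscale/= /product_measure1/=; congr (_ * _)%E.
apply: eq_integral => x _; rewrite /= -grid_survivalE grid_safeE /distribution /pushforward/=.
congr (P _); apply/seteqP; split => w /=; by rewrite /xsection/= inE.
Qed.

Lemma step_disjoint H u : step0 H u `&` step1 H u = set0.
Proof. by apply/seteqP; split => // w [[+ _] [+ _]] => /= ->. Qed.

(** The constraint at step [k + 1] on the whole path is the one at step [k] on the remaining path,
    whence the closure of [H] under predecessors; at step 0 the constraint is [0 <= u]. *)
Lemma step_sub (H : set nat) u : (forall k, H k.+1 -> H k) -> 0 <= u ->
  step0 H u `|` step1 H u `<=` grid_safe H u.
Proof.
move=> HS u0; rewrite grid_safeE => w [[/= Nh Hw]|[/= Nh Hw]] [|k] Hk.
- by rewrite /path_claims path_count0 big_ord0 mul0r addr0.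
- rewrite path_claimsS0//; have := Hw k (HS k Hk).
  by rewrite -[k.+1]add1n natrD mulrDl mul1r addrA.
- by rewrite /path_claims path_count0 big_ord0 mul0r addr0.
- rewrite path_claimsS1//; have := Hw k (HS k Hk).
  by rewrite -[k.+1]add1n natrD mulrDl mul1r; lra.
Qed.

Lemma step_sup u : grid_safe setT u `<=`
  step0 setT u `|` step1 setT u `|` N h @^-1` (~` [set 0%N; 1%N]).
Proof.
rewrite grid_safeE => w /= Hw.
have [Nh|Nh0] := eqVneq (N h w) 0%N.
  left; left; split => //= k _; have := Hw k.+1 Logic.I.
  by rewrite path_claimsS0// -[k.+1]add1n natrD mulrDl mul1r addrA.
have [Nh|Nh1] := eqVneq (N h w) 1%N.
  left; right; split => //= k _; have := Hw k.+1 Logic.I.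
  by rewrite path_claimsS1// -[k.+1]add1n natrD mulrDl mul1r; lra.
by right => /= -[] /eqP; apply/negP.
Qed.

(* The remaining path is asked to survive all of H, which is more than what is
   left of a finite horizon; so the reverse inequality needs all grid times. *)
Lemma first_step_ge (H : set nat) u : (forall k, H k.+1 -> H k) -> 0 <= u ->
  ((expR (- (rate * h)) * grid_survival H (u + h))%:E +
   (rate * h * expR (- (rate * h)))%:E *
    \int[distribution P (U 0%N)]_x (grid_survival H (u + h - x))%:E <=
  (grid_survival H u)%:E)%E.
Proof.
move=> HS u0; rewrite -step0_prob -step1_prob -grid_survivalE.
have m0 := measurable_step0 H u; have m1 := measurable_step1 H u.
rewrite -measureU//; last exact: step_disjoint.
by apply: le_measure; rewrite ?inE; [exact: measurableU|exact: measurable_grid_safe|exact: step_sub].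
Qed.

(** The last summand is the probability of at least two claims, on which survival is simply
    granted. *)
Lemma first_step_le u :
  ((grid_survival setT u)%:E <=
   (expR (- (rate * h)) * grid_survival setT (u + h))%:E +
   (rate * h * expR (- (rate * h)))%:E *
    \int[distribution P (U 0%N)]_x (grid_survival setT (u + h - x))%:E +
   (1 - expR (- (rate * h)) - rate * h * expR (- (rate * h)))%:E)%E.
Proof.
rewrite -step0_prob -step1_prob -grid_survivalE.
have m0 := measurable_step0 setT u; have m1 := measurable_step1 setT u.
have mN2 : measurable (N h @^-1` (~` [set 0%N; 1%N])) by exact: measurable_funPTI.
have -> : (1 - expR (- (rate * h)) - rate * h * expR (- (rate * h)))%:E =
    P (N h @^-1` (~` [set 0%N; 1%N])).
  have lawN A : P (N h @^-1` A) = poisson_prob (rate * h) 0 A.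
    case: clNU => -[N0 _ _ _ lawN] _ _ _; rewrite -[h in RHS]subr0 -lawN//.
    by congr (P _); apply/seteqP; split => w /=; rewrite N0 subn0.
  rewrite lawN probability_setC// measureU//; last first.
    by apply/seteqP; split => // n [/= ->].
  by rewrite /= E0 E1 /=; congr EFin; ring.
apply: (@le_trans _ _ (P (step0 setT u `|` step1 setT u `|` N h @^-1` (~` [set 0%N; 1%N])))).
  apply: le_measure; rewrite ?inE; [exact: measurable_grid_safe| |exact: step_sup].
  by apply: measurableU => //; exact: measurableU.
by rewrite (le_trans (measureU2 _ _ _))//; [exact: measurableU|rewrite leeD2r// measureU2].
Qed.

End first_step.

(** * The renewal equation *)

Section claim_average.
Context {R : realType}.
Local Notation mu := (@lebesgue_measure R).
Variable nu : probability R R.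
Hypothesis nu_ge0 : nu `]-oo, 0[%classic = 0%E.
Local Notation G x := (fine (nu `]-oo, x]%classic)).

Lemma nu_cdfE x : nu `]-oo, x]%classic = (G x)%:E.
Proof. by rewrite fineK// fin_num_measure. Qed.

Lemma nu_cdf_bounds x : 0 <= G x <= 1.
Proof. by rewrite fine_ge0//= -lee_fin -nu_cdfE probability_le1. Qed.

Lemma nu_cdf_nd : nondecreasing_fun (fun x => G x).
Proof.
move=> x y xy; rewrite -lee_fin -!nu_cdfE le_measure ?inE//.
by apply: subset_itvl; rewrite bnd_simp.
Qed.

Lemma bmeas_nu_cdf : bmeas (fun x => G x).
Proof. exact: bmeas_nondecreasing nu_cdf_nd nu_cdf_bounds. Qed.

(** Tonelli on the region [0 <= y], [x + y <= v]: integrating over [x] first leaves the distribution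
    function at [v - y]. *)
Lemma integral_primitive (c : R -> R) v : bmeas c -> (forall y : R, 0 <= c y) -> 0 <= v ->
  (\int[nu]_x (\int[mu]_(y in `[0%R, (v - x)%R]) c y)%:E =
   (\int[mu]_(y in `[0, v]) (c y * G (v - y)))%:E)%E.
Proof.
move=> bc c0 v0.
pose D : set R := `[0, v]%classic.
pose f (z : R * R) : \bar R :=
  (c z.2 * \1_D z.2 * \1_[set x : R | 0 <= x] (v - z.2 - z.1))%:E.
have mf : measurable_fun setT f.
  apply/measurable_EFinP; apply: measurable_funM.
    apply: measurable_funM => //; first exact: (measurableT_comp bc.1).
    by apply: measurableT_comp => //; apply: measurable_indic; exact: measurable_itv.
  apply: measurableT_comp.
    apply: measurable_indic; rewrite (_ : [set _ | _] = `[0, +oo[%classic)//.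
    by apply/seteqP; split => x /=; rewrite in_itv/= andbT.
  by apply: measurable_funB => //; apply: measurable_funB => //; exact: measurable_cst.
have f_ge0 z : (0 <= f z)%E by rewrite lee_fin !mulr_ge0.
have bcG : bmeas (fun y => c y * G (v - y)).
  by apply: bmeasM => //; exact: bmeas_subr bmeas_nu_cdf.
rewrite /Rintegral [RHS]fineK; last exact: integrable_fin_num (bmeas_integrable _ _ bcG).
transitivity (\int[mu]_y \int[nu]_x f (x, y))%E; last first.
  rewrite [RHS]integral_mkcond; apply: eq_integral => y _.
  rewrite patchE; case: ifPn => yD.
    rewrite EFinM -nu_cdfE -[X in nu X]setIT -integral_indic//.
    rewrite -ge0_integralZl_EFin//; last by apply/measurable_EFinP; exact: measurable_indic.
    apply: eq_integral => x _.
    rewrite /f/= indicE yD mulr1 -EFinM !indicE; congr (_ * _%:R)%:E.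
    by congr nat_of_bool; apply/idP/idP; rewrite !inE/= in_itv/= subr_ge0.
  rewrite integral0_eq// => x _.
  by rewrite /f/= indicE (negbTE yD) mulr0 mul0r.
rewrite -(fubini_tonelli (m1 := nu) (m2 := mu) f)//.
have E (x : R) : 0 <= x -> ((fine (\int[mu]_(y in `[0%R, (v - x)%R]) (c y)%:E))%:E =
    \int[mu]_y f (x, y))%E.
  move=> x0; rewrite fineK; last exact: integrable_fin_num (bmeas_integrable _ _ bc).
  rewrite [LHS]integral_mkcond; apply: eq_integral => y _.
  rewrite patchE /f/= !indicE; case: ifPn => [/set_mem|/negP Hy].
    rewrite /= in_itv/= => Hy; rewrite !mem_set ?mulr1//=; first lra.
    by rewrite /D/= in_itv/=; lra.
  have [yD|yD] := boolP (y \in D); last by rewrite mulr0 mul0r.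
  rewrite [X in _ * X](_ : _ = 0) ?mulr0//.
  rewrite memNset//= => Hvy; apply: Hy; rewrite mem_set//= in_itv/=.
  by move: yD; rewrite inE/D/= in_itv/=; lra.
have mF := measurable_fun_fubini_tonelli_F (m2 := mu) f mf f_ge0.
apply: ae_eq_integral => //.
  apply/measurable_EFinP; apply: nonincreasing_measurable => // x y xy.
  by apply: le_cint_itv => //; rewrite lerD2l lerN2.
(* The integrands can differ only for [x < 0], where [[0, v - x]] sticks out of [[0, v]]; there [nu]
   has no mass. *)
exists (`]-oo, 0[%classic); split => // x /= Hx; rewrite in_itv/=.
by apply: contrapT => /negP; rewrite -leNgt => x0; apply: Hx => _; exact: E.
Qed.

Variable phi : R -> R.
Hypothesis phi_nd : nondecreasing_fun phi.
Hypothesis phi01 : forall x, 0 <= phi x <= 1.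
Hypothesis phi_lt0 : forall x : R, x < 0 -> phi x = 0.

Let phi0 x : 0 <= phi x. Proof. by case/andP: (phi01 x). Qed.
Let phi1 x : phi x <= 1. Proof. by case/andP: (phi01 x). Qed.
Let bphi : bmeas phi. Proof. exact: bmeas_nondecreasing phi_nd phi01. Qed.

Definition claim_average u : R := fine (\int[nu]_x (phi (u - x))%:E)%E.

Let mphi u : measurable_fun setT (fun x : R => (phi (u - x))%:E).
Proof. by apply/measurable_EFinP; exact: (bmeas_subr u bphi).1. Qed.

Let int_le1 (u : R) : (\int[nu]_x (phi (u - x))%:E <= 1)%E.
Proof.
apply: (@le_trans _ _ (\int[nu]_x (cst 1%E) x)%E).
  by apply: ge0_le_integral => //; rewrite /= => x _; rewrite lee_fin.
by rewrite integral_cst//= mul1e; exact: probability_le1.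
Qed.

Lemma claim_averageE (u : R) : (\int[nu]_x (phi (u - x))%:E = (claim_average u)%:E)%E.
Proof.
rewrite fineK// ge0_fin_numE; first exact: le_lt_trans (int_le1 u) (ltry _).
by apply: integral_ge0 => x _; rewrite lee_fin.
Qed.

Lemma claim_average_bounds u : 0 <= claim_average u <= 1.
Proof.
rewrite fine_ge0/= -?lee_fin -?claim_averageE//.
by apply: integral_ge0 => x _; rewrite lee_fin.
Qed.

Lemma claim_average_nd : nondecreasing_fun claim_average.
Proof.
move=> u v uv; rewrite -lee_fin -!claim_averageE.
apply: ge0_le_integral => //= x _; rewrite lee_fin //.
by apply: phi_nd; rewrite lerD2r.
Qed.

Lemma bmeas_claim_average : bmeas claim_average.
Proof. exact: bmeas_nondecreasing claim_average_nd claim_average_bounds. Qed.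

(** Tonelli exchanges capital and claim size. As [phi] vanishes below 0, for [x >= 0] the integral
    of [phi (u - x)] over [u] in [[0, v]] is that of [phi] over [[0, v - x]], to which
    [integral_primitive] applies. *)
Lemma cint_claim_average v : 0 <= v ->
  \int[mu]_(u in `[0, v]) claim_average u =
  \int[mu]_(w in `[0, v]) (phi w * G (v - w)).
Proof.
move=> v0; apply: EFin_inj; rewrite -integral_primitive//.
rewrite /Rintegral fineK; last first.
  exact: integrable_fin_num (bmeas_integrable _ _ bmeas_claim_average).
pose D : set R := `[0, v]%classic.
pose f (z : R * R) : \bar R := (phi (z.2 - z.1) * \1_D z.2)%:E.
have mf : measurable_fun setT f.
  apply/measurable_EFinP; apply: measurable_funM => //.
    by apply: (measurableT_comp bphi.1); apply: measurable_funB.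
  by apply: measurableT_comp => //; apply: measurable_indic; exact: measurable_itv.
have f_ge0 z : (0 <= f z)%E by rewrite lee_fin mulr_ge0.
transitivity (\int[mu]_u \int[nu]_x f (x, u))%E.
  rewrite integral_mkcond; apply: eq_integral => u _.
  rewrite patchE; case: ifPn => uD.
    rewrite -claim_averageE; apply: eq_integral => x _.
    by rewrite /f/= indicE uD mulr1.
  rewrite integral0_eq// => x _.
  by rewrite /f/= indicE (negbTE uD) mulr0.
rewrite -(fubini_tonelli (m1 := nu) (m2 := mu) f)//.
apply: ae_eq_integral => //.
- exact: (measurable_fun_fubini_tonelli_F (m2 := mu) f).
- apply/measurable_EFinP; apply: nonincreasing_measurable => // x y xy.
  by apply: le_cint_itv => //; rewrite lerD2l lerN2.
exists (`]-oo, 0[%classic); split => // x /= Hx; rewrite in_itv/=.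
apply: contrapT => /negP; rewrite -leNgt => x0; apply: Hx => _.
rewrite fineK; last exact: integrable_fin_num (bmeas_integrable _ _ bphi).
transitivity (\int[mu]_(y in D) (phi (y - x))%:E)%E.
  rewrite [RHS]integral_mkcond; apply: eq_integral => y _.
  by rewrite patchE /f/= indicE; case: ifP => _; rewrite ?mulr1 ?mulr0.
have H := f_equal (@EFin R) (cint_shift 0 v (- x) bphi).
rewrite addr0 [- x + v]addrC /Rintegral !fineK in H; last 2 first.
  exact: integrable_fin_num (bmeas_integrable _ _ bphi).
  exact: integrable_fin_num (bmeas_integrable _ _ (bmeas_addl _ bphi)).
under eq_integral do rewrite addrC.
rewrite {}H [LHS]integral_mkcond [RHS]integral_mkcond; apply: eq_integral => y _.
rewrite !patchE; have [y0|y0] := ltP y 0.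
  by rewrite phi_lt0//; case: ifP; case: ifP.
congr (if _ then _ else _); apply/idP/idP; rewrite !inE/= !in_itv/=; lra.
Qed.

End claim_average.

(** * The integrated inequalities at a fixed mesh *)

Section renewal_step.
Context {R : realType}.
Local Notation mu := (@lebesgue_measure R).
Variable nu : probability R R.
Hypothesis nu_ge0 : nu `]-oo, 0[%classic = 0%E.
Local Notation G x := (fine (nu `]-oo, x]%classic)).
Variables (lambda h : R).
Hypotheses (lambda0 : 0 <= lambda) (h0 : 0 < h).
Variables phi psi : R -> R.
Hypothesis phi_nd : nondecreasing_fun phi.
Hypothesis phi01 : forall x, 0 <= phi x <= 1.
Hypothesis psi_nd : nondecreasing_fun psi.
Hypothesis psi01 : forall x, 0 <= psi x <= 1.
Hypothesis psi_lt0 : forall x : R, x < 0 -> psi x = 0.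
Hypothesis phi_psi : forall x, phi x <= psi x <= phi (x + h).

Let bphi : bmeas phi. Proof. exact: bmeas_nondecreasing phi_nd phi01. Qed.
Let bpsi : bmeas psi. Proof. exact: bmeas_nondecreasing psi_nd psi01. Qed.
Let bG v : bmeas (fun w => G (v - w)).
Proof. exact: (bmeas_subr v (bmeas_nu_cdf nu)). Qed.
Let G01 x : 0 <= G x <= 1. Proof. exact: nu_cdf_bounds. Qed.

Let phi_shift_le v : 0 <= v ->
  \int[mu]_(w in `[0, v]) phi (h + w) <= \int[mu]_(w in `[0, v]) phi w + h.
Proof.
move=> v0; rewrite cint_shift// addr0.
have hv : h <= h + v by rewrite lerDl.
have v0h : 0 <= v <= h + v by rewrite v0 lerDr ltW.
have /andP[_ vh] := v0h.
apply: (@le_trans _ _ (\int[mu]_(w in `[0, h + v]) phi w)).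
  by apply: le_cint_itv => //; [move=> x; case/andP: (phi01 x)|exact: ltW].
rewrite (cint_split bphi v0 vh) lerD2l.
apply: (@le_trans _ _ (\int[mu]_(w in `[v, h + v]) 1)).
  by apply: le_cint => //; [exact: bmeas_cst|move=> x _; case/andP: (phi01 x)].
by rewrite cint_cst// mul1r addrK.
Qed.

Let psi_shiftE v : 0 <= v ->
  \int[mu]_(w in `[0, v]) psi (w + h) =
  \int[mu]_(w in `[0, v]) psi w - \int[mu]_(w in `[0, h]) psi w +
  \int[mu]_(w in `[v, v + h]) psi w.
Proof.
move=> v0; under eq_Rintegral do rewrite addrC.
rewrite cint_shift// addr0 [h + v]addrC.
have h0' := ltW h0.
have hv : h <= v + h by rewrite lerDr.
have vh : v <= v + h by rewrite lerDl.
have := cint_split bpsi h0' hv; rewrite (cint_split bpsi v0 vh).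
by move=> /eqP; rewrite addrC -subr_eq => /eqP <-; ring.
Qed.

Let cint_const_le a b c : a <= b -> (forall x, a <= x <= b -> psi x <= c) ->
  \int[mu]_(w in `[a, b]) psi w <= c * (b - a).
Proof.
by move=> ab H; rewrite -cint_cst//; apply: le_cint => //; exact: bmeas_cst.
Qed.

Let cint_const_ge a b c : a <= b -> (forall x, a <= x <= b -> c <= psi x) ->
  c * (b - a) <= \int[mu]_(w in `[a, b]) psi w.
Proof.
by move=> ab H; rewrite -cint_cst//; apply: le_cint => //; exact: bmeas_cst.
Qed.

Let p := expR (- (lambda * h)).
Let p_ge : 1 - lambda * h <= p. Proof. exact: expR_ge1Dx. Qed.
Let p_le1 : p <= 1. Proof. by rewrite expR_le1 oppr_le0 mulr_ge0// ltW. Qed.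
Let q_le : 1 - p <= lambda * h. Proof. by rewrite lerBlDr -lerBlDl. Qed.
Let q_ge0 : 0 <= 1 - p. Proof. by rewrite subr_ge0. Qed.
Let lh0 : 0 <= lambda * h. Proof. by rewrite mulr_ge0// ltW. Qed.

Let bca := bmeas_claim_average nu psi_nd psi01.

Let psiG_ge v : \int[mu]_(w in `[0, v]) (phi w * G (v - w)) <=
  \int[mu]_(w in `[0, v]) (psi w * G (v - w)).
Proof.
apply: le_cint => [||x _]; [exact: bmeasM|exact: bmeasM|].
by apply: ler_wpM2r; [case/andP: (G01 (v - x))|case/andP: (phi_psi x)].
Qed.

(** In the application [psi] is the survival probability on the grid of mesh [h] and [phi] the one
    in continuous time. Over [[0, v]] the integrals of [psi u] and [psi (u + h)] differ only by
    integrals over [[0, h]] and [[v, v + h]]; divided by [h], these are close to [phi 0] and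
    [phi v]. *)
Lemma renewal_step_ge v : 0 <= v ->
  (forall u, 0 <= u -> p * psi (u + h) + lambda * h * p * claim_average nu psi (u + h)
    <= psi u) ->
  phi v - phi (h *+ 2) - lambda * h +
    lambda * (1 - lambda * h) * \int[mu]_(w in `[0, v]) (phi w * G (v - w)) <=
  lambda * (\int[mu]_(w in `[0, v]) phi w + h).
Proof.
move=> v0 H.
set J0 := \int[mu]_(_ in _) (_ * _); set I0 := \int[mu]_(_ in _) _.
pose I := \int[mu]_(w in `[0, v]) psi w.
pose J := \int[mu]_(w in `[0, v]) (psi w * G (v - w)).
have J00 : 0 <= J0.
  apply: cint_ge0 => x _; apply: mulr_ge0; first by case/andP: (phi01 x).
  by case/andP: (G01 (v - x)).
have HJ : J0 <= J by exact: psiG_ge.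
have HI : I <= I0 + h.
  apply: le_trans (phi_shift_le v0).
  apply: le_cint => //; first exact: bmeas_addl.
  by move=> x _; rewrite addrC; case/andP: (phi_psi x).
have H1 : p * \int[mu]_(w in `[0, v]) psi (w + h) + lambda * h * p * J <= I.
  have bs : bmeas (fun w => psi (w + h)).
    by under eq_fun do rewrite addrC; exact: bmeas_addl.
  rewrite /J -(cint_claim_average nu_ge0 psi_nd psi01 psi_lt0 v0).
  rewrite -!cintZ// -cintD; [|exact: bmeasZ|exact: bmeasZ].
  apply: le_cint => //; first by apply: bmeasD; exact: bmeasZ.
  move=> x /andP[x0 _]; apply: le_trans (H x x0); rewrite lerD2l.
  apply: ler_wpM2l; first by rewrite mulr_ge0// expR_ge0.
  by apply: claim_average_nd => //; rewrite lerDl ltW.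
rewrite psi_shiftE// -/I in H1.
have H2 : \int[mu]_(w in `[0, h]) psi w <= phi (h *+ 2) * h.
  rewrite -[X in _ * X]subr0; apply: cint_const_le; first exact: ltW.
  move=> x /andP[_ xh]; case/andP: (phi_psi x) => _ /le_trans; apply.
  by apply: phi_nd; rewrite mulr2n lerD2r.
have H3 : phi v * h <= \int[mu]_(w in `[v, v + h]) psi w.
  rewrite -[X in _ * X](addKr v) [- v + _]addrC; apply: cint_const_ge.
    by rewrite lerDl ltW.
  by move=> x /andP[vx _]; case/andP: (phi_psi x) => + _; apply: le_trans; exact: phi_nd.
set A := \int[mu]_(w in `[0, h]) psi w in H1 H2.
set B := \int[mu]_(w in `[v, v + h]) psi w in H1 H3.
have /andP[a0 a1] := phi01 v; have /andP[b0 b1] := phi01 (h *+ 2).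
rewrite -(ler_pM2r h0).
have p0 : 0 <= p by exact: expR_ge0.
have I0' : 0 <= I by apply: cint_ge0 => x _; case/andP: (psi01 x).
have H4 : (1 - p) * I <= lambda * h * (I0 + h).
  by apply: ler_pM.
have H5 : lambda * h * (1 - lambda * h) * J0 <= lambda * h * p * J.
  apply: (@le_trans _ _ (lambda * h * p * J0)).
    by apply: ler_wpM2r => //; exact: ler_wpM2l.
  by apply: ler_wpM2l => //; exact: mulr_ge0.
have H6 : p * (phi v - phi (h *+ 2)) * h <= p * (B - A).
  by rewrite -mulrA; apply: ler_wpM2l => //; lra.
have H7 : (phi v - phi (h *+ 2) - lambda * h) * h <= p * (phi v - phi (h *+ 2)) * h.
  apply: ler_wpM2r; first exact: ltW.
  (* [v] may be smaller than [2 h], so the difference has no fixed sign; either way it is at most 1,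
     and replacing [p] by 1 costs at most [lambda * h]. *)
  have : (1 - p) * (phi v - phi (h *+ 2)) <= lambda * h * 1; last by lra.
  have [c0|c0] := lerP 0 (phi v - phi (h *+ 2)).
    by apply: ler_pM => //; lra.
  apply: (@le_trans _ _ 0); last by rewrite mulr1.
  by apply: mulr_ge0_le0 => //; exact: ltW.
by move: H1 H4 H5 H6 H7; lra.
Qed.

(** Origin of the errors: in [phi (v + h *+ 2)] one [h] comes from the window [[v, v + h]], the
    other from [psi x <= phi (x + h)]. In the summand [h *+ 2] one [h] comes from replacing [psi] by
    [phi], the other from the shift of the claim average. The last term bounds the probability of
    two or more claims by [(lambda * h) ^+ 2], integrated over the capital and divided by [h]. *)
Lemma renewal_step_le v : 0 <= v ->
  (forall u, 0 <= u -> psi u <= p * psi (u + h) +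
    lambda * h * p * claim_average nu psi (u + h) + (1 - p - lambda * h * p)) ->
  lambda * (1 - lambda * h) * \int[mu]_(w in `[0, v]) phi w <=
  phi (v + h *+ 2) - phi 0 + lambda * h +
  lambda * (\int[mu]_(w in `[0, v]) (phi w * G (v - w)) + h *+ 2) +
  lambda ^+ 2 * h * v.
Proof.
move=> v0 H.
set J0 := \int[mu]_(_ in _) (_ * _); set I0 := \int[mu]_(_ in _) _.
pose I := \int[mu]_(w in `[0, v]) psi w.
pose J := \int[mu]_(w in `[0, v]) (psi w * G (v - w)).
pose b := phi (v + h *+ 2) - phi 0.
have p0 : 0 <= p by exact: expR_ge0.
have HI : I0 <= I by apply: le_cint => // x _; case/andP: (phi_psi x).
have HJ : J <= J0 + h.
  have J1 : J - J0 <= \int[mu]_(w in `[0, v]) (phi (h + w) - phi w).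
    rewrite -cintB; [|exact: bmeasM|exact: bmeasM].
    apply: le_cint; first by apply: bmeasB; exact: bmeasM.
      by apply: bmeasB => //; exact: bmeas_addl.
    move=> x _; rewrite -mulrBl; have /andP[g0 g1] := G01 (v - x).
    have /andP[pp1 pp2] := phi_psi x.
    apply: (@le_trans _ _ (psi x - phi x)); first by rewrite ler_piMr// subr_ge0.
    by rewrite lerD2r addrC.
  rewrite cintB ?(bmeas_addl h bphi)// in J1.
    by have := phi_shift_le v0; lra.
  exact: bmeas_addl.
have H1 : I <= p * \int[mu]_(w in `[0, v]) psi (w + h) + lambda * h * p * (J + h) +
    (1 - p - lambda * h * p) * v.
  have bs : bmeas (fun w => psi (w + h)).
    by under eq_fun do rewrite addrC; exact: bmeas_addl.
  have bs' : bmeas (fun w => claim_average nu psi (w + h)).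
    by under eq_fun do rewrite addrC; exact: bmeas_addl.
  have -> : (1 - p - lambda * h * p) * v = \int[mu]_(w in `[0, v]) (1 - p - lambda * h * p).
    by rewrite cint_cst// subr0.
  apply: (@le_trans _ _ (\int[mu]_(w in `[0, v]) (p * psi (w + h) +
    lambda * h * p * claim_average nu psi (w + h) + (1 - p - lambda * h * p)))).
    apply: le_cint => //.
      by apply: bmeasD; [apply: bmeasD; exact: bmeasZ|exact: bmeas_cst].
    by move=> x /andP[x0 _]; exact: H.
  rewrite cintD; [|by apply: bmeasD; exact: bmeasZ|exact: bmeas_cst].
  rewrite cintD; [|exact: bmeasZ|exact: bmeasZ].
  rewrite !cintZ// lerD2r lerD2l; apply: ler_wpM2l; first by rewrite mulr_ge0.
  rewrite /J -(cint_claim_average nu_ge0 psi_nd psi01 psi_lt0 v0).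
  under eq_Rintegral do rewrite addrC.
  rewrite cint_shift// addr0 [h + v]addrC.
  have ca01 := claim_average_bounds nu psi_nd psi01.
  have ca0 x : 0 <= claim_average nu psi x by case/andP: (ca01 x).
  have vh : v <= v + h by rewrite lerDl ltW.
  apply: (@le_trans _ _ (\int[mu]_(w in `[0, v + h]) claim_average nu psi w)).
    by apply: le_cint_itv => //; exact: ltW.
  rewrite (cint_split bca v0 vh) lerD2l.
  apply: (@le_trans _ _ (\int[mu]_(w in `[v, v + h]) 1)).
    by apply: le_cint => //; [exact: bmeas_cst|move=> x _; case/andP: (ca01 x)].
  by rewrite cint_cst// mul1r addrAC subrr add0r.
rewrite psi_shiftE// -/I in H1.
have H2 : phi 0 * h <= \int[mu]_(w in `[0, h]) psi w.
  rewrite -[X in _ * X]subr0; apply: cint_const_ge; first exact: ltW.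
  by move=> x /andP[x0 _]; case/andP: (phi_psi x) => + _; apply: le_trans; exact: phi_nd.
have H3 : \int[mu]_(w in `[v, v + h]) psi w <= phi (v + h *+ 2) * h.
  rewrite -[X in _ * X](addKr v) [- v + _]addrC; apply: cint_const_le.
    by rewrite lerDl ltW.
  move=> x /andP[_ xvh]; case/andP: (phi_psi x) => _ /le_trans; apply.
  by apply: phi_nd; rewrite mulr2n addrA lerD2r.
set A := \int[mu]_(w in `[0, h]) psi w in H1 H2.
set B := \int[mu]_(w in `[v, v + h]) psi w in H1 H3.
have /andP[a0 a1] := phi01 (v + h *+ 2); have /andP[b0 b1] := phi01 0.
have I00 : 0 <= I0 by apply: cint_ge0 => x _; case/andP: (phi01 x).
have J00 : 0 <= J.
  apply: cint_ge0 => x _; apply: mulr_ge0; first by case/andP: (psi01 x).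
  by case/andP: (G01 (v - x)).
have I_0 : 0 <= I by exact: le_trans HI.
rewrite -(ler_pM2r h0).
have p2 : 0 <= 1 - p - lambda * h * p.
  have : p * (1 + lambda * h) <= p * expR (lambda * h).
    by apply: ler_wpM2l => //; exact: expR_ge1Dx.
  by rewrite -expRD addNr expR0; lra.
have H4 : lambda * h * (1 - lambda * h) * I0 <= (1 - p) * I.
  apply: (@le_trans _ _ (lambda * h * p * I0)).
    by apply: ler_wpM2r => //; exact: ler_wpM2l.
  apply: ler_pM => //; first exact: mulr_ge0.
  by move: p2; rewrite subr_ge0.
have H5 : lambda * h * p * (J + h) <= lambda * h * (J0 + h *+ 2).
  apply: ler_pM; [exact: mulr_ge0|by rewrite addr_ge0// ltW| |].
    by rewrite ler_piMr.
  by rewrite mulr2n; lra.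
have H6 : p * (B - A) <= p * (b * h) by apply: ler_wpM2l => //; rewrite /b; lra.
have H7 : p * (b * h) <= (b + lambda * h) * h.
  rewrite mulrA; apply: ler_wpM2r; first exact: ltW.
  have : (1 - p) * (- b) <= lambda * h * 1; last by lra.
  have b_ge0 : 0 <= b by rewrite subr_ge0 phi_nd// addr_ge0// mulrn_wge0// ltW.
  apply: (@le_trans _ _ 0); last by rewrite mulr1.
  by apply: mulr_ge0_le0 => //; rewrite oppr_le0.
have H8 : (1 - p - lambda * h * p) * v <= lambda ^+ 2 * h * v * h.
  have -> : lambda ^+ 2 * h * v * h = (lambda * h) ^+ 2 * v by ring.
  apply: ler_wpM2r => //.
  have : (1 - lambda * h) * (1 + lambda * h) <= p * (1 + lambda * h).
    by apply: ler_wpM2r => //; rewrite addr_ge0.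
  by lra.
by rewrite -/b; move: H1 H4 H5 H6 H7 H8; lra.
Qed.

End renewal_step.

(** * Vanishing mesh *)

Section renewal_limit.
Context {R : realType}.
Local Notation mu := (@lebesgue_measure R).
Variable nu : probability R R.
Hypothesis nu_ge0 : nu `]-oo, 0[%classic = 0%E.
Local Notation G x := (fine (nu `]-oo, x]%classic)).
Variable lambda : R.
Hypothesis lambda0 : 0 <= lambda.
Variables (phi : R -> R) (psi : nat -> R -> R).
Hypothesis phi_nd : nondecreasing_fun phi.
Hypothesis phi01 : forall x, 0 <= phi x <= 1.
Hypothesis phi_rc : forall x, phi (x + harmonic n *+ 2) @[n --> \oo] --> phi x.
Hypothesis psi_nd : forall n, nondecreasing_fun (psi n).
Hypothesis psi01 : forall n x, 0 <= psi n x <= 1.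
Hypothesis psi_lt0 : forall n (x : R), x < 0 -> psi n x = 0.
Hypothesis phi_psi : forall n x, phi x <= psi n x <= phi (x + harmonic n).

Let h_cvg : (@harmonic R) @ \oo --> 0. Proof. exact: cvg_harmonic. Qed.

Let p n := expR (- (lambda * harmonic n)).

Lemma renewal_limit_ge v : 0 <= v ->
  (forall n u, 0 <= u -> p n * psi n (u + harmonic n) +
     lambda * harmonic n * p n * claim_average nu (psi n) (u + harmonic n) <= psi n u) ->
  phi v - phi 0 + lambda * \int[mu]_(w in `[0, v]) (phi w * G (v - w)) <=
  lambda * \int[mu]_(w in `[0, v]) phi w.
Proof.
move=> v0 H; set J0 := \int[mu]_(_ in _) (_ * _); set I0 := \int[mu]_(_ in _) _.
have S n := renewal_step_ge nu_ge0 lambda0 (harmonic_gt0 n) phi_nd phi01 (psi_nd n)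
  (psi01 n) (psi_lt0 n) (phi_psi n) v0 (H n).
have L : phi v - phi (harmonic n *+ 2) - lambda * harmonic n +
    lambda * (1 - lambda * harmonic n) * J0 @[n --> \oo] -->
    phi v - phi 0 - lambda * 0 + lambda * (1 - lambda * 0) * J0.
  apply: cvgD; last first.
    apply: cvgMl; apply: cvgMr; apply: cvgB; first exact: cvg_cst.
    exact: cvgMr.
  apply: cvgB; last exact: cvgMr.
  apply: cvgB; first exact: cvg_cst.
  by have := @phi_rc 0; under eq_fun do rewrite add0r.
have Rr : lambda * (I0 + harmonic n) @[n --> \oo] --> lambda * (I0 + 0).
  by apply: cvgMr; apply: cvgD => //; exact: cvg_cst.
rewrite !(mulr0, subr0, addr0, mulr1) in L Rr.
by apply: (ler_cvg_to L Rr); apply: nearW => n; exact: S.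
Qed.

Lemma renewal_limit_le v : 0 <= v ->
  (forall n u, 0 <= u -> psi n u <= p n * psi n (u + harmonic n) +
     lambda * harmonic n * p n * claim_average nu (psi n) (u + harmonic n) +
     (1 - p n - lambda * harmonic n * p n)) ->
  lambda * \int[mu]_(w in `[0, v]) phi w <=
  phi v - phi 0 + lambda * \int[mu]_(w in `[0, v]) (phi w * G (v - w)).
Proof.
move=> v0 H; set J0 := \int[mu]_(_ in _) (_ * _); set I0 := \int[mu]_(_ in _) _.
have S n := renewal_step_le nu_ge0 lambda0 (harmonic_gt0 n) phi_nd phi01 (psi_nd n)
  (psi01 n) (psi_lt0 n) (phi_psi n) v0 (H n).
have L : lambda * (1 - lambda * harmonic n) * I0 @[n --> \oo] -->
    lambda * (1 - lambda * 0) * I0.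
  apply: cvgMl; apply: cvgMr; apply: cvgB; first exact: cvg_cst.
  exact: cvgMr.
have Rr : phi (v + harmonic n *+ 2) - phi 0 + lambda * harmonic n +
    lambda * (J0 + harmonic n *+ 2) + lambda ^+ 2 * harmonic n * v @[n --> \oo] -->
    phi v - phi 0 + lambda * 0 + lambda * (J0 + 0 *+ 2) + lambda ^+ 2 * 0 * v.
  apply: cvgD; last by apply: cvgMl; exact: cvgMr.
  apply: cvgD.
    apply: cvgD; last exact: cvgMr.
    by apply: cvgB; [exact: phi_rc|exact: cvg_cst].
  apply: cvgMr; apply: cvgD; first exact: cvg_cst.
  by under eq_fun do rewrite mulr2n; rewrite mulr2n; exact: cvgD.
rewrite !(mul0rn, mulr0, subr0, addr0, mulr1, mul0r) in L Rr.
by apply: (ler_cvg_to L Rr); apply: nearW => n; exact: S.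
Qed.

End renewal_limit.

(** * Survival in continuous time *)

Section continuous_time.
Context {R : realType} {d : measure_display} {T : measurableType d}.
Local Notation mu := (@lebesgue_measure R).
Variables (P : probability T R) (rate : R) (F : set R -> \bar R).
Variables (N : R -> {RV P >-> nat}) (U : nat -> {RV P >-> R}).
Hypothesis clNU : cramer_lundberg rate F N U.
Hypothesis rate0 : 0 <= rate.
Hypothesis F_ge0 : F `]-oo, 0[%classic = 0%E.

Definition safe (Hz : set R) (u : R) : set T :=
  [set w | forall t, Hz t -> \sum_(i < N t w) U i w - t <= u].

Definition grid_times (Hz : set R) n : set nat := [set k | Hz (k%:R * harmonic n)].

(** The last clause asks for a grid time inside the horizon at most one mesh after [t]. It holds for
    [[0, m]] because the integer [m] is a multiple of every mesh [1 / (n + 1)]. *)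
Definition horizon (Hz : set R) : Prop :=
  [/\ Hz 0, forall s t, Hz t -> 0 <= s <= t -> Hz s, Hz `<=` [set t | 0 <= t] &
  forall n t, Hz t -> exists k : nat, grid_times Hz n k /\
    t <= k%:R * harmonic n <= t + harmonic n].

Lemma grid_ceil n (t : R) : 0 <= t -> exists k : nat,
  t <= k%:R * harmonic n <= t + harmonic n.
Proof.
move=> t0; exists `|Num.ceil (t * n.+1%:R)|%N.
have c0 : (0 <= Num.ceil (t * n.+1%:R))%R.
  by rewrite -(ler_int R) (le_trans _ (ceil_ge _))// mulr_ge0.
have -> : `|Num.ceil (t * n.+1%:R)|%N%:R = (Num.ceil (t * n.+1%:R))%:~R :> R.
  by rewrite natr_absz ger0_norm.
rewrite /harmonic ler_pdivlMr// ceil_ge/=.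
rewrite ler_pdivrMr// mulrDl mulVf//.
by have := @ceilB1_lt R (t * n.+1%:R); lra.
Qed.

Lemma horizon_infty : horizon [set t | 0 <= t].
Proof.
split => //=; first by move=> s t _ /andP[].
by move=> n t /(grid_ceil n)[k kP]; exists k; split => //; rewrite /grid_times/= mulr_ge0.
Qed.

Lemma horizon_nat (m : nat) : horizon [set t | 0 <= t <= m%:R].
Proof.
split => //=; first by rewrite lexx/=.
- by move=> s t /andP[_ tm] /andP[s0 st]; rewrite s0 (le_trans st).
- by move=> t /andP[].
move=> n t /andP[t0 tm].
have [k /andP[k1 k2]] := grid_ceil n t0.
have [km|km] := leP (k%:R * harmonic n : R) m%:R.
  by exists k; rewrite /grid_times/= km mulr_ge0// k1.
have E : (m * n.+1)%:R * harmonic n = m%:R :> R.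
  by rewrite natrM -mulrA mulfV// mulr1.
exists (m * n.+1)%N; rewrite /grid_times/= E ler0n lexx tm.
by split => //; rewrite (le_trans (ltW km)).
Qed.

Variable Hz : set R.
Hypothesis hHz : horizon Hz.

Let Hz0 : Hz 0. Proof. by case: hHz. Qed.

Let grid0 n : grid_times Hz n 0%N.
Proof. by rewrite /grid_times/= mul0r. Qed.

Let gridS n k : grid_times Hz n k.+1 -> grid_times Hz n k.
Proof.
case: hHz => _ H _ _; rewrite /grid_times/= => /H; apply.
by rewrite mulr_ge0// ler_wpM2r// ler_nat.
Qed.

Let Nrc w (t : R) : 0 <= t -> \forall s \near t^'+, N s w = N t w.
Proof. by case: clNU => -[_ _ H _ _] _ _ _; exact: H. Qed.

Let Nmono w (s t : R) : 0 <= s -> s <= t -> (N s w <= N t w)%N.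
Proof. by case: clNU => -[_ H _ _ _] _ _ _; exact: H. Qed.

Lemma safe_grid n u : safe Hz u `<=` grid_safe N U (harmonic n) (grid_times Hz n) u.
Proof. by move=> w Hw k /Hw; rewrite lerBlDr. Qed.

(** [N] keeps its value just after [t], so a grid time slightly above [t] carries the same claims
    and at most one mesh more of premium. The countable intersection makes the event measurable. *)
Lemma safeE u :
  safe Hz u = \bigcap_n grid_safe N U (harmonic n) (grid_times Hz n) u.
Proof.
apply/seteqP; split => [w Hw n _|w Hw t Ht]; first exact: safe_grid.
have [_ _ /(_ _ Ht) t0 hgrid] := hHz.
have [e /= e0 He] := Nrc w t0.
apply/ler_addgt0Pr => x x0.
pose y := Num.min e x.
have y0 : 0 < y by rewrite lt_min e0.
have [n _ /(_ n (leqnn n)) Hn] : \forall n \near \oo, (harmonic n : R) < y.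
  by apply: (cvgr_lt 0) => //; exact: cvg_harmonic.
have [k [gk /andP[k1 k2]]] := hgrid n t Ht.
have Hk := Hw n Logic.I k gk.
have hne : harmonic n < e :> R by rewrite (lt_le_trans Hn)// ge_min lexx.
have hnx : harmonic n < x :> R by rewrite (lt_le_trans Hn)// ge_min lexx orbT.
have E : N (k%:R * harmonic n) w = N t w.
  move: k1; rewrite le_eqVlt => /predU1P[<-//|k1].
  apply: He => //=; rewrite distrC ger0_norm; last by rewrite subr_ge0 ltW.
  by rewrite ltrBlDl (le_lt_trans k2)// ltrD2l.
by rewrite E in Hk; lra.
Qed.

Lemma measurable_safe u : measurable (safe Hz u).
Proof.
by rewrite safeE; apply: bigcapT_measurable => n; exact: (measurable_grid_safe clNU (harmonic_ge0 n)).
Qed.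

Definition survival u : R := fine (P (safe Hz u)).

Lemma survivalE u : P (safe Hz u) = (survival u)%:E.
Proof. by rewrite fineK// fin_num_measure//; exact: measurable_safe. Qed.

Lemma survival_bounds u : 0 <= survival u <= 1.
Proof.
rewrite fine_ge0//= -lee_fin -survivalE.
exact: probability_le1 (measurable_safe u).
Qed.

Lemma safe_nd u v : u <= v -> safe Hz u `<=` safe Hz v.
Proof. by move=> uv w Hw t /Hw /le_trans; apply. Qed.

Lemma survival_nd : nondecreasing_fun survival.
Proof.
move=> u v uv; rewrite -lee_fin -!survivalE le_measure ?inE//;
  try exact: measurable_safe.
exact: safe_nd.
Qed.

(** [safe] consists of non-strict inequalities, hence is continuous from above in the capital; two
    meshes is the shift left over by the renewal steps. *)
Lemma survival_rc x : survival (x + harmonic n *+ 2) @[n --> \oo] --> survival x.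
Proof.
have E : safe Hz x = \bigcap_n safe Hz (x + harmonic n *+ 2).
  apply/seteqP; split => w Hw.
    by move=> n _; apply: safe_nd Hw; rewrite lerDl mulrn_wge0 ?harmonic_ge0.
  move=> t Ht; apply/ler_addgt0Pr => e e0.
  have e2 : 0 < e / 2 by exact: divr_gt0.
  have [n _ /(_ n (leqnn n)) Hn] : \forall n \near \oo, (harmonic n : R) < e / 2.
    by apply: (cvgr_lt 0) => //; exact: cvg_harmonic.
  by rewrite (le_trans (Hw n Logic.I t Ht))// lerD2l mulr2n; lra.
suff : P (safe Hz (x + harmonic n *+ 2)) @[n --> \oo] --> P (safe Hz x).
  by rewrite survivalE; under eq_fun do rewrite survivalE; move=> /fine_cvg.
rewrite E; apply: nonincreasing_cvg_mu.
- by rewrite ltey_eq fin_num_measure//; exact: measurable_safe.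
- by move=> n; exact: measurable_safe.
- by apply: bigcapT_measurable => n; exact: measurable_safe.
- move=> n m nm; apply/subsetPset; apply: safe_nd; rewrite lerD2l.
  by rewrite lerMn2r/= lef_pV2 ?posrE// ler_nat.
Qed.

Let claims_ge0 : {ae P, forall w, forall i, 0 <= U i w}.
Proof.
apply: ae_foralln => i; exists (U i @^-1` `]-oo, 0[%classic); split.
- exact: measurable_funPTI.
- by have [_ _ H _] := clNU; exact: etrans (H i _ (measurable_itv _)) F_ge0.
- by move=> w /= /negP; rewrite -ltNge in_itv.
Qed.

(** Claims are almost surely nonnegative, so by the next grid time after [t] they have only
    accumulated, while the premium has grown by at most one mesh: extra capital [harmonic n] makes
    up for testing on the grid only. *)
Lemma survival_grid n u :
  survival u <= grid_survival N U (harmonic n) (grid_times Hz n) u <= survival (u + harmonic n).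
Proof.
have mg v : measurable (grid_safe N U (harmonic n) (grid_times Hz n) v).
  exact: (measurable_grid_safe clNU (harmonic_ge0 n)).
apply/andP; split; rewrite -lee_fin -survivalE -(grid_survivalE clNU (harmonic_ge0 n))//.
  by apply: le_measure; rewrite ?inE//; [exact: measurable_safe|exact: safe_grid].
have [D [mD D0 HD]] := claims_ge0.
apply: (@le_trans _ _ (P (safe Hz (u + harmonic n) `|` D))); last first.
  apply: (le_trans (measureU2 _ _ _)) => //; first exact: measurable_safe.
  by rewrite [X in (_ + X)%E]D0 adde0.
apply: le_measure; rewrite ?inE//; first by apply: measurableU => //; exact: measurable_safe.
move=> w Hw; have [Dw|Dw] := pselect (D w); [by right|left].
have Uw i : 0 <= U i w.
  by apply: contrapT => H; apply: Dw; apply: HD => /(_ i).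
move=> t Ht; have [_ _ /(_ _ Ht) t0 /(_ n t Ht)[k [gk /andP[k1 k2]]]] := hHz.
have := Hw k gk; have Ntk := Nmono w t0 k1.
have : \sum_(i < N t w) U i w <= \sum_(i < N (k%:R * harmonic n) w) U i w.
  rewrite -!(big_mkord xpredT (fun i => U i w)) (big_cat_nat _ Ntk)//=.
  by rewrite lerDl sumr_ge0.
lra.
Qed.

Let nu : probability R R := distribution P (U 0%N).
Local Notation G x := (fine (nu `]-oo, x]%classic)).

Let nu_ge0 : nu `]-oo, 0[%classic = 0%E.
Proof. by case: clNU => _ _ H _; rewrite -F_ge0; exact: H. Qed.

Let grid_stepE n u : (\int[distribution P (U 0%N)]_x
    (grid_survival N U (harmonic n) (grid_times Hz n) (u + harmonic n - x))%:E =
  (claim_average nu (grid_survival N U (harmonic n) (grid_times Hz n)) (u + harmonic n))%:E)%E.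
Proof.
rewrite claim_averageE//; first exact: (grid_survival_nd clNU (harmonic_ge0 n)).
exact: (grid_survival_bounds clNU (harmonic_ge0 n)).
Qed.

Lemma survival_renewal_ge v : 0 <= v ->
  survival v - survival 0 + rate * \int[mu]_(w in `[0, v]) (survival w * G (v - w)) <=
  rate * \int[mu]_(w in `[0, v]) survival w.
Proof.
move=> v0; apply: (renewal_limit_ge nu_ge0 rate0
  (psi := fun n => grid_survival N U (harmonic n) (grid_times Hz n))) => //.
- exact: survival_nd.
- exact: survival_bounds.
- exact: survival_rc.
- by move=> n; exact: (grid_survival_nd clNU (harmonic_ge0 n)).
- by move=> n; exact: (grid_survival_bounds clNU (harmonic_ge0 n)).
- by move=> n x; exact: (grid_survival_lt0 clNU).
- exact: survival_grid.
move=> n u u0; rewrite -lee_fin EFinD [X in (_ + X)%E]EFinM -grid_stepE.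
by apply: (first_step_ge clNU rate0 (harmonic_ge0 n)) => // k; exact: gridS.
Qed.

End continuous_time.

(** * The renewal equation of the ruin probability *)

Section ruin_renewal.
Context {R : realType} {d : measure_display} {T : measurableType d}.
Local Notation mu := (@lebesgue_measure R).
Variables (P : probability T R) (rate : R) (F : set R -> \bar R).
Variables (N : R -> {RV P >-> nat}) (U : nat -> {RV P >-> R}).
Hypothesis clNU : cramer_lundberg rate F N U.
Hypothesis rate0 : 0 <= rate.
Hypothesis F_ge0 : F `]-oo, 0[%classic = 0%E.

Definition claim_rate (y : R) : R := rate * (1 - fine (F `]-oo, y]%classic)).

Let nu : probability R R := distribution P (U 0%N).

Let nuE A : measurable A -> nu A = F A.
Proof. by move=> mA; case: clNU => _ _ H _; exact: H. Qed.

Let claim_rateE y : claim_rate y = rate * (1 - fine (nu `]-oo, y]%classic)).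
Proof. by rewrite nuE. Qed.

Lemma bmeas_claim_rate : bmeas claim_rate.
Proof.
rewrite (_ : claim_rate = fun y => rate * (1 - fine (nu `]-oo, y]%classic))).
  by apply: bmeasZ; apply: bmeasB; [exact: bmeas_cst|exact: bmeas_nu_cdf].
by apply/funext => y; exact: claim_rateE.
Qed.

Lemma claim_rate_ge0 y : 0 <= claim_rate y.
Proof.
by rewrite claim_rateE mulr_ge0// subr_ge0; case/andP: (nu_cdf_bounds nu y).
Qed.

Local Notation H8 := [set t : R | 0 <= t].
Local Notation surv := (survival N U).

Let sbd Hz (hHz : horizon Hz) : bmeas (surv Hz).
Proof. exact: (bmeas_nondecreasing (survival_nd clNU hHz) (survival_bounds clNU hHz)). Qed.

Let conv_surv Hz (hHz : horizon Hz) v :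
  rate * \int[mu]_(w in `[0, v]) surv Hz w -
  rate * \int[mu]_(w in `[0, v]) (surv Hz w * fine (nu `]-oo, v - w]%classic)) =
  conv (surv Hz) claim_rate v.
Proof.
have bs := sbd hHz; have bk := bmeas_claim_rate.
have bg : bmeas (fun w => fine (nu `]-oo, v - w]%classic)).
  exact: (bmeas_subr v (bmeas_nu_cdf nu)).
rewrite -!cintZ//; last exact: bmeasM.
rewrite -cintB; [|exact: bmeasZ|by apply: bmeasZ; exact: bmeasM].
rewrite -cint_reflect; last first.
  by apply: bmeasB; [exact: bmeasZ|by apply: bmeasZ; exact: bmeasM].
by apply: eq_cint => w _; rewrite claim_rateE subKr; ring.
Qed.

Let surv_ge Hz (hHz : horizon Hz) v : 0 <= v ->
  surv Hz v - surv Hz 0 <= conv (surv Hz) claim_rate v.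
Proof.
by move=> v0; rewrite -conv_surv// lerBrDr; exact: (survival_renewal_ge clNU rate0 F_ge0 hHz v0).
Qed.

Let surv_le v : 0 <= v -> conv (surv H8) claim_rate v <= surv H8 v - surv H8 0.
Proof.
move=> v0; have hHz := @horizon_infty R.
have gT n : grid_times H8 n = setT.
  by apply/seteqP; split => // k _; rewrite /grid_times/= mulr_ge0 ?harmonic_ge0.
rewrite -conv_surv// lerBlDr.
have nu0 : nu `]-oo, 0[%classic = 0%E by rewrite nuE.
apply: (renewal_limit_le nu0 rate0
  (psi := fun n => grid_survival N U (harmonic n) (grid_times H8 n))) => //.
- exact: (survival_nd clNU hHz).
- exact: (survival_bounds clNU hHz).
- exact: (survival_rc clNU hHz).
- by move=> n; exact: (grid_survival_nd clNU (harmonic_ge0 n)).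
- by move=> n; exact: (grid_survival_bounds clNU (harmonic_ge0 n)).
- by move=> n x; apply: (grid_survival_lt0 clNU) => //; rewrite /grid_times/= mul0r.
- exact: (survival_grid clNU F_ge0 hHz).
move=> n u u0; rewrite gT -lee_fin.
have := first_step_le clNU rate0 (harmonic_ge0 n) u.
rewrite !EFinD !EFinM.
have nd := grid_survival_nd clNU (harmonic_ge0 n) setT.
have bd := grid_survival_bounds clNU (harmonic_ge0 n) setT.
by rewrite (claim_averageE nu nd bd).
Qed.

Lemma surv_to1 m : surv [set t | 0 <= t <= m%:R] n%:R @[n --> \oo] --> (1 : R).
Proof.
have hHz := @horizon_nat R m; set Hz := [set t | _] in hHz *.
suff : P (safe N U Hz n%:R) @[n --> \oo] --> P setT.
  rewrite probability_setT; under eq_fun do rewrite (survivalE clNU hHz).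
  by move=> /fine_cvg.
have <- : \bigcup_n safe N U Hz n%:R = setT.
  apply/seteqP; split => // w _.
  pose S := \sum_(i < N m%:R w) `|U i w|.
  have S0 : 0 <= S by rewrite sumr_ge0.
  exists (Num.truncn S).+1 => // t /andP[t0 tm].
  have Nmono : (N t w <= N m%:R w)%N by case: clNU => -[_ H _ _ _] _ _ _; exact: H.
  apply: (@le_trans _ _ S); last by rewrite ltW// truncnS_gt.
  rewrite lerBlDr (le_trans (ler_norm _))// (le_trans (ler_norm_sum _ _ _))//.
  rewrite -lerBlDr (le_trans _ (_ : \sum_(i < N t w) `|U i w| <= S))//.
    by rewrite gerBl.
  rewrite /S -!(big_mkord xpredT (fun i => `|U i w|)) (big_cat_nat _ Nmono)//=.
  by rewrite lerDl sumr_ge0.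
apply: nondecreasing_cvg_mu.
- by move=> n; exact: (measurable_safe clNU hHz).
- by apply: bigcupT_measurable => n; exact: (measurable_safe clNU hHz).
- by move=> a b ab; apply/subsetPset/safe_nd; rewrite ler_nat.
Qed.

Lemma surv_horizon : surv [set t | 0 <= t <= m%:R] 0 @[m --> \oo] --> surv H8 0.
Proof.
have hHz m := @horizon_nat R m.
suff : P (safe N U [set t | 0 <= t <= m%:R] 0) @[m --> \oo] --> P (safe N U H8 0).
  rewrite (survivalE clNU (@horizon_infty R)).
  under eq_fun do rewrite (survivalE clNU (hHz _)).
  by move=> /fine_cvg.
have -> : safe N U H8 0 = \bigcap_m safe N U [set t | 0 <= t <= m%:R] 0.
  apply/seteqP; split => w Hw; first by move=> m _ t /andP[t0 _]; exact: Hw.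
  move=> t t0; apply: (Hw (Num.truncn t).+1) => //=.
  by rewrite t0 ltW// truncnS_gt.
apply: nonincreasing_cvg_mu.
- by rewrite ltey_eq fin_num_measure//; exact: (measurable_safe clNU (hHz _)).
- by move=> m; exact: (measurable_safe clNU (hHz m)).
- by apply: bigcapT_measurable => m; exact: (measurable_safe clNU (hHz m)).
- move=> a b ab; apply/subsetPset => w Hw t /andP[t0 ta]; apply: Hw => /=.
  by rewrite t0 (le_trans ta)// ler_nat.
Qed.

Lemma ruin_safeE u :
  [set w | (u%:E < max_claim_surplus N U w)%E] = ~` safe N U H8 u.
Proof.
apply/seteqP; split => w /=.
  move=> uM Hw; move: uM; apply/negP; rewrite -leNgt.
  by apply: ge_ereal_sup => _ [t t0 <-]; rewrite lee_fin; exact: Hw.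
move=> Hw; rewrite ltNge; apply/negP => Mu; apply: Hw => t t0.
by rewrite -lee_fin (le_trans _ Mu)//; apply: ereal_sup_ubound; exists t.
Qed.

Lemma measurable_ruin u : measurable [set w | (u%:E < max_claim_surplus N U w)%E].
Proof.
rewrite ruin_safeE; apply: measurableC.
exact: (measurable_safe clNU (@horizon_infty R)).
Qed.

Lemma ruin_probE u : ruin_prob N U u = 1 - surv H8 u.
Proof.
have hHz := @horizon_infty R.
rewrite /ruin_prob ruin_safeE probability_setC; last exact: (measurable_safe clNU hHz).
by rewrite (survivalE clNU hHz).
Qed.

Lemma ruin_prob_bounds u : 0 <= ruin_prob N U u <= 1.
Proof.
rewrite ruin_probE; have := survival_bounds clNU (@horizon_infty R) u; lra.
Qed.

Lemma ruin_prob_ni : nonincreasing_fun (ruin_prob N U).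
Proof.
move=> u v uv; rewrite !ruin_probE lerD2l lerN2.
exact: (survival_nd clNU (@horizon_infty R)).
Qed.

Variable rho : R.
Hypothesis rho1 : rho < 1.
Hypothesis k_cvg : \int[mu]_(y in `[0, v]) claim_rate y @[v --> +oo] --> rho.

Let bk := bmeas_claim_rate.
Let k0 := claim_rate_ge0.
Let hH8 := @horizon_infty R.
Let phi := surv H8.

Let phi_nd : nondecreasing_fun phi. Proof. exact: (survival_nd clNU hH8). Qed.
Let phi01 x : 0 <= phi x <= 1. Proof. exact: (survival_bounds clNU hH8). Qed.

Let k_le v : \int[mu]_(y in `[0, v]) claim_rate y <= rho.
Proof.
apply: (ler_cvg_to (cvg_cst (\int[mu]_(y in `[0, v]) claim_rate y)) k_cvg).
near=> x; apply: le_cint_itv => //; near: x; apply: nbhs_pinfty_ge; exact: num_real.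
Unshelve. all: by end_near. Qed.

Lemma conv_le_rho f v : bmeas f -> (forall x, f x <= 1) -> conv f claim_rate v <= rho.
Proof.
move=> bf f1; apply: (le_trans _ (k_le v)); rewrite -conv1//.
by apply: le_conv => //; exact: bmeas_cst.
Qed.

Let surv_rec v : 0 <= v -> phi v = phi 0 + conv phi claim_rate v.
Proof.
move=> v0; apply/eqP; rewrite eq_le; apply/andP; split.
  by rewrite -lerBlDl; exact: surv_ge.
by rewrite -lerBrDl; exact: surv_le.
Qed.

(* A finite-horizon survival probability tends to 1 as the capital grows, since
   there are finitely many claims: no law of large numbers is needed. *)
Let phi0_ge : 1 - rho <= phi 0.
Proof.
apply: (ler_cvg_to (cvg_cst (1 - rho)) surv_horizon); apply: nearW => m.
have hm := @horizon_nat R m.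
set phim := surv _.
(* Letting the capital [n] grow in [phim n - phim 0 <= conv phim k n <= rho], with [k] the claim
   rate, gives [1 - rho <= phim 0] for every horizon [m]. *)
have L : phim n%:R - phim 0 @[n --> \oo] --> 1 - phim 0.
  by apply: cvgB; [exact: surv_to1|exact: cvg_cst].
have := ler_cvg_to L (cvg_cst rho).
rewrite lerBlDr addrC -lerBlDr; apply; apply: nearW => n.
apply: (le_trans (surv_ge hm _)) => //; apply: conv_le_rho; first exact: sbd.
by move=> x; case/andP: (survival_bounds clNU hm x).
Qed.

(** In the limit of large capital the equation yields [phi 0 + l * rho <= l]. Together with
    [phi0_ge] and [rho < 1] this forces [l = 1], and the inequality becomes the bound. *)
Let phi0_le : phi 0 <= 1 - rho.
Proof.
have nd : nondecreasing_seq (fun n => phi (n%:R)).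
  by move=> a b ab; apply: phi_nd; rewrite ler_nat.
have ub : has_ubound (range (fun n => phi (n%:R))).
  by exists 1 => _ [n _ <-]; case/andP: (phi01 n%:R).
have L := nondecreasing_cvgn nd ub; set l := sup _ in L.
have l1 : l <= 1.
  apply: (ler_cvg_to L (cvg_cst (1 : R))); apply: nearW => n.
  by case/andP: (phi01 n%:R).
have kn : \int[mu]_(y in `[0, n%:R]) claim_rate y @[n --> \oo] --> rho.
  exact: (cvg_comp _ _ cvgr_idn k_cvg).
have L2 : phi 0 + phi n%:R * \int[mu]_(y in `[0, n%:R]) claim_rate y @[n --> \oo]
    --> phi 0 + l * rho.
  by apply: cvgD; [exact: cvg_cst|exact: cvgM].
have : phi 0 + l * rho <= l.
  apply: (ler_cvg_to L2 (cvg_cst l)); apply: nearW => n.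
  (* At capital [2 n] every claim [y <= n] leaves at least [n], so [phi n] can be taken out of the
     convolution on [[0, n]]. *)
  apply: (@le_trans _ _ (phi (n + n)%:R)); last first.
    by apply: ub_le_sup => //; exists (n + n)%N.
  rewrite [leRHS]surv_rec// lerD2l.
  have n0 : 0 <= n%:R :> R by [].
  have n2 : n%:R <= (n + n)%:R :> R by rewrite ler_nat leq_addr.
  have bphi := sbd hH8.
  rewrite /conv (cint_split (bmeas_conv _ bphi bk) n0 n2).
  rewrite -[leLHS]addr0; apply: lerD; last first.
    by apply: cint_ge0 => x _; apply: mulr_ge0 => //; case/andP: (phi01 ((n + n)%:R - x)).
  rewrite -cintZ//; apply: le_cint; [exact: bmeasZ|exact: bmeas_conv|].
  move=> x /andP[x0 xn]; apply: ler_wpM2r => //; apply: phi_nd.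
  by rewrite natrD; lra.
move=> H; have := phi0_ge => H'.
have l_ge1 : 1 <= l.
  rewrite -(ler_pM2r (_ : 0 < 1 - rho)) ?subr_gt0//; lra.
have E : l = 1 by apply/eqP; rewrite eq_le l1.
by rewrite E mul1r in H; lra.
Qed.

Theorem ruin_renewal v : 0 <= v ->
  ruin_prob N U v = rho - \int[mu]_(y in `[0, v]) claim_rate y +
    conv (ruin_prob N U) claim_rate v.
Proof.
move=> v0; have bphi := sbd hH8.
have E : ruin_prob N U = (fun u => 1 - phi u) by apply/funext => u; exact: ruin_probE.
rewrite E convBl//; last exact: bmeas_cst.
rewrite conv1// surv_rec//.
have -> : phi 0 = 1 - rho by apply/eqP; rewrite eq_le phi0_le phi0_ge.
by ring.
Qed.

End ruin_renewal.

(** * Light and long tails *)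

Section expneg.
Context {R : realType}.
Local Notation mu := (@lebesgue_measure R).

(* Constant on the negative half-line, so as to be bounded. *)
Definition expneg (a y : R) : R := expR (- (a * Num.max y 0)).

Lemma expnegE a y : 0 <= y -> expneg a y = expR (- (a * y)).
Proof. by move=> y0; rewrite /expneg max_l. Qed.

Lemma expneg_gt0 a y : 0 < expneg a y. Proof. exact: expR_gt0. Qed.

Lemma expneg_ge0 a y : 0 <= expneg a y. Proof. exact: expR_ge0. Qed.

Lemma expneg_ni a : 0 <= a -> nonincreasing_fun (expneg a).
Proof.
by move=> a0 x y xy; rewrite ler_expR lerN2 ler_wpM2l// ge_max !le_max xy lexx orbT.
Qed.

Lemma expneg_le1 a y : 0 <= a -> expneg a y <= 1.
Proof. by move=> a0; rewrite expR_le1 oppr_le0 mulr_ge0// le_max lexx orbT. Qed.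

Lemma bmeas_expneg a : 0 <= a -> bmeas (expneg a).
Proof.
move=> a0; apply: (bmeas_nonincreasing (M := 1)); first exact: expneg_ni.
by move=> x; rewrite expneg_ge0 expneg_le1.
Qed.

Lemma cint_expneg_le a x : 0 < a -> \int[mu]_(y in `[0, x]) expneg a y <= a^-1.
Proof.
move=> a0; have ba := bmeas_expneg (ltW a0).
have [x0|x0] := lerP x 0.
  apply: (@le_trans _ _ (\int[mu]_(y in `[0, 0]) expneg a y)).
    by apply: le_cint_itv => // y; exact: expneg_ge0.
  rewrite set_itv1 Rintegral_set1 invr_ge0; exact: ltW.
have := exponential_prob_itv0c a x0.
rewrite -(ler_pM2l a0) mulfV ?gt_eqF// -cintZ// => /(congr1 fine).
rewrite /exponential_prob -[fine (integral _ _ _)]/(Rintegral _ _ _).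
rewrite -(@eq_cint _ _ _ (exponential_pdf a)).
  by move=> ->; rewrite /= gerBl expR_ge0.
by move=> y /andP[y0 _]; rewrite exponential_pdfE// expnegE// mulNr.
Qed.

Lemma cint_expneg_tail a L x : 0 < a -> 0 <= L ->
  \int[mu]_(y in `[L, x]) expneg a y <= a^-1 * expR (- (a * L)).
Proof.
move=> a0 L0; have ba := bmeas_expneg (ltW a0).
have := cint_shift 0 (x - L) L ba; rewrite addr0 [L + _]addrC subrK => <-.
rewrite (@eq_cint _ _ _ _ (fun y => expR (- (a * L)) * expneg a y)).
  rewrite cintZ// mulrC; apply: ler_wpM2r; first exact: expR_ge0.
  exact: cint_expneg_le.
move=> y /andP[y0 _]; rewrite !expnegE ?addr_ge0// -expRD; congr expR; ring.
Qed.

Lemma expR_decay (a : R) : 0 < a -> expR (- (a * x)) @[x --> +oo] --> 0.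
Proof.
move=> a0; apply: (@cvg_comp _ _ _ (fun x => a * x) (fun z => expR (- z)) _ (pinfty_nbhs R)).
  exact: gt0_cvgMry.
exact: cvgr_expR.
Qed.

End expneg.

Section light_tail.
Context {R : realType}.
Local Notation mu := (@lebesgue_measure R).
Variables (b : R -> R) (A s beta : R).
Hypotheses (bb : bmeas b) (b0 : forall y, 0 <= b y).
Hypotheses (A0 : 0 <= A) (s0 : 0 < s).
Hypothesis bA : forall y : R, 0 <= y -> b y <= A * expR (- (s * y)).
Hypothesis b_cvg : \int[mu]_(y in `[0, u]) b y @[u --> +oo] --> beta.

Lemma light_le u : \int[mu]_(y in `[0, u]) b y <= beta.
Proof.
apply: (ler_cvg_to (cvg_cst (\int[mu]_(y in `[0, u]) b y)) b_cvg).
near=> x; apply: le_cint_itv => //; near: x; apply: nbhs_pinfty_ge; exact: num_real.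
Unshelve. all: by end_near. Qed.

Lemma light_itv u v : 0 <= u -> \int[mu]_(y in `[u, v]) b y <= A / s * expR (- (s * u)).
Proof.
move=> u0; have be := bmeas_expneg (ltW s0).
apply: (@le_trans _ _ (\int[mu]_(y in `[u, v]) (A * expneg s y))).
  apply: le_cint => //; first exact: bmeasZ.
  by move=> y /andP[uy _]; rewrite expnegE ?bA// (le_trans u0).
rewrite cintZ// -mulrA; apply: ler_wpM2l => //.
exact: cint_expneg_tail.
Qed.

Lemma light_remainder u : 0 <= u ->
  0 <= beta - \int[mu]_(y in `[0, u]) b y <= A / s * expR (- (s * u)).
Proof.
move=> u0; rewrite subr_ge0 light_le/= lerBlDr.
apply: (ler_cvg_to b_cvg (cvg_cst _)); near=> v.
have uv : u <= v by near: v; apply: nbhs_pinfty_ge; exact: num_real.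
by rewrite (cint_split bb u0 uv) addrC lerD2r light_itv.
Unshelve. all: by end_near. Qed.

(* Splitting at L: the exponential weight costs little on [0, L], and the tail
   of b beats it on [L, u]. *)
Lemma light_exp_moment (p : R) : 0 <= p -> p * beta < 1 ->
  exists r q, [/\ 0 < r, r <= s, 0 <= q < 1 &
    forall u, 0 <= u -> conv (expneg r) (fun y => p * b y) u <= q * expneg r u].
Proof.
move=> p0 pb.
have beta0 : 0 <= beta by apply: le_trans (light_le 0); exact: cint_ge0.
(* Room for two errors: [p * beta + e + e = (1 + p * beta) / 2 < 1]. *)
pose e := (1 - p * beta) / 4.
have e0 : 0 < e by rewrite divr_gt0// subr_gt0.
have s2 : 0 < s / 2 by exact: divr_gt0.
have [L L0 HL] : exists2 L, 0 <= L & p * (A * (s / 2)^-1 * expR (- (s / 2 * L))) <= e.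
  have cv : p * (A * (s / 2)^-1 * expR (- (s / 2 * L))) @[L --> +oo] --> p * (A * (s / 2)^-1 * 0).
    by apply: cvgMr; apply: cvgMr; exact: expR_decay.
  rewrite !mulr0 in cv.
  have [L [_ HL]] : \forall L \near +oo, p * (A * (s / 2)^-1 * expR (- (s / 2 * L))) <= e.
    exact: (cvgr_le 0 cv).
  exists (`|L| + 1); first by rewrite addr_ge0.
  by apply: HL; rewrite (le_lt_trans (ler_norm _))// ltrDl.
(* [L] is fixed before [r]: beyond [L] the estimate asks only for [r <= s / 2], and shrinking [r]
   then makes [expR (r * L)] harmless. *)
have [r [r0 rs Hr]] : exists r, [/\ 0 < r, r <= s / 2 & expR (r * L) * (p * beta) <= p * beta + e].
  have cv : expR (x * L) * (p * beta) @[x --> (0 : R)] --> expR (0 * L) * (p * beta).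
    apply: cvgMl; apply: continuous_cvg; first exact: continuous_expR.
    by apply: cvgMl; exact: cvg_id.
  rewrite mul0r expR0 mul1r in cv.
  have [x /= x0 Hx] : \forall x \near (0:R), expR (x * L) * (p * beta) <= p * beta + e.
    by apply: (cvgr_le _ cv); rewrite ltrDl.
  pose r := Num.min (x / 2) (s / 2).
  have r0 : 0 < r by rewrite lt_min s2 divr_gt0.
  exists r; split => //; first by rewrite ge_min lexx orbT.
  apply: Hx; rewrite /= sub0r normrN gtr0_norm// gt_min; apply/orP; left.
  by rewrite ltr_pdivrMr// mulr_natr mulr2n ltrDl.
have be := bmeas_expneg (ltW r0).
have bpb : bmeas (fun y => p * b y) by exact: bmeasZ.
exists r, (p * beta + e + e); split => //.
- by rewrite (le_trans rs)// ler_pdivrMr// mulr_natr mulr2n lerDl ltW.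
- by rewrite !addr_ge0 ?mulr_ge0// 1?ltW//= /e; lra.
move=> u u0.
pose g y := expR (r * u) * (expneg r (u - y) * (p * b y)).
have bg : bmeas g by apply: bmeasZ; exact: bmeas_conv.
suff : \int[mu]_(y in `[0, u]) g y <= p * beta + e + e.
  rewrite cintZ; last exact: bmeas_conv.
  rewrite -ler_pdivlMl ?expR_gt0// => /le_trans; apply.
  by rewrite expnegE// -expRN mulrC.
have gE y : 0 <= y <= u -> g y = expR (r * y) * (p * b y).
  move=> /andP[y0 yu]; rewrite /g mulrA expnegE ?subr_ge0// -expRD.
  by congr (expR _ * _); ring.
have g0 y : 0 <= g y.
  by rewrite mulr_ge0 ?expR_ge0// mulr_ge0 ?expneg_ge0// mulr_ge0.
pose L' := Num.min L u.
have L'0 : 0 <= L' by rewrite le_min L0.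
have L'u : L' <= u by rewrite ge_min lexx orbT.
rewrite (cint_split bg L'0 L'u); apply: lerD.
  apply: (@le_trans _ _ (\int[mu]_(y in `[0, L']) (expR (r * L) * (p * b y)))).
    apply: le_cint => //; first by apply: bmeasZ.
    move=> y /andP[y0 yL]; rewrite gE; last by rewrite y0 (le_trans yL).
    apply: ler_wpM2r; first exact: mulr_ge0.
    rewrite ler_expR; apply: ler_wpM2l; first exact: ltW.
    by rewrite (le_trans yL)// ge_min lexx.
  rewrite !cintZ//; apply: le_trans Hr; apply: ler_wpM2l; first exact: expR_ge0.
  by apply: ler_wpM2l => //; exact: light_le.
have [uL|Lu] := lerP u L.
  by rewrite /L' min_r// set_itv1 Rintegral_set1 ltW.
rewrite /L' (min_l (ltW Lu)); apply: le_trans HL.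
have be2 := bmeas_expneg (ltW s2).
apply: (@le_trans _ _ (\int[mu]_(y in `[L, u]) (p * (A * expneg (s / 2) y)))).
  apply: le_cint => //; first by apply: bmeasZ; exact: bmeasZ.
  move=> y /andP[Ly yu]; have y0 := le_trans L0 Ly.
  rewrite gE ?y0// mulrCA; apply: ler_wpM2l => //; rewrite expnegE//.
  apply: (@le_trans _ _ (expR (s / 2 * y) * (A * expR (- (s * y))))).
    apply: ler_pM; [exact: expR_ge0|exact: b0| |exact: bA].
    by rewrite ler_expR ler_wpM2r.
  by rewrite mulrCA -expRD; apply: ler_wpM2l => //; rewrite ler_expR; lra.
rewrite !cintZ//; last exact: bmeasZ.
apply: ler_wpM2l => //; rewrite -mulrA; apply: ler_wpM2l => //.
exact: cint_expneg_tail.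
Qed.

End light_tail.

(** * Consequences of the twofold convolution limit *)

Section long_tail.
Context {R : realType}.
Local Notation mu := (@lebesgue_measure R).
Variables (K c : R -> R) (m : R).
Hypotheses (m0 : 0 < m) (bc : bmeas c) (c0 : forall y : R, 0 <= c y).
Hypothesis KE : forall u, K u = 1 - m^-1 * \int[mu]_(y in `[0, u]) c y.
Hypothesis Kgt0 : forall u, 0 < K u.
Hypothesis K_cvg0 : K u @[u --> +oo] --> 0.
Hypothesis Ksub : (m^-1 * conv K c u) / K u @[u --> +oo] --> (1 : R).

Let Kge0 u : 0 <= K u. Proof. exact: ltW. Qed.

Lemma tail_ni : nonincreasing_fun K.
Proof.
move=> u v uv; rewrite !KE lerD2l lerN2 ler_wpM2l ?invr_ge0//; first exact: ltW.
exact: le_cint_itv.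
Qed.

Lemma tail_le1 u : K u <= 1.
Proof. by rewrite KE gerBl mulr_ge0 ?invr_ge0 ?cint_ge0// ltW. Qed.

Lemma tail0 u : u <= 0 -> K u = 1.
Proof.
move=> u0; apply/eqP; rewrite eq_le tail_le1/=.
suff -> : (1 : R) = K 0 by exact: tail_ni.
by rewrite KE set_itv1 Rintegral_set1 mulr0 subr0.
Qed.

Lemma bmeas_tail : bmeas K.
Proof.
apply: (bmeas_nonincreasing (M := 1)) => [|x]; first exact: tail_ni.
by rewrite Kge0 tail_le1.
Qed.

Lemma cint_density u v : 0 <= u -> u <= v ->
  \int[mu]_(y in `[u, v]) c y = m * (K u - K v).
Proof.
move=> u0 uv; rewrite !KE (cint_split bc u0 uv); field.
by rewrite gt_eqF.
Qed.

(** Bounding [K (u - y)] below by [K u] on [[0, L]] and by [K (u - L)] on [[L, u]] gives [m^-1 *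
    conv K c u >= K u * (1 - K L) + K (u - L) * (K L - K u)]. Divided by [K u], the left side tends
    to 1, which leaves [K (u - L) / K u] no room above 1 in the limit. *)
Lemma long_tail L : 0 <= L -> K (u - L) / K u @[u --> +oo] --> (1 : R).
Proof.
move=> L0; pose j u := (m^-1 * conv K c u) / K u.
have up : (j u - (1 - K L)) / (K L - K u) @[u --> +oo] --> (1 - (1 - K L)) / (K L - 0).
  apply: cvgM; first by apply: cvgB; [exact: Ksub|exact: cvg_cst].
  apply: cvgV; first by rewrite subr0 gt_eqF.
  by apply: cvgB; [exact: cvg_cst|exact: K_cvg0].
rewrite subr0 subKr divff ?gt_eqF// in up.
apply: (squeeze_cvgr _ (cvg_cst (1 : R)) up); near=> u.
have uL : L <= u by near: u; apply: nbhs_pinfty_ge; exact: num_real.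
have Ku : K u < K L by near: u; exact: (cvgr_lt 0 K_cvg0).
have u0 : 0 <= u by exact: le_trans uL.
apply/andP; split; first by rewrite ler_pdivlMr// mul1r tail_ni// gerBl.
rewrite ler_pdivlMr ?subr_gt0// lerBrDr.
have bK := bmeas_tail.
have H : m * (K u * (1 - K L) + K (u - L) * (K L - K u)) <= conv K c u.
  rewrite /conv (cint_split (bmeas_conv u bK bc) L0 uL) mulrDr; apply: lerD.
    rewrite mulrCA -[in 1 - _](@tail0 0)// -cint_density// -cintZ//.
    apply: le_cint; [exact: bmeasZ|exact: bmeas_conv|move=> x /andP[x0 _]].
    by apply: ler_wpM2r => //; apply: tail_ni; rewrite gerBl.
  rewrite mulrCA -cint_density// -cintZ//.
  apply: le_cint; [exact: bmeasZ|exact: bmeas_conv|move=> x /andP[Lx _]].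
  by apply: ler_wpM2r => //; apply: tail_ni; rewrite lerD2l lerN2.
have -> : K (u - L) / K u * (K L - K u) + (1 - K L) =
    (K u * (1 - K L) + K (u - L) * (K L - K u)) / K u.
  by field; rewrite gt_eqF.
by rewrite /j ler_pM2r ?invr_gt0// ler_pdivlMl.
Unshelve. all: by end_near. Qed.

(** By [long_tail] a unit shift eventually costs at most [expR r], and unit shifts are iterated. In
    [D = expR r / K u0] the numerator pays for rounding [y] up to an integer, the denominator for
    arguments below [u0], where only [K <= 1] is used. *)
Lemma tail_shift_bound r : 0 < r ->
  exists2 D, 0 < D & forall u y, 0 <= y -> K (u - y) <= D * expR (r * y) * K u.
Proof.
move=> r0.
have er : 1 < expR r by rewrite expR_gt1.
have [u1 [_ Hu1]] : \forall u \near +oo, K (u - 1) <= expR r * K u.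
  near=> u; rewrite -ler_pdivrMr//; near: u.
  by apply: (cvgr_le _ (long_tail ler01)).
pose u0 := `|u1| + 1.
have Hu0 u : u0 <= u -> K (u - 1) <= expR r * K u.
  move=> u0u; apply: Hu1; apply: lt_le_trans u0u.
  by rewrite (le_lt_trans (ler_norm _))// ltrDl.
have Hn n u : u0 - 1 <= u -> K u <= expR (r * n%:R) * K (u + n%:R).
  elim: n u => [|n IH] u u0u; first by rewrite mulr0 expR0 mul1r addr0.
  apply: (le_trans (IH u u0u)).
  have := Hu0 (u + n.+1%:R); rewrite -natr1 addrA addrK => H.
  rewrite mulrDr mulr1 expRD -mulrA; apply: ler_wpM2l; first exact: expR_ge0.
  by apply: H; have : 0 <= n%:R :> R by []; lra.
have Hy u y : 0 <= y -> u0 <= u - y -> K (u - y) <= expR r * expR (r * y) * K u.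
  move=> y0 uy; have := Hn (Num.truncn y).+1 (u - y).
  have t1 := truncnS_gt y.
  have t2 : (Num.truncn y)%:R <= y by rewrite truncn_le.
  move=> /(_ (le_trans _ uy)); rewrite gerBl => /(_ ler01) /le_trans; apply.
  apply: ler_pM => //.
    by rewrite -expRD ler_expR -natr1 mulrDr mulr1 addrC lerD2l ler_wpM2l// ltW.
  by apply: tail_ni; have := ltW t1; lra.
exists (expR r / K u0); first by rewrite divr_gt0// expR_gt0.
move=> u y y0.
have K0 : 0 < K u0 by [].
have E : expR r / K u0 * expR (r * y) * K u = expR r * expR (r * y) * K u / K u0.
  by rewrite mulrAC -!mulrA; congr (_ * _); ring.
rewrite E ler_pdivlMr//.
have [uy|uy] := leP u0 (u - y).
  apply: (@le_trans _ _ (K (u - y))); first by rewrite ler_piMr// tail_le1.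
  exact: Hy.
apply: (@le_trans _ _ (K u0)); first by rewrite ler_piMl// tail_le1.
have [u0u|u0u] := leP u0 u; last first.
  apply: (@le_trans _ _ (K u)); first by apply: tail_ni; exact: ltW.
  rewrite ler_peMl// -expRD -expR0 ler_expR; apply: addr_ge0; first exact: ltW.
  by rewrite mulr_ge0// ltW.
have d0 : 0 <= u - u0 by rewrite subr_ge0.
have := Hy u (u - u0) d0; rewrite opprB addrCA subrr addr0 lexx => /(_ isT) /le_trans; apply.
apply: ler_wpM2r => //; apply: ler_wpM2l; first exact: expR_ge0.
by rewrite ler_expR; apply: ler_wpM2l; [exact: ltW|lra].
Unshelve. all: by end_near. Qed.

(** Shifting by all of [u] brings [K] back to [K 0 = 1], so [tail_shift_bound] at rate [a / 2] reads
    [1 <= D * expR (a / 2 * u) * K u]. *)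
Lemma exp_tail_negligible a : 0 < a -> expR (- (a * u)) / K u @[u --> +oo] --> 0.
Proof.
move=> a0; have a2 : 0 < a / 2 by exact: divr_gt0.
have [D D0 HD] := tail_shift_bound a2.
have up : D * expR (- (a / 2 * u)) @[u --> +oo] --> D * 0.
  by apply: cvgMr; exact: expR_decay.
rewrite mulr0 in up; apply: (squeeze_cvgr _ (cvg_cst (0 : R)) up); near=> u.
have u0 : 0 <= u by near: u; apply: nbhs_pinfty_ge; exact: num_real.
rewrite divr_ge0 ?expR_ge0//= ler_pdivrMr//.
have := HD u u u0; rewrite subrr tail0// => H.
apply: (@le_trans _ _ (expR (- (a * u)) * (D * expR (a / 2 * u) * K u))).
  by rewrite ler_peMr// expR_ge0.
have -> : - (a / 2 * u) = - (a * u) + a / 2 * u by field.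
by rewrite expRD le_eqVlt; apply/orP; left; apply/eqP; ring.
Unshelve. all: by end_near. Qed.

Section light_component.
Variables (b : R -> R) (A s beta : R).
Hypotheses (bb : bmeas b) (b0 : forall y : R, 0 <= b y).
Hypotheses (A0 : 0 <= A) (s0 : 0 < s).
Hypothesis bA : forall y : R, 0 <= y -> b y <= A * expR (- (s * y)).
Hypothesis b_cvg : \int[mu]_(y in `[0, u]) b y @[u --> +oo] --> beta.

(** A dominated convergence by hand. Below, [K (u - y) >= K u]. Above, [K (u - L) / K u] tends to 1
    for the part on [[0, L]], and beyond [L] the shift bound at rate [s / 2] loses against the decay
    of [b] at rate [s]. *)
Lemma light_conv_cvg : conv K b u / K u @[u --> +oo] --> beta.
Proof.
have bK := bmeas_tail.
have beta0 : 0 <= beta by apply: le_trans (light_le bb b0 b_cvg 0); exact: cint_ge0.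
have s2 : 0 < s / 2 by exact: divr_gt0.
have [D D0 HD] := tail_shift_bound s2.
apply/cvgrPdist_le => e e0.
have e2 : 0 < e / 2 by exact: divr_gt0.
have [L L0 HL] : exists2 L, 0 <= L & D * A * ((s / 2)^-1 * expR (- (s / 2 * L))) <= e / 2.
  have cv : D * A * ((s / 2)^-1 * expR (- (s / 2 * L))) @[L --> +oo] --> D * A * ((s / 2)^-1 * 0).
    by apply: cvgMr; apply: cvgMr; exact: expR_decay.
  rewrite !mulr0 in cv.
  have [L [_ HL]] : \forall L \near +oo, D * A * ((s / 2)^-1 * expR (- (s / 2 * L))) <= e / 2.
    exact: (cvgr_le 0 cv).
  exists (`|L| + 1); first by rewrite addr_ge0.
  by apply: HL; rewrite (le_lt_trans (ler_norm _))// ltrDl.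
have LT : K (u - L) / K u * beta @[u --> +oo] --> 1 * beta.
  by apply: cvgMl; exact: long_tail.
rewrite mul1r in LT.
near=> u.
have uL : L <= u by near: u; apply: nbhs_pinfty_ge; exact: num_real.
have u0 : 0 <= u by exact: le_trans uL.
rewrite ler_distlC; apply/andP; split.
  rewrite ler_pdivlMr//.
  apply: (@le_trans _ _ (K u * \int[mu]_(y in `[0, u]) b y)); last first.
    rewrite -cintZ//; apply: le_cint; [exact: bmeasZ|exact: bmeas_conv|move=> x /andP[x0 _]].
    by apply: ler_wpM2r => //; apply: tail_ni; rewrite gerBl.
  rewrite mulrC; apply: ler_wpM2l => //.
  by near: u; apply: (cvgr_ge _ b_cvg); rewrite gtrBl.
rewrite ler_pdivrMr//.
rewrite /conv (cint_split (bmeas_conv u bK bb) L0 uL).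
have H1 : \int[mu]_(y in `[0, L]) (K (u - y) * b y) <= K (u - L) * beta.
  apply: (@le_trans _ _ (\int[mu]_(y in `[0, L]) (K (u - L) * b y))).
    apply: le_cint; [exact: bmeas_conv|exact: bmeasZ|move=> x /andP[_ xL]].
    by apply: ler_wpM2r => //; apply: tail_ni; rewrite lerD2l lerN2.
  by rewrite cintZ//; apply: ler_wpM2l => //; exact: (light_le bb b0 b_cvg).
have H2 : K (u - L) * beta <= (beta + e / 2) * K u.
  rewrite -ler_pdivrMr// mulrAC; near: u.
  by apply: (cvgr_le _ LT); rewrite ltrDl.
have be := bmeas_expneg (ltW s2).
have H3 : \int[mu]_(y in `[L, u]) (K (u - y) * b y) <= e / 2 * K u.
  apply: (@le_trans _ _ (\int[mu]_(y in `[L, u]) (D * A * K u * expneg (s / 2) y))).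
    apply: le_cint; [exact: bmeas_conv|exact: bmeasZ|move=> y /andP[Ly _]].
    have y0 := le_trans L0 Ly.
    apply: (le_trans (ler_pM _ _ (HD u y y0) (bA y0))) => //.
    rewrite expnegE// (_ : - (s / 2 * y) = s / 2 * y + - (s * y)); last by field.
    by rewrite expRD le_eqVlt; apply/orP; left; apply/eqP; ring.
  rewrite cintZ// mulrAC; apply: ler_wpM2r => //; apply: le_trans HL.
  apply: ler_wpM2l; first by rewrite mulr_ge0// ltW.
  exact: cint_expneg_tail.
by apply: (le_trans (lerD (le_trans H1 H2) H3)); lra.
Unshelve. all: by end_near. Qed.

End light_component.

End long_tail.

(** * Solutions of renewal equations *)

Section renewal_asymptotics.
Context {R : realType}.
Local Notation mu := (@lebesgue_measure R).

(** [renewal_comparison] for [|f - g|], where the forcing terms cancel, with constant weight 1 and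
    [A = 0]. *)
Lemma renewal_unique (k f g h : R -> R) (rho : R) :
  bmeas k -> (forall y : R, 0 <= k y) -> bmeas f -> bmeas g -> 0 <= rho < 1 ->
  (forall v, \int[mu]_(y in `[0, v]) k y <= rho) ->
  (forall v, 0 <= v -> f v = h v + conv f k v) ->
  (forall v, 0 <= v -> g v = h v + conv g k v) ->
  forall v, 0 <= v -> f v = g v.
Proof.
move=> bk k0 bf bg r01 krho Hf Hg v v0.
have bfg := bmeasB bf bg.
have bd := bmeas_norm bfg.
suff : `|f v - g v| <= 0 * 1.
  by rewrite mul0r normr_le0 subr_eq0 => /eqP.
apply: (renewal_comparison (d := fun u => `|f u - g u|) (r := fun=> 0) (k := k)
  (K := fun=> 1) (u0 := 0) (q := rho)) => //.
- exact: bmeas_cst.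
- by move=> u /andP[u0 /(le_lt_trans u0)]; rewrite ltxx.
- move=> u u0 _; rewrite add0r Hf// Hg// opprD addrACA subrr add0r -convBl//.
  exact: norm_conv_le.
- by move=> u u0 _; rewrite conv1// mulr1.
- by move=> u _ _; rewrite mulr0 mul0r.
Qed.

(** The forcing term is the remaining mass of the kernel, at most [p * (A / s) * expR (- (s * v))].
    The weight from [light_exp_moment] is contracted by [q], and [D] solves
    [(1 - q) * D = p * (A / s)]. *)
Lemma renewal_light (b : R -> R) (A s beta p : R) (f : R -> R) :
  bmeas b -> (forall y : R, 0 <= b y) -> 0 <= A -> 0 < s ->
  (forall y : R, 0 <= y -> b y <= A * expR (- (s * y))) ->
  \int[mu]_(y in `[0, u]) b y @[u --> +oo] --> beta ->
  0 <= p -> p * beta < 1 -> bmeas f ->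
  (forall v, 0 <= v -> f v = p * beta - \int[mu]_(y in `[0, v]) (p * b y) +
    conv f (fun y => p * b y) v) ->
  exists r D, [/\ 0 < r, 0 <= D & forall u, 0 <= u -> f u <= D * expR (- (r * u))].
Proof.
move=> bb b0 A0 s0 bA b_cvg p0 pb bf Hf.
have [r [q [r0 rs /andP[q0 q1] Hq]]] := light_exp_moment bb b0 A0 s0 bA b_cvg p0 pb.
pose D := p * (A / s) / (1 - q).
have D0 : 0 <= D by rewrite divr_ge0 ?subr_ge0 ?mulr_ge0 ?invr_ge0// ltW.
exists r, D; split => // u u0.
have bpb : bmeas (fun y => p * b y) by exact: bmeasZ.
rewrite -expnegE//.
apply: (renewal_comparison (d := f)
  (r := fun v => p * (A / s) * expneg r v) (k := fun y => p * b y)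
  (K := expneg r) (u0 := 0) (q := q)) => //.
- exact: bmeas_expneg (ltW r0).
- by move=> y; rewrite mulr_ge0.
- exact: expneg_ni (ltW r0).
- exact: expneg_gt0.
- by rewrite q0.
- by move=> v /andP[v0 /(le_lt_trans v0)]; rewrite ltxx.
- move=> v v0 _; rewrite Hf// lerD2r cintZ// -mulrBr -mulrA.
  apply: ler_wpM2l => //.
  have /andP[_ H] := light_remainder bb b0 A0 s0 bA b_cvg v0.
  apply: (le_trans H); apply: ler_wpM2l; first by rewrite divr_ge0// ltW.
  by rewrite expnegE// ler_expR lerN2 ler_wpM2r.
- by move=> v v0 _; exact: Hq.
- move=> v v0 _; rewrite le_eqVlt; apply/orP; left; apply/eqP.
  by rewrite /D; field; rewrite subr_eq0 (gt_eqF s0) gt_eqF.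
Qed.

(** Positivity at [e] comes from the forcing term and spreads in steps of [e / 2]: by monotonicity
    [f (w)] is at least [f (w - e / 2)] times the mass of [k] on [[e / 2, e]]. It excludes division
    by 0 when [eps = 0]. *)
Lemma renewal_gt0 (k f h : R -> R) (e : R) :
  bmeas k -> (forall y : R, 0 <= k y) -> bmeas f -> (forall y : R, 0 <= f y) ->
  nonincreasing_fun f -> 0 < e ->
  (forall v, 0 <= v -> f v = h v + conv f k v) ->
  (forall v, 0 <= v -> 0 <= h v) ->
  (forall v, 0 <= v <= e -> 0 < h v) ->
  0 < \int[mu]_(y in `[e / 2, e]) k y ->
  forall v, 0 <= v -> 0 < f v.
Proof.
move=> bk k0 bf f0 ni e0 Hf h0 he kint v v0.
have H n : 0 < f (e + n%:R * (e / 2)).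
  elim: n => [|n IH].
    rewrite mul0r addr0 Hf; last exact: ltW.
    by rewrite ltr_pwDl ?conv_ge0// he// lexx ltW.
  set w := e + n.+1%:R * (e / 2).
  have e2 : 0 <= e / 2 by rewrite divr_ge0// ltW.
  have w0 : 0 <= w by rewrite addr_ge0 ?mulr_ge0// ltW.
  rewrite Hf//; apply: ltr_wpDl; first exact: h0.
  apply: (@lt_le_trans _ _ (f (e + n%:R * (e / 2)) * \int[mu]_(y in `[e / 2, e]) k y)).
    exact: mulr_gt0.
  rewrite -cintZ//.
  apply: (@le_trans _ _ (\int[mu]_(y in `[e / 2, e]) (f (w - y) * k y))).
    apply: le_cint; [exact: bmeasZ|exact: bmeas_conv|move=> y /andP[ey _]].
    apply: ler_wpM2r => //; apply: ni; rewrite /w -natr1 mulrDl mul1r; lra.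
  apply: le_cint_itv => //; first exact: bmeas_conv.
    by move=> y; rewrite mulr_ge0.
  by rewrite lerDl mulr_ge0.
pose n := (Num.truncn (v / (e / 2))).+1.
apply: lt_le_trans (H n) _; apply: ni.
have e2 : 0 < e / 2 by rewrite divr_gt0.
have : v / (e / 2) < n%:R by exact: truncnS_gt.
by rewrite ltr_pdivrMr// => /ltW /le_trans; apply; rewrite lerDr ltW.
Qed.

Section heavy.
Variables (K c : R -> R) (m : R).
Hypotheses (m0 : 0 < m) (bc : bmeas c) (c0 : forall y : R, 0 <= c y).
Hypothesis KE : forall u, K u = 1 - m^-1 * \int[mu]_(y in `[0, u]) c y.
Hypothesis Kgt0 : forall u, 0 < K u.
Hypothesis K_cvg0 : K u @[u --> +oo] --> 0.
Hypothesis Ksub : (m^-1 * conv K c u) / K u @[u --> +oo] --> (1 : R).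
Variables (b : R -> R) (A s beta : R).
Hypotheses (bb : bmeas b) (b0 : forall y : R, 0 <= b y).
Hypotheses (A0 : 0 <= A) (s0 : 0 < s).
Hypothesis bA : forall y : R, 0 <= y -> b y <= A * expR (- (s * y)).
Hypothesis b_cvg : \int[mu]_(y in `[0, u]) b y @[u --> +oo] --> beta.
Variables (p q : R).
Hypotheses (p0 : 0 <= p) (q0 : 0 <= q).

Let k y := p * b y + q * c y.
Let rho := p * beta + q * m.
Hypothesis rho1 : rho < 1.
Variable f : R -> R.
Hypothesis bf : bmeas f.
Hypothesis Hf : forall v, 0 <= v ->
  f v = rho - \int[mu]_(y in `[0, v]) k y + conv f k v.

Let alpha := q * m / (1 - rho).

(** [K] is asymptotically an eigenfunction: [conv K k ~ rho K]. So [f - alpha K] solves the equation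
    with forcing term [(q * m + alpha * rho - alpha) K] up to o([K]), and [alpha] is the value that
    annihilates the coefficient. [renewal_vanishing] then applies to the absolute value. *)
Lemma renewal_subexponential : f u / K u @[u --> +oo] --> alpha.
Proof.
have bK := bmeas_tail m0 bc c0 KE Kgt0.
have niK := tail_ni m0 bc c0 KE.
have Kge0 u : 0 <= K u by exact: ltW.
have bpb : bmeas (fun y => p * b y) by exact: bmeasZ.
have bqc : bmeas (fun y => q * c y) by exact: bmeasZ.
have bk : bmeas k by exact: bmeasD.
have k0 y : 0 <= k y by rewrite addr_ge0 ?mulr_ge0.
have beta0 : 0 <= beta by apply: le_trans (light_le bb b0 b_cvg 0); exact: cint_ge0.
have rho0 : 0 <= rho by rewrite addr_ge0 ?mulr_ge0// ltW.
have exK := exp_tail_negligible m0 bc c0 KE Kgt0 K_cvg0 Ksub.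
have cK : conv K k u / K u @[u --> +oo] --> rho.
  rewrite (_ : (fun u => _) = fun u => p * (conv K b u / K u) + q * (m * ((m^-1 * conv K c u) / K u))).
    rewrite /rho -[m in q * m]mulr1; apply: cvgD; apply: cvgMr; last exact: cvgMr.
    exact: (light_conv_cvg m0 bc c0 KE Kgt0 K_cvg0 Ksub bb b0 A0 s0 bA b_cvg).
  apply/funext => u; rewrite convDr// !convZr//; field.
  by rewrite !gt_eqF.
pose h v := rho - \int[mu]_(y in `[0, v]) k y.
have hE v : 0 <= v -> h v = p * (beta - \int[mu]_(y in `[0, v]) b y) + q * (m * K v).
  move=> v0; rewrite /h cintD// !cintZ//.
  have := cint_density m0 bc KE (lexx 0) v0; rewrite (tail0 m0 bc c0 KE)// => ->.
  by rewrite /rho; ring.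
have hK : h u / K u @[u --> +oo] --> q * m.
  have up : p * (A / s) * (expR (- (s * u)) / K u) + q * m @[u --> +oo] --> p * (A / s) * 0 + q * m.
    by apply: cvgD; [apply: cvgMr; exact: exK|exact: cvg_cst].
  rewrite mulr0 add0r in up.
  apply: (squeeze_cvgr _ (cvg_cst (q * m)) up); near=> u.
  have u0 : 0 <= u by near: u; apply: nbhs_pinfty_ge; exact: num_real.
  have /andP[H1 H2] := light_remainder bb b0 A0 s0 bA b_cvg u0.
  rewrite hE// mulrDl (_ : q * (m * K u) / K u = q * m); last by field; rewrite gt_eqF.
  rewrite lerDr lerD2r; apply/andP; split; first by rewrite divr_ge0// mulr_ge0.
  by rewrite mulrA ler_pM2r ?invr_gt0// -mulrA; exact: ler_wpM2l.
pose g u := f u - alpha * K u.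
have bg : bmeas g by apply: bmeasB => //; exact: bmeasZ.
suff gK : `|g u| / K u @[u --> +oo] --> 0.
  have gK' : g u / K u @[u --> +oo] --> 0.
    apply/cvgr0Pnorm_le => e e0; near=> u.
    rewrite normrM (ger0_norm (_ : 0 <= (K u)^-1)) ?invr_ge0//.
    rewrite -[leLHS]ger0_norm; last by rewrite divr_ge0.
    by near: u; apply: (cvgr0_norm_le _ gK).
  have L : g u / K u + alpha @[u --> +oo] --> 0 + alpha.
    by apply: cvgD => //; exact: cvg_cst.
  rewrite add0r in L; rewrite (_ : (fun u => f u / K u) = fun u => g u / K u + alpha)//.
  by apply/funext => u; rewrite /g; field; rewrite gt_eqF.
pose r u := `|h u + alpha * conv K k u - alpha * K u|.
apply: (@renewal_vanishing _ (fun u => `|g u|) r k K rho) => //.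
- exact: bmeas_norm.
- by rewrite rho0.
- move=> u u0; rewrite /r.
  have -> : g u = (h u + alpha * conv K k u - alpha * K u) + conv g k u.
    rewrite /g convBl//; last exact: bmeasZ.
    by rewrite convZl// Hf//; rewrite /h; ring.
  apply: (le_trans (ler_normD _ _)); rewrite lerD2l.
  exact: norm_conv_le.
- have L : h u / K u + alpha * (conv K k u / K u) - alpha @[u --> +oo] -->
      q * m + alpha * rho - alpha.
    by apply: cvgB; [apply: cvgD => //; exact: cvgMr|exact: cvg_cst].
  rewrite (_ : q * m + alpha * rho - alpha = 0) in L; last first.
    by rewrite /alpha; field; rewrite subr_eq0 gt_eqF.
  have E : (fun u => r u / K u) =
      (fun u => `|h u / K u + alpha * (conv K k u / K u) - alpha|).
    apply/funext => u; rewrite /r -[X in _ / X]ger0_norm// -normf_div.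
    by congr (Num.norm _); field; rewrite gt_eqF.
  by rewrite E; have := cvg_norm L; rewrite normr0; apply.
(* In the last window the light part has exponentially small mass and the heavy part
   [q * m * (K (u - L) - K u)], which is o([K u]) by [long_tail]. *)
- move=> L L0.
  have lt := long_tail m0 bc c0 KE Kgt0 K_cvg0 Ksub L0.
  have up : p * (A / s * (expR (s * L) * (expR (- (s * u)) / K u))) +
      q * (m * (K (u - L) / K u - 1)) @[u --> +oo] -->
      p * (A / s * (expR (s * L) * 0)) + q * (m * (1 - 1)).
    apply: cvgD; apply: cvgMr; apply: cvgMr; first by apply: cvgMr; exact: exK.
    by apply: cvgB => //; exact: cvg_cst.
  rewrite subrr !mulr0 addr0 in up.
  apply: (squeeze_cvgr _ (cvg_cst (0 : R)) up); near=> u.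
  have uL : L <= u by near: u; apply: nbhs_pinfty_ge; exact: num_real.
  have uL0 : 0 <= u - L by rewrite subr_ge0.
  have uLu : u - L <= u by rewrite gerBl.
  rewrite divr_ge0 ?cint_ge0//= ler_pdivrMr// cintD// !cintZ//.
  rewrite (cint_density m0 bc KE uL0 uLu).
  have H := light_itv bb A0 s0 bA u uL0.
  have -> : (p * (A / s * (expR (s * L) * (expR (- (s * u)) / K u))) +
      q * (m * (K (u - L) / K u - 1))) * K u =
      p * (A / s * (expR (s * L) * expR (- (s * u)))) + q * (m * (K (u - L) - K u)).
    by field; rewrite !gt_eqF.
  rewrite lerD2r; apply: ler_wpM2l => //; apply: (le_trans H).
  by rewrite -expRD (_ : s * L + - (s * u) = - (s * (u - L))); last by ring.
Unshelve. all: by end_near. Qed.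

End heavy.

End renewal_asymptotics.

(** * Phase-type distributions *)

Section cauchy_exp.
Context {R : realType}.

Lemma cauchy_partial (a b : nat -> R) n :
  \sum_(k < n) \sum_(i < k.+1) a i * b (k - i)%N =
  \sum_(i < n) a i * \sum_(j < n - i) b j.
Proof.
elim: n => [|n IH]; first by rewrite !big_ord0.
rewrite big_ord_recr/= IH [RHS]big_ord_recr/= subSnn big_ord1.
rewrite [X in _ + X]big_ord_recr/= subnn addrA -big_split/=; congr (_ + _).
apply: eq_bigr => i _; rewrite subSn ?big_ord_recr/= ?mulrDr//.
exact: ltnW (ltn_ord i).
Qed.

Definition exp_partial (y : R) n := \sum_(k < n) y ^+ k / k`!%:R.

Lemma exp_partial_cvg y : exp_partial y n @[n --> \oo] --> expR y.
Proof.
have := @is_cvg_series_exp_coeff R y; rewrite /expR => H.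
rewrite (_ : (fun n => exp_partial y n) = series (exp_coeff y))//.
apply/funext => n; rewrite /series/= big_mkord /exp_partial.
by apply: eq_bigr => i _.
Qed.

Lemma exp_partial_le y n : 0 <= y -> exp_partial y n <= expR y.
Proof.
move=> y0.
have nd : nondecreasing_seq (exp_partial y).
  apply/nondecreasing_seqP => k; rewrite /exp_partial big_ord_recr/= lerDl.
  by rewrite divr_ge0 ?exprn_ge0.
have := nondecreasing_cvgn_le nd (cvgP _ (@exp_partial_cvg y)) n.
by rewrite (cvg_lim _ (@exp_partial_cvg y)).
Qed.

Lemma exp_cauchy_term (x y : R) k :
  \sum_(i < k.+1) (x ^+ i / i`!%:R) * (y ^+ (k - i) / (k - i)`!%:R) =
  (x + y) ^+ k / k`!%:R.
Proof.
rewrite addrC exprDn mulr_suml; apply: eq_bigr => i _.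
have ik : (i <= k)%N by rewrite -ltnS.
rewrite -(bin_fact ik) !natrM -mulr_natr; field.
have fN (n : nat) : (n`!%:R : R) != 0 by rewrite pnatr_eq0 -lt0n fact_gt0.
have bN : ('C(k, i)%:R : R) != 0 by rewrite pnatr_eq0 -lt0n bin_gt0.
by rewrite !fN bN.
Qed.

(** The double sum is the Cauchy product of the series of [expR (- y)] with that of the [b j], whose
    partial sums stay below [D * expR (kap * y)]. Replacing the triangle of indices by the square
    costs at most [D] times the same defect for [expR y * expR y], which tends to 0. *)
Lemma exp_cauchy_le (y D kap : R) (p : nat -> R) (l : R) : 0 <= y -> 0 <= D ->
  0 <= kap <= 1 -> (forall j, 0 <= p j <= D * kap ^+ j) ->
  \sum_(k < n) \sum_(i < k.+1)
    ((- y) ^+ i / i`!%:R) * (y ^+ (k - i) * p (k - i)%N / (k - i)`!%:R)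
    @[n --> \oo] --> l ->
  l <= D * expR (- ((1 - kap) * y)).
Proof.
move=> y0 D0 /andP[kap0 kap1] pD Hl.
pose a i := (- y) ^+ i / i`!%:R; pose a' i := y ^+ i / i`!%:R.
pose b j := y ^+ j * p j / j`!%:R.
pose B n := \sum_(j < n) b j.
have b0 j : 0 <= b j.
  by rewrite divr_ge0// mulr_ge0 ?exprn_ge0//; case/andP: (pD j).
have b_le j : b j <= D * a' j.
  rewrite /b /a' mulrA ler_wpM2r ?invr_ge0// mulrC ler_wpM2r ?exprn_ge0//.
  case/andP: (pD j) => _ /le_trans; apply; rewrite ler_piMr//.
  by rewrite exprn_ile1.
have B_le n : B n <= D * expR (kap * y).
  apply: (@le_trans _ _ (D * exp_partial (kap * y) n)).
    rewrite /exp_partial mulr_sumr; apply: ler_sum => j _.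
    rewrite /b mulrA ler_wpM2r ?invr_ge0// exprMn mulrA mulrC.
    by rewrite ler_wpM2r ?exprn_ge0//; case/andP: (pD j).
  by apply: ler_wpM2l => //; apply: exp_partial_le; exact: mulr_ge0.
have B0 n : 0 <= B n by rewrite sumr_ge0.
have na i : `|a i| = a' i.
  by rewrite normrM normrX normrN (ger0_norm y0) ger0_norm ?invr_ge0.
have a'0 i : 0 <= a' i by rewrite divr_ge0 ?exprn_ge0.
have err n : \sum_(k < n) \sum_(i < k.+1) a i * b (k - i)%N <=
    exp_partial (- y) n * B n + D * (exp_partial y n * exp_partial y n - exp_partial (y + y) n).
  rewrite cauchy_partial -lerBlDl.
  have -> : exp_partial y n * exp_partial y n - exp_partial (y + y) n =
      \sum_(i < n) a' i * \sum_(n - i <= j < n) a' j.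
    rewrite [exp_partial (y + y) n](_ : _ = \sum_(i < n) a' i * \sum_(j < n - i) a' j).
      rewrite /exp_partial mulr_suml -sumrB; apply: eq_bigr => i _.
      rewrite -mulrBr; congr (_ * _).
      rewrite -!(big_mkord xpredT (fun i => y ^+ i / i`!%:R)).
      by rewrite (big_cat_nat _ (leq_subr i n))//= addrAC subrr add0r.
    rewrite -cauchy_partial; apply: eq_bigr => k _.
    by rewrite -exp_cauchy_term.
  have -> : \sum_(i < n) a i * \sum_(j < n - i) b j - exp_partial (- y) n * B n =
      \sum_(i < n) a i * (\sum_(j < n - i) b j - B n).
    rewrite /exp_partial mulr_suml -sumrB.
    by apply: eq_bigr => i _; rewrite mulrBr.
  rewrite mulr_sumr; apply: ler_sum => i _.
  apply: (le_trans (ler_norm _)); rewrite normrM na.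
  rewrite mulrCA ler_wpM2l// mulr_sumr.
  rewrite /B -!(big_mkord xpredT b) (big_cat_nat _ (leq_subr i n))//= opprD addrA subrr add0r.
  rewrite normrN; apply: (le_trans (ler_norm_sum _ _ _)).
  by apply: ler_sum => j _; rewrite ger0_norm.
have L : exp_partial (- y) n * (D * expR (kap * y)) +
   D * (exp_partial y n * exp_partial y n - exp_partial (y + y) n) @[n --> \oo] -->
   expR (- y) * (D * expR (kap * y)) + D * (expR y * expR y - expR (y + y)).
  apply: cvgD; first by apply: cvgMl; exact: exp_partial_cvg.
  apply: cvgMr; apply: cvgB; last exact: exp_partial_cvg.
  by apply: cvgM; exact: exp_partial_cvg.
rewrite [X in D * (_ - X)]expRD subrr mulr0 addr0 mulrCA -expRD in L.
rewrite (_ : - ((1 - kap) * y) = - y + kap * y); last by ring.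
apply: (ler_cvg_to Hl L); near=> n.
(* Replacing [B n] by its bound needs [0 <= exp_partial (- y) n], which can fail for small [n] but
   holds eventually, the limit being positive. *)
apply: (le_trans (err n)); rewrite lerD2r; apply: ler_wpM2l => //.
apply: ltW; near: n; apply: (cvgr_gt _ (@exp_partial_cvg (- y))); exact: expR_gt0.
Unshelve. all: by end_near. Qed.

End cauchy_exp.

Section subintensity.
Context {R : realType} {n : nat}.
Variable S : 'M[R]_n.+1.
Hypothesis Soff : forall i j, i != j -> 0 <= S i j.
Hypothesis Srow : forall i, \sum_j S i j <= 0.
Hypothesis Sunit : S \in unitmx.

(** The uniformization rate: it dominates every [|S i i|], so that [unif] has a nonnegative
    diagonal, and the summand 1 keeps it positive. *)
Local Notation q := (1 + \sum_i `|S i i|).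

Lemma unif_rate_gt0 : 0 < q.
Proof. by rewrite ltr_pwDl// sumr_ge0. Qed.

(* Uniformization: expmx (t *: S) = expR (- (q * t)) *: expmx ((q * t) *: unif),
   where unif is substochastic. *)
Definition unif : 'M[R]_n.+1 := 1 + q^-1 *: S.

Lemma unifE : S = q *: (unif - 1).
Proof. by rewrite /unif addrAC subrr add0r scalerA mulfV ?scale1r// gt_eqF// unif_rate_gt0. Qed.

Lemma unif_ge0 i j : 0 <= unif i j.
Proof.
rewrite !mxE; have q0 := unif_rate_gt0.
have [->|ij] := eqVneq i j; last by rewrite add0r mulr_ge0 ?invr_ge0 ?(ltW q0)// Soff.
rewrite -lerBlDl sub0r -ler_pdivrMl ?invr_gt0// invrK.
apply: (@le_trans _ _ (- `|S j j|)); last by rewrite lerNl -normrN ler_norm.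
rewrite mulrN1 lerN2 (bigD1 j)//= addrCA lerDl addr_ge0// sumr_ge0//.
Qed.

(* Minimum principle: at the index minimizing x, the off-diagonal terms of
   (S x)_i = -1 only increase it, so x_i <= 0 is impossible. *)
Lemma subintensity_supersolution : exists x : 'cV[R]_n.+1,
  (forall i, 0 < x i 0) /\ S *m x = const_mx (-1).
Proof.
pose x : 'cV[R]_n.+1 := invmx S *m const_mx (-1); exists x.
have Sx : S *m x = const_mx (-1) by rewrite /x mulKVmx.
split => // i0.
pose i := [arg min_(i < ord0) x i 0]%O.
have imin j : x i 0 <= x j 0.
  by rewrite /i; case: arg_minP => // k _; apply.
apply: lt_le_trans (imin i0); rewrite ltNge; apply/negP => xi.
have := congr1 (fun M : 'cV[R]_n.+1 => M i 0) Sx; rewrite !mxE => E.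
have : 0 <= \sum_j S i j * x j 0.
  have -> : \sum_j S i j * x j 0 = (\sum_j S i j) * x i 0 + \sum_j S i j * (x j 0 - x i 0).
    by rewrite mulr_suml -big_split/=; apply: eq_bigr => j _; ring.
  apply: addr_ge0; first exact: mulr_le0.
  apply: sumr_ge0 => j _; have [<-|ij] := eqVneq i j; first by rewrite subrr mulr0.
  by rewrite mulr_ge0 ?Soff// subr_ge0.
by rewrite E; lra.
Qed.

(** [unif] lowers each entry of the supersolution [x] by [q^-1]; as no entry exceeds the sum [X],
    this is a contraction by at least [1 - (q * X)^-1]. The positive weight [x] replaces a spectral
    radius argument. *)
Lemma unif_contraction : exists (x : 'cV[R]_n.+1) (kap : R),
  [/\ forall i, 0 < x i 0, 0 <= kap < 1 & forall i, (unif *m x) i 0 <= kap * x i 0].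
Proof.
have [x [x0 Sx]] := subintensity_supersolution.
have q0 := unif_rate_gt0.
pose X := \sum_i x i 0.
have xX i : x i 0 <= X by rewrite /X (bigD1 i)//= lerDl sumr_ge0// => j _; exact: ltW.
have X0 : 0 < X by exact: lt_le_trans (xX ord0).
pose kap := 1 - (q * X)^-1.
have Hk i : (unif *m x) i 0 <= kap * x i 0.
  rewrite /unif mulmxDl mul1mx -scalemxAl Sx !mxE mulrN1 /kap mulrBl mul1r lerD2l lerN2.
  by rewrite invfM -mulrA ler_piMr ?invr_ge0 ?(ltW q0)// ler_pdivrMl// mulr1.
exists x, kap; split => //; apply/andP; split; last first.
  by rewrite /kap gtrBl invr_gt0 mulr_gt0.
rewrite -(pmulr_lge0 _ (x0 ord0)); apply: le_trans (Hk ord0).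
by rewrite mxE sumr_ge0// => j _; rewrite mulr_ge0 ?unif_ge0// ltW.
Qed.

Lemma unif_pow_le (x : 'cV[R]_n.+1) kap : (forall i, 0 < x i 0) -> 0 <= kap ->
  (forall i, (unif *m x) i 0 <= kap * x i 0) ->
  forall j i, (unif ^+ j *m x) i 0 <= kap ^+ j * x i 0.
Proof.
move=> x0 kap0 H; elim=> [|j IH] i; first by rewrite expr0 mul1mx mul1r.
rewrite exprS -mulmxA mxE.
apply: (@le_trans _ _ (\sum_l unif i l * (kap ^+ j * x l 0))).
  by apply: ler_sum => l _; apply: ler_wpM2l => //; exact: unif_ge0.
under eq_bigr do rewrite mulrCA; rewrite -mulr_sumr exprSr -mulrA.
by apply: ler_wpM2l; [exact: exprn_ge0|have := H i; rewrite mxE].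
Qed.

Lemma unif_pow_ge0 j i l : 0 <= (unif ^+ j) i l.
Proof.
elim: j i l => [|j IH] i l; first by rewrite expr0 mxE ler0n.
by rewrite exprS mxE sumr_ge0// => m _; rewrite mulr_ge0 ?unif_ge0.
Qed.

End subintensity.

Section matrix_exponential.
Context {R : realType} {n : nat}.

Lemma mx_pow_entry_le (A : 'M[R]_n.+1) k i j :
  `|(A ^+ k) i j| <= (\sum_i \sum_j `|A i j|) ^+ k.
Proof.
set M := \sum_i _.
have M0 : 0 <= M by rewrite sumr_ge0// => l _; rewrite sumr_ge0.
elim: k i j => [|k IH] i j.
  by rewrite expr0 mxE; case: eqP => _; rewrite ?normr1 ?normr0.
rewrite exprS mxE (le_trans (ler_norm_sum _ _ _))//.
apply: (@le_trans _ _ (\sum_l `|A i l| * M ^+ k)).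
  by apply: ler_sum => l _; rewrite normrM ler_wpM2l.
rewrite -mulr_suml exprS ler_wpM2r ?exprn_ge0//.
by rewrite /M [leRHS](bigD1 i)//= lerDl sumr_ge0// => l _; rewrite sumr_ge0.
Qed.

Lemma expmx_cvg (A : 'M[R]_n.+1) i j :
  \sum_(k < m) (k`!%:R^-1 *: A ^+ k) i j @[m --> \oo] --> expmx A i j.
Proof.
rewrite mxE.
have -> : (fun m => \sum_(k < m) (k`!%:R^-1 *: A ^+ k) i j) =
    series (fun k => (k`!%:R^-1 *: A ^+ k) i j).
  by apply/funext => m; rewrite /series/= big_mkord.
apply: (@normed_cvg R R^o).
apply: (series_le_cvg _ _ _ (is_cvg_series_exp_coeff (\sum_i \sum_j `|A i j|))) => k //=.
- by rewrite /exp_coeff/= divr_ge0// exprn_ge0// sumr_ge0// => l _; rewrite sumr_ge0.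
- rewrite /exp_coeff/= mxE normrM ger0_norm ?invr_ge0// mulrC ler_wpM2r ?invr_ge0//.
  exact: mx_pow_entry_le.
Qed.

Lemma bilinear_sumE (al : 'rV[R]_n.+1) (M : 'M[R]_n.+1) (x : 'cV[R]_n.+1) :
  (al *m M *m x) 0 0 = \sum_i \sum_j al 0 i * M i j * x j 0.
Proof.
rewrite mxE exchange_big/=; apply: eq_bigr => j _.
by rewrite mxE mulr_suml.
Qed.

Lemma expmx_bilinear_cvg (al : 'rV[R]_n.+1) (A : 'M[R]_n.+1) (x : 'cV[R]_n.+1) :
  \sum_(k < m) k`!%:R^-1 * (al *m A ^+ k *m x) 0 0 @[m --> \oo] -->
  (al *m expmx A *m x) 0 0.
Proof.
rewrite bilinear_sumE.
have -> : (fun m => \sum_(k < m) k`!%:R^-1 * (al *m A ^+ k *m x) 0 0) =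
  (fun m => \sum_i \sum_j al 0 i * (\sum_(k < m) (k`!%:R^-1 *: A ^+ k) i j) * x j 0).
  apply/funext => m; under eq_bigr do rewrite bilinear_sumE mulr_sumr.
  rewrite exchange_big/=; apply: eq_bigr => i _.
  under eq_bigr do rewrite mulr_sumr.
  rewrite exchange_big/=; apply: eq_bigr => j _.
  rewrite mulr_sumr mulr_suml; apply: eq_bigr => k _; rewrite mxE; ring.
apply: cvg_big => [|i _]; first exact: add_continuous.
apply: cvg_big => [|j _]; first exact: add_continuous.
by apply: cvgMl; apply: cvgMr; exact: expmx_cvg.
Qed.

End matrix_exponential.

(** Uniformization makes the tail a Poisson mixture, of mean [q * t], of the survival probabilities
    [p j] of a discrete chain. These are at most [D * kap ^+ j], and mixing a geometric sequence
    gives [expR (- ((1 - kap) * q * t))]. *)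
Lemma phase_type_tail (R : realType) (F : probability R R) : phase_type F ->
  exists A s : R, [/\ 0 <= A, 0 < s & forall y, 0 <= y ->
    1 - fine (F `]-oo, y]%classic) <= A * expR (- (s * y))].
Proof.
move=> [n [al [S [[al0 al1] Soff Srow Sunit [_ FE]]]]].
have [x [kap [x0 /andP[kap0 kap1] Qx]]] := unif_contraction Soff Srow Sunit.
set q := 1 + \sum_i `|S i i|.
have q0 : 0 < q := unif_rate_gt0 S.
pose Q := unif S.
pose e : 'cV[R]_n.+1 := const_mx 1.
pose p j := (al *m Q ^+ j *m e) 0 0.
(* The vector of ones is dominated by [x] times the sum of its inverse entries, which transfers the
   contraction from [x] to the ones. *)
pose D := \sum_i al 0 i * (\sum_j (x j 0)^-1) * x i 0.
have X0 : 0 <= \sum_j (x j 0)^-1 by rewrite sumr_ge0// => j _; rewrite invr_ge0 ltW.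
have D0 : 0 <= D by rewrite sumr_ge0// => i _; rewrite !mulr_ge0// ltW.
have pD j : 0 <= p j <= D * kap ^+ j.
  rewrite /p bilinear_sumE; apply/andP; split.
    rewrite sumr_ge0// => i _; rewrite sumr_ge0// => l _.
    by rewrite !mulr_ge0 ?unif_pow_ge0// mxE.
  rewrite /D mulr_suml; apply: ler_sum => i _.
  apply: (@le_trans _ _ (al 0 i * (\sum_j (x j 0)^-1) * (Q ^+ j *m x) i 0)).
    rewrite mxE mulr_sumr; apply: ler_sum => l _; rewrite mxE mulr1.
    rewrite -mulrA; apply: ler_wpM2l => //; rewrite mulrCA -[leLHS]mulr1.
    apply: ler_wpM2l; first exact: unif_pow_ge0.
    rewrite -(mulVf (lt0r_neq0 (x0 l))); apply: ler_wpM2r; first exact: ltW.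
    by rewrite (bigD1 l)//= lerDl sumr_ge0// => j' _; rewrite invr_ge0 ltW.
  rewrite -!mulrA; apply: ler_wpM2l => //; apply: ler_wpM2l => //.
  by rewrite mulrC; exact: unif_pow_le.
exists D, ((1 - kap) * q); split => //; first by rewrite mulr_gt0// subr_gt0.
move=> t t0; rewrite FE//= opprB addrCA subrr addr0.
rewrite -mulrA; apply: (exp_cauchy_le (p := p)) => //.
- by rewrite mulr_ge0// ltW.
- by rewrite kap0 ltW.
suff E : (fun m => \sum_(k < m) k`!%:R^-1 * (al *m (t *: S) ^+ k *m e) 0 0) =
    (fun m => \sum_(k < m) \sum_(i < k.+1) (- (q * t)) ^+ i / i`!%:R *
       ((q * t) ^+ (k - i) * p (k - i)%N / (k - i)`!%:R)).
  by rewrite -E; exact: expmx_bilinear_cvg.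
apply/funext => m; apply: eq_bigr => k _.
have -> : t *: S = (q * t) *: Q + (- (q * t)) *: (1 : 'M[R]_n.+1).
  by rewrite [in LHS](unifE S) -/Q -/q scalerA mulrC scalerBr scaleNr.
rewrite exprDn_comm; last by rewrite /GRing.comm -!scalerAl -!scalerAr mul1r mulr1 !scalerA mulrC.
rewrite mulmx_sumr mulmx_suml summxE mulr_sumr; apply: eq_bigr => i _.
have ik : (i <= k)%N by rewrite -ltnS.
rewrite !exprZn expr1n -scalerAl -scalerAr mulr1 scalerA.
rewrite -[X in al *m X]scaler_nat scalerA -scalemxAr -scalemxAl mxE -/(p (k - i)%N).
rewrite -(bin_fact ik) !natrM; field.
have fN (l : nat) : (l`!%:R : R) != 0 by rewrite pnatr_eq0 -lt0n fact_gt0.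
have bN : ('C(k, i)%:R : R) != 0 by rewrite pnatr_eq0 -lt0n bin_gt0.
by rewrite !fN bN.
Qed.

(** * The excess distribution *)

Section tails_of_random_variables.
Context {R : realType}.
Local Notation mu := (@lebesgue_measure R).

Lemma nondecreasing_cvg_pinfty (f : R -> R) (l : R) : nondecreasing_fun f ->
  f n%:R @[n --> \oo] --> l -> f u @[u --> +oo] --> l.
Proof.
move=> nd fl.
have fle u : f u <= l.
  apply: (ler_cvg_to (cvg_cst (f u)) fl); near=> n; apply: nd.
  near: n; exact: nbhs_infty_ger.
apply/cvgrPdist_le => e e0.
have [n _ /(_ n (leqnn n)) Hn] : \forall n \near \oo, l - e <= f n%:R.
  by apply: (cvgr_ge _ fl); rewrite gtrBl.
near=> u; rewrite ger0_norm ?subr_ge0// lerBlDr -lerBlDl.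
apply: (le_trans Hn); apply: nd; near: u; apply: nbhs_pinfty_ge; exact: num_real.
Unshelve. all: by end_near. Qed.

Lemma tail_integral_cvg d (T : measurableType d) (P : probability T R)
    (X : {RV P >-> R}) : {ae P, forall w, 0 <= X w} -> ('E_P[X] < +oo)%E ->
  \int[mu]_(y in `[0, u]) (1 - fine (distribution P X `]-oo, y]%classic)) @[u --> +oo] -->
  fine 'E_P[X].
Proof.
move=> X0 EX.
pose b y := 1 - fine (distribution P X `]-oo, y]%classic).
have b01 y : 0 <= b y <= 1.
  by have := nu_cdf_bounds (distribution P X) y; rewrite /b; lra.
have b_ni : nonincreasing_fun b.
  by move=> x y xy; rewrite lerD2l lerN2; exact: nu_cdf_nd.
have bb : bmeas b by exact: bmeas_nonincreasing b_ni b01.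
have b0 y : 0 <= b y by case/andP: (b01 y).
apply: (@nondecreasing_cvg_pinfty (fun u => \int[mu]_(y in `[0, u]) b y)).
  by move=> u v uv; exact: le_cint_itv.
(* The tail formula for the expectation is applied to a variable nonnegative everywhere, while [X]
   is so only almost everywhere; its positive part has the same tail on [[0, +oo[]. *)
pose Y' w := Num.max (X w) 0.
have mY : measurable_fun setT Y' by apply: measurable_maxr => //; exact: measurable_cst.
pose Y : {RV P >-> R} := mfun_Sub (mem_set mY).
have EY : ('E_P[Y] = 'E_P[X])%E.
  rewrite !expectation_def; apply: ae_eq_integral => //.
  - exact/measurable_EFinP.
  - exact/measurable_EFinP.
  by apply: filterS X0 => w X0 _; rewrite /= /Y' max_l.
have YE y : 0 <= y -> ccdf Y y = (b y)%:E.
  move=> y0; rewrite /ccdf /b EFinB -nu_cdfE -probability_setC// setCitvl.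
  rewrite /distribution /pushforward; congr (P _).
  by apply/seteqP; split => w /=; rewrite !in_itv/= !andbT lt_max (ltNge y 0) y0 orbF.
have EYE : ('E_P[Y] = \int[mu]_(y in `[0%R, +oo[) (b y)%:E)%E.
  rewrite ge0_expectation_ccdf.
    apply: eq_integral => y; rewrite inE/= in_itv/= andbT; exact: YE.
  by move=> w; rewrite /Y/= /Y' le_max lexx orbT.
pose D (n : nat) : set R := `[0, n%:R]%classic.
have UD : \bigcup_n D n = `[0, +oo[%classic.
  apply/seteqP; split => y /=.
    by move=> [n _]; rewrite /D/= !in_itv/= andbT => /andP[].
  rewrite in_itv/= andbT => y0; exists (Num.truncn y).+1 => //.
  by rewrite /D/= in_itv/= y0 ltW// truncnS_gt.
have := @ge0_nondecreasing_set_cvg_integral _ (measurableTypeR R) R D (EFin \o b) mu.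
rewrite UD -EYE EY => H.
apply: (@fine_cvg _ _ _ _ (fun n => \int[mu]_(y in `[0%R, n%:R]) (b y)%:E)%E).
rewrite fineK; last first.
  by rewrite ge0_fin_numE// -EY EYE; apply: integral_ge0 => y _; rewrite lee_fin.
apply: H.
- move=> n k nk; apply/subsetPset; apply: subset_itvl.
  by rewrite bnd_simp ler_nat.
- by move=> n; exact: measurable_itv.
- by move=> n; apply: measurable_funTS; apply/measurable_EFinP; exact: bb.1.
- by move=> n y _; rewrite /= lee_fin.
Qed.

End tails_of_random_variables.

Section subexponential_excess.
Context {R : realType}.
Local Notation mu := (@lebesgue_measure R).
Variables (nu : probability R R) (c : R -> R) (m : R).
Hypotheses (m0 : 0 < m) (bc : bmeas c) (c0 : forall y : R, 0 <= c y).
Local Notation G x := (fine (nu `]-oo, x]%classic)).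
Hypothesis GE : forall u, G u = m^-1 * \int[mu]_(y in `[0, u]) c y.
Hypothesis nu_sub : subexponential nu.

Let K u := 1 - G u.

Let nu_ge0 : nu `]-oo, 0[%classic = 0%E.
Proof.
apply/eqP; rewrite -measure_le0; apply: (@le_trans _ _ (nu `]-oo, 0]%classic)).
  by apply: le_measure; rewrite ?inE//; apply: subset_itvl; rewrite bnd_simp.
by rewrite nu_cdfE GE set_itv1 Rintegral_set1 mulr0.
Qed.

Let conv2E u : 0 <= u ->
  conv_pow nu 2 `]-oo, u]%classic = (m^-1 * conv (fun x => G x) c u)%:E.
Proof.
move=> u0.
have bG := bmeas_nu_cdf nu.
have c1 (B : set R) : measurable B -> conv_pow nu 1 B = nu B.
  move=> mB; rewrite /= -[RHS]mul1e -[X in (X * _)%E]/(1%:E) -[B in RHS]setIT -integral_indic//.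
  rewrite mul1e; apply: eq_integral => x _; rewrite diracE indicE.
  by congr (_%:R%:E); congr nat_of_bool; apply/idP/idP; rewrite !inE/= addr0.
rewrite (_ : conv_pow nu 2 _ =
    \int[nu]_x (m^-1 * \int[mu]_(y in `[0%R, (u - x)%R]) c y)%:E)%E; last first.
  apply: eq_integral => x _; rewrite -GE -nu_cdfE.
  have E : [set y | `]-oo, u]%classic (x + y)] = `]-oo, u - x]%classic.
    by apply/seteqP; split => y /=; rewrite !in_itv/= lerBrDl.
  by rewrite E -c1.
under eq_integral do rewrite EFinM.
rewrite ge0_integralZl_EFin//.
- rewrite integral_primitive// -EFinM; congr (_ * _)%:E.
  by apply: eq_cint => x _; rewrite mulrC.
- by move=> x _; rewrite lee_fin cint_ge0.
- apply/measurable_EFinP; apply: nonincreasing_measurable => // x y xy.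
  by apply: le_cint_itv => //; rewrite lerD2l lerN2.
- by rewrite invr_ge0 ltW.
Qed.

Let K_ge0 u : 0 <= K u.
Proof. by rewrite /K subr_ge0; case/andP: (nu_cdf_bounds nu u). Qed.

Let bK : bmeas K.
Proof. by apply: bmeasB; [exact: bmeas_cst|exact: bmeas_nu_cdf]. Qed.

(* A vanishing tail would make the ratio 0 / 0 = 0, so its limit could not be 2. *)
Lemma subexponential_tail_gt0 u : 0 < K u.
Proof.
rewrite lt0r K_ge0 andbT; apply/negP => /eqP Ku.
have [_ /(_ 2%N isT) lim2] := nu_sub.
have lim0 : (1 - fine (conv_pow nu 2 `]-oo, u]%classic)) /
    (1 - fine (nu `]-oo, u]%classic)) @[u --> +oo] --> (0 : R).
  apply: cvg_near_cst; near=> v; rewrite -/(K v).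
  have -> : K v = 0; last by rewrite invr0 mulr0.
  apply/eqP; rewrite eq_le K_ge0 andbT -Ku lerD2l lerN2; apply: nu_cdf_nd.
  near: v; apply: nbhs_pinfty_ge; exact: num_real.
have E : (0 : R) = 2%:R by exact: (cvg_unique _ lim0 lim2).
by move: E => /eqP; rewrite eq_sym pnatr_eq0.
Unshelve. all: by end_near. Qed.

(** The tail of the twofold convolution is [K u + m^-1 * conv K c u], so the ratio 2 leaves 1 for
    the second summand. *)
Lemma subexponential_conv : (m^-1 * conv K c u) / K u @[u --> +oo] --> (1 : R).
Proof.
have [_ /(_ 2%N isT) lim2] := nu_sub.
have L : (1 - fine (conv_pow nu 2 `]-oo, u]%classic)) / (1 - G u) - 1 @[u --> +oo]
    --> (2%:R - 1 : R).
  by apply: cvgB => //; exact: cvg_cst.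
rewrite (_ : 2%:R - 1 = 1 :> R) in L; last by rewrite mulr2n addrK.
apply: cvg_trans L; apply: near_eq_cvg; near=> u.
have u0 : 0 <= u by near: u; apply: nbhs_pinfty_ge; exact: num_real.
have Ku := subexponential_tail_gt0 u.
rewrite conv2E//= -/(K u).
have -> : conv (fun x => G x) c u = \int[mu]_(y in `[0, u]) c y - conv K c u.
  rewrite -conv1// -convBl//; last exact: bmeas_cst.
  by apply: eq_cint => y _; rewrite /K subKr.
rewrite mulrBr -GE opprB addrCA -/(K u); field; rewrite gt_eqF//=.
by rewrite gt_eqF.
Unshelve. all: by end_near. Qed.

End subexponential_excess.

(** * Adding light-tailed summands to a long-tailed variable *)

Section light_perturbation.
Context {R : realType} {d : measure_display} {T : measurableType d}.
Variable P : probability T R.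
Variables (X Y : {RV P >-> \bar R}) (Z : {RV P >-> R}).
Hypothesis indXYZ : independent3 P X Y Z.
Variables (r D : R).
Hypotheses (r0 : 0 < r) (D0 : 0 <= D).
Hypothesis X_ge0 : P [set w | (0 <= X w)%E] = 1%E.
Hypothesis Y_ge0 : P [set w | (0 <= Y w)%E] = 1%E.
Hypothesis X_le : forall u : R, 0 <= u ->
  (P [set w | (u%:E < X w)%E] <= (D * expR (- (r * u)))%:E)%E.
Hypothesis Y_le : forall u : R, 0 <= u ->
  (P [set w | (u%:E < Y w)%E] <= (D * expR (- (r * u)))%:E)%E.
Variable K : R -> R.
Hypothesis ZE : forall u : R, P [set w | u < Z w] = (K u)%:E.
Hypothesis Kgt0 : forall u, 0 < K u.
Hypothesis K_long : forall L : R, 0 <= L -> K (u - L) / K u @[u --> +oo] --> (1 : R).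
Hypothesis K_exp : forall a : R, 0 < a -> expR (- (a * u)) / K u @[u --> +oo] --> 0.
Hypothesis K_shift : forall a : R, 0 < a ->
  exists2 C, 0 < C & forall u y : R, 0 <= y -> K (u - y) <= C * expR (a * y) * K u.

Let W (u : R) : set T := [set w | (u%:E < X w + Y w + (Z w)%:E)%E].

Lemma measurable_gt_RV (V : {RV P >-> \bar R}) (u : R) :
  measurable [set w | (u%:E < V w)%E].
Proof.
by rewrite -[X in measurable X]setTI; apply: measurable_lte.
Qed.

Lemma measurable_ge0_RV (V : {RV P >-> \bar R}) : measurable [set w | (0 <= V w)%E].
Proof.
by rewrite -[X in measurable X]setTI; apply: measurable_lee => //; exact: measurable_cst.
Qed.

Let mZ u : measurable [set w | u < Z w].
Proof.
rewrite (_ : [set _ | _] = Z @^-1` `]u, +oo[%classic); first exact: measurable_funPTI.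
by apply/seteqP; split => w /=; rewrite in_itv/= andbT.
Qed.

Let mgt (x : R) : measurable [set v | (x%:E < v)%E].
Proof.
by rewrite -[X in measurable X]setTI; apply: measurable_lte.
Qed.

Lemma measurable_sum3 u : measurable (W u).
Proof.
rewrite -[X in measurable X]setTI; apply: measurable_lte => //.
apply: emeasurable_funD; first exact: emeasurable_funD.
by apply/measurable_EFinP.
Qed.

Let K0 u : 0 <= K u. Proof. exact: ltW. Qed.

Let W_ge (u : R) : (P [set w | (u < Z w)%R] <= P (W u))%E.
Proof.
have nX : P (~` [set w | (0 <= X w)%E]) = 0%E.
  by rewrite probability_setC ?X_ge0 ?subee//; exact: measurable_ge0_RV.
have nY : P (~` [set w | (0 <= Y w)%E]) = 0%E.
  by rewrite probability_setC ?Y_ge0 ?subee//; exact: measurable_ge0_RV.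
have mX : measurable (~` [set w | (0 <= X w)%E]).
  by apply: measurableC; exact: measurable_ge0_RV.
have mY : measurable (~` [set w | (0 <= Y w)%E]).
  by apply: measurableC; exact: measurable_ge0_RV.
have mW := measurable_sum3 u.
apply: (@le_trans _ _ (P (W u `|` (~` [set w | (0 <= X w)%E] `|` ~` [set w | (0 <= Y w)%E])))).
  apply: le_measure; rewrite ?inE//.
    by apply: measurableU => //; exact: measurableU.
  move=> w /= uZ; have [Xw|Xw] := boolP (0 <= X w)%E; last by right; left; exact/negP.
  have [Yw|Yw] := boolP (0 <= Y w)%E; last by right; right; exact/negP.
  left; rewrite /W/=; apply: (@lt_le_trans _ _ (Z w)%:E); first by rewrite lte_fin.
  by rewrite leeDr// adde_ge0.
apply: (le_trans (measureU2 _ _ _)) => //; first exact: measurableU.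
rewrite -[leRHS]adde0 leeD2l//; apply: (le_trans (measureU2 _ _ _)) => //.
by rewrite [X in (X + _)%E]nX [X in (_ + X)%E]nY adde0.
Qed.

(** If [j <= X + Y < j + 1], then [X] or [Y] exceeds [(j - 1) / 2], and [W u] forces
    [Z > u - (j + 1)]. A strict threshold [j / 2] would miss the case [X = Y = j / 2]. *)
Let A (u : R) (j : nat) : set T :=
  ([set w | (((j%:R - 1) / 2)%:E < X w)%E] `|` [set w | (((j%:R - 1) / 2)%:E < Y w)%E])
  `&` [set w | u - (j%:R + 1) < Z w].

Let A' (u : R) (L j : nat) : set T := if (L <= j)%N then A u j else set0.

Let B (n : nat) : set T :=
  [set w | ((n%:R / 2)%:E < X w)%E] `|` [set w | ((n%:R / 2)%:E < Y w)%E].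

Let mA u j : measurable (A u j).
Proof.
by apply: measurableI => //; apply: measurableU; exact: measurable_gt_RV.
Qed.

Let mB n : measurable (B n).
Proof. by apply: measurableU; exact: measurable_gt_RV. Qed.

Let indX (x z : R) : P ([set w | (x%:E < X w)%E] `&` [set w | z < Z w]) =
  (P [set w | (x%:E < X w)%E] * P [set w | (z < Z w)%R])%E.
Proof.
have E : [set w | z < Z w] = Z @^-1` `]z, +oo[%classic.
  by apply/seteqP; split => w /=; rewrite in_itv/= andbT.
have := indXYZ (mgt x) measurableT (measurable_itv `]z, +oo[).
by rewrite preimage_setT setIT probability_setT mule1 E.
Qed.

Let indY (y z : R) : P ([set w | (y%:E < Y w)%E] `&` [set w | z < Z w]) =
  (P [set w | (y%:E < Y w)%E] * P [set w | (z < Z w)%R])%E.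
Proof.
have E : [set w | z < Z w] = Z @^-1` `]z, +oo[%classic.
  by apply/seteqP; split => w /=; rewrite in_itv/= andbT.
have := indXYZ measurableT (mgt y) (measurable_itv `]z, +oo[).
by rewrite preimage_setT setTI probability_setT mul1e E.
Qed.

Let W_sub (u : R) (L n : nat) : u <= n%:R -> (0 < L)%N ->
  W u `<=` [set w | u - L%:R < Z w] `|`
    \big[setU/set0]_(j < n.+1) A' u L j `|` B n.
Proof.
move=> un L0 w; rewrite /W/= => uW.
have [Bw|nB] := pselect (B n w); first by right.
left; move: nB => /not_orP[/= /negP + /negP]; rewrite -!leNgt => Xn Yn.
(* Outside [B n] the value [+oo] is excluded; [-oo] absorbs every other summand and would contradict
   [uW]. *)
have [x Xx] : exists x, X w = x%:E.
  by move: uW Xn; case: (X w) => [x| |]// _ _; exists x.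
have [y Yy] : exists y, Y w = y%:E.
  by move: uW Yn; case: (Y w) => [y| |]//; rewrite ?addeNy// => _ _; exists y.
move: uW Xn Yn; rewrite Xx Yy -!EFinD lte_fin !lee_fin => uW Xn Yn.
have [vL|vL] := leP (x + y) L%:R; first by left => /=; lra.
right; rewrite -(bigcup_mkord n.+1 (A' u L)).
have v0 : 0 <= x + y by apply: ltW; apply: le_lt_trans vL.
pose j := Num.truncn (x + y).
have j1 : j%:R <= x + y by rewrite truncn_le.
have j2 : x + y < j.+1%:R by exact: truncnS_gt.
have Lj : (L <= j)%N by rewrite truncn_ge_nat// ltW.
exists j => /=.
  by rewrite ltnS -(ler_nat R); lra.
rewrite /A' Lj; split => /=; last by rewrite -natr1 in j2; lra.
rewrite Xx Yy !lte_fin.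
have [xj|xj] := ltP ((j%:R - 1) / 2) x; first by left.
by right; lra.
Qed.

Let PA u j : (1 <= j)%N ->
  (P (A u j) <= (D * expR (- (r * ((j%:R - 1) / 2))) * K (u - (j%:R + 1)) *+ 2)%:E)%E.
Proof.
move=> j1; rewrite /A setIUl.
have m1 (V : {RV P >-> \bar R}) : measurable ([set w | (((j%:R - 1) / 2)%:E < V w)%E] `&`
    [set w | u - (j%:R + 1) < Z w]).
  by apply: measurableI => //; exact: measurable_gt_RV.
have x0 : 0 <= (j%:R - 1) / 2 :> R by rewrite divr_ge0// subr_ge0 ler1n.
apply: (le_trans (measureU2 _ (m1 X) (m1 Y))).
rewrite [X in (_ <= X%:E)%E]mulr2n EFinD; apply: leeD.
  rewrite [leLHS]indX ZE [leRHS]EFinM.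
  by apply: lee_pmul; rewrite ?lee_fin//; exact: X_le.
rewrite [leLHS]indY ZE [leRHS]EFinM.
by apply: lee_pmul; rewrite ?lee_fin//; exact: Y_le.
Qed.

Let PB n : (P (B n) <= (D * expR (- (r * (n%:R / 2))) *+ 2)%:E)%E.
Proof.
have x0 : 0 <= n%:R / 2 :> R by rewrite divr_ge0.
apply: (le_trans (measureU2 _ (measurable_gt_RV _ _) (measurable_gt_RV _ _))).
by rewrite [X in (_ <= X%:E)%E]mulr2n EFinD; apply: leeD; [exact: X_le|exact: Y_le].
Qed.

Let W_le (u : R) (L n : nat) : u <= n%:R -> (0 < L)%N ->
  fine (P (W u)) <= K (u - L%:R) +
    \sum_(j < n.+1 | (L <= j)%N)
       D * expR (- (r * ((j%:R - 1) / 2))) * K (u - (j%:R + 1)) *+ 2 +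
    D * expR (- (r * (n%:R / 2))) *+ 2.
Proof.
move=> un L0; rewrite -lee_fin fineK; last by rewrite fin_num_measure//; exact: measurable_sum3.
have mA' j : measurable (A' u L j) by rewrite /A'; case: ifP.
have mU : measurable (\big[setU/set0]_(j < n.+1) A' u L j) by exact: bigsetU_measurable.
apply: (@le_trans _ _ (P ([set w | u - L%:R < Z w] `|`
    \big[setU/set0]_(j < n.+1) A' u L j `|` B n))).
  apply: le_measure; rewrite ?inE; [exact: measurable_sum3| |exact: W_sub].
  by apply: measurableU => //; exact: measurableU.
apply: (le_trans (measureU2 _ _ _)) => //; first exact: measurableU.
rewrite [leRHS]EFinD; apply: leeD; last exact: PB.
apply: (le_trans (measureU2 _ _ _)) => //.
rewrite [leRHS]EFinD; apply: leeD; first by rewrite [leLHS]ZE.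
apply: (le_trans (@content_subadditive _ _ _ P _ (A' u L) n.+1 _ _ _)) => //.
rewrite -sumEFin [leRHS]big_mkcond/=; apply: lee_sum => j _; rewrite /A'.
case: ifPn => Lj; last by rewrite measure0.
by apply: PA; exact: leq_trans Lj.
Qed.

Let geometric_tail (x : R) (L n : nat) : 0 <= x < 1 ->
  \sum_(j < n | (L <= j)%N) x ^+ j <= x ^+ L / (1 - x).
Proof.
move=> /andP[x0 x1]; have x10 : 0 < 1 - x by rewrite subr_gt0.
have [nL|Ln] := leqP n L.
  rewrite big1 ?divr_ge0 ?exprn_ge0// 1?ltW// => j Lj.
  by have := leq_ltn_trans Lj (leq_trans (ltn_ord j) nL); rewrite ltnn.
rewrite ler_pdivlMr//.
have -> : \sum_(j < n | (L <= j)%N) x ^+ j = \sum_(L <= j < n) x ^+ j.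
  rewrite -(big_mkord (fun j => L <= j)%N (fun j => x ^+ j)).
  rewrite (big_cat_nat _ (ltnW Ln))//= big_nat_cond big_pred0 ?add0r; last first.
    by move=> j; apply/negP => /andP[/andP[_ jL]]; rewrite leqNgt jL.
  by rewrite big_nat_cond [RHS]big_nat_cond; apply: eq_bigl => j; case: (L <= j)%N; rewrite ?andbT.
rewrite mulr_suml.
under eq_bigr do rewrite mulrBr mulr1 -exprSr.
rewrite -[leLHS]opprK -sumrN; under eq_bigr do rewrite opprB.
by rewrite telescope_sumr ?(ltnW Ln)// opprB gerBl exprn_ge0.
Qed.

(** Nonnegativity of [X] and [Y] gives the lower bound. Above, the event is cut by the integer part
    [j] of [X + Y]. Small sums leave [Z > u - L], where [K] is long-tailed; for [j >= L]
    independence sets a decay of rate [r / 2] in [j] against a shift of [K] of rate [r / 4];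
    finally, [X] or [Y] beyond [n / 2 >= u / 2] is exponentially rare. *)
Lemma light_perturbation_cvg :
  fine (P [set w | (u%:E < X w + Y w + (Z w)%:E)%E]) / K u @[u --> +oo] --> (1 : R).
Proof.
have r4 : 0 < r / 4 by rewrite divr_gt0.
have [C C0 HC] := K_shift r4.
pose x := expR (- (r / 4)).
have x01 : 0 <= x < 1 by rewrite expR_ge0 expR_lt1 oppr_lt0.
(* The exponents add up: [- r (j - 1) / 2 + r (j + 1) / 4 = 3 r / 4 - j r / 4]. *)
pose e34 := expR (3 / 4 * r).
pose c := D * C * e34 *+ 2.
have c0 : 0 <= c by rewrite mulrn_wge0// !mulr_ge0 ?expR_ge0// ltW.
have bound (u : R) (L n : nat) : u <= n%:R -> (0 < L)%N ->
    fine (P (W u)) <= K (u - L%:R) + c * (x ^+ L / (1 - x)) * K u +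
      D *+ 2 * expR (- (r / 2 * u)).
  move=> un L0; apply: (le_trans (W_le un L0)); apply: lerD.
    rewrite lerD2l; apply: (@le_trans _ _ (\sum_(j < n.+1 | (L <= j)%N) c * K u * x ^+ j)).
      apply: ler_sum => j Lj.
      have j0 : 0 <= j%:R + 1 :> R by rewrite addr_ge0.
      have := HC u (j%:R + 1) j0 => H.
      rewrite /c !mulrnAl lerMn2r/=.
      apply: (@le_trans _ _ (D * expR (- (r * ((j%:R - 1) / 2))) *
        (C * expR (r / 4 * (j%:R + 1)) * K u))).
        by apply: ler_wpM2l => //; rewrite mulr_ge0 ?expR_ge0.
      rewrite le_eqVlt; apply/orP; left; apply/eqP.
      rewrite /x -expRM_natl.
      transitivity (D * C * K u * (expR (- (r * ((j%:R - 1) / 2))) * expR (r / 4 * (j%:R + 1)))).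
        by ring.
      transitivity (D * C * K u * (e34 * expR (j%:R * - (r / 4)))); last by ring.
      by congr (_ * _); rewrite /e34 -!expRD; congr expR; field.
    rewrite -mulr_sumr [leRHS]mulrAC; apply: ler_wpM2l; first exact: mulr_ge0.
    exact: geometric_tail.
  rewrite [leRHS]mulrnAl lerMn2r/=; apply: ler_wpM2l => //.
  by rewrite ler_expR lerN2 mulrAC mulrA ler_wpM2r// ler_wpM2l// ltW.
apply/cvgrPdist_le => e e0.
have e3 : 0 < e / 3 by exact: divr_gt0.
have [L L0 HL] : exists2 L, (0 < L)%N & c * (x ^+ L / (1 - x)) <= e / 3.
  have cv : c * (x ^+ n / (1 - x)) @[n --> \oo] --> c * (0 / (1 - x)).
    by apply: cvgMr; apply: cvgMl; apply: cvg_expr; case/andP: x01 => a b; rewrite ger0_norm.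
  rewrite mul0r mulr0 in cv.
  have [N _ HN] : \forall n \near \oo, c * (x ^+ n / (1 - x)) <= e / 3.
    exact: (cvgr_le 0 cv).
  by exists N.+1 => //; apply: HN => /=.
have L0' : 0 <= L%:R :> R by [].
have r2 : 0 < r / 2 by exact: divr_gt0.
have cv2 : D *+ 2 * (expR (- (r / 2 * u)) / K u) @[u --> +oo] --> D *+ 2 * 0.
  by apply: cvgMr; exact: K_exp.
rewrite mulr0 in cv2.
near=> u.
rewrite ler_distlC; apply/andP; split.
  apply: (@le_trans _ _ 1); first by rewrite gerBl ltW.
  rewrite ler_pdivlMr// mul1r -lee_fin -ZE fineK; first exact: W_ge.
  by rewrite fin_num_measure//; exact: measurable_sum3.
have uN : u <= (Num.truncn u).+1%:R by rewrite ltW// truncnS_gt.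
rewrite ler_pdivrMr//; apply: (le_trans (bound u L _ uN L0)).
have H1 : K (u - L%:R) <= (1 + e / 3) * K u.
  rewrite -ler_pdivrMr//; near: u.
  by apply: (cvgr_le _ (K_long L0')); rewrite ltrDl.
have H2 : c * (x ^+ L / (1 - x)) * K u <= e / 3 * K u by exact: ler_wpM2r.
have H3 : D *+ 2 * expR (- (r / 2 * u)) <= e / 3 * K u.
  rewrite -ler_pdivrMr// -[leLHS]mulrA; near: u.
  by apply: (cvgr_le _ cv2).
by apply: (le_trans (lerD (lerD H1 H2) H3)); lra.
Unshelve. all: by end_near. Qed.

End light_perturbation.

(** * The corrected discard approximation *)

Section base_model.
Context {R : realType}.
Local Notation mu := (@lebesgue_measure R).

Lemma ae_ge0_distribution d (T : measurableType d) (P : probability T R)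
  (X : {RV P >-> R}) : {ae P, forall w, 0 <= X w} -> distribution P X `]-oo, 0[%classic = 0%E.
Proof.
move=> [A [mA PA XA]]; apply/eqP; rewrite -measure_le0.
apply: (@le_trans _ _ (P A)); last by rewrite PA.
apply: (le_measure P); rewrite ?inE//; first exact: measurable_funPTI.
by move=> w /=; rewrite in_itv/= => Xw; apply: XA => /=; apply/negP; rewrite -ltNge.
Qed.

Lemma max_claim_surplus_ge0 d (T : measurableType d) (P : probability T R) rate F
    (N : R -> {RV P >-> nat}) (U : nat -> {RV P >-> R}) :
  cramer_lundberg rate F N U -> forall w, (0 <= max_claim_surplus N U w)%E.
Proof.
move=> [[N0 _ _ _ _] _ _ _] w; apply: ereal_sup_ubound; exists 0 => //=.
by rewrite N0 big_ord0 subrr.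
Qed.

(** This supplies the interval that [renewal_gt0] asks for. [b] is positive at some [x > 0], since
    otherwise its integral would vanish, and by monotonicity it is at least [b x] before [x];
    [e = x / 2] keeps some mass beyond [e]. *)
Lemma positive_tail_interval (b : R -> R) (beta : R) :
  bmeas b -> nonincreasing_fun b -> (forall y : R, 0 <= b y <= 1) ->
  \int[mu]_(y in `[0, u]) b y @[u --> +oo] --> beta -> 0 < beta ->
  exists e, [/\ 0 < e, 0 < \int[mu]_(y in `[e / 2, e]) b y &
    forall v, 0 <= v <= e -> 0 < beta - \int[mu]_(y in `[0, v]) b y].
Proof.
move=> bb b_ni b01 b_cvg beta0.
have b0 y : 0 <= b y by case/andP: (b01 y).
have [x [x0 bx]] : exists x, 0 < x /\ 0 < b x.
  apply: contrapT => H.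
  have bz y : 0 < y -> b y = 0.
    move=> y0; apply/eqP; rewrite eq_le b0 andbT leNgt; apply/negP => by0.
    by apply: H; exists y.
  have b2 : 0 < beta / 2 by exact: divr_gt0.
  have : beta <= beta / 2.
    apply: (ler_cvg_to b_cvg (cvg_cst (beta / 2))); near=> u.
    have ub : beta / 2 <= u by near: u; apply: nbhs_pinfty_ge; exact: num_real.
    rewrite (cint_split bb (ltW b2) ub) -[leRHS]addr0; apply: lerD.
      apply: (@le_trans _ _ (\int[mu]_(y in `[0, beta / 2]) 1)).
        by apply: le_cint => //; [exact: bmeas_cst|move=> y _; case/andP: (b01 y)].
      by rewrite cint_cst ?mul1r ?subr0// ltW.
    rewrite (eq_cint (g := fun=> 0)); first by rewrite cint_cst// mul0r.
    by move=> y /andP[y1 _]; apply: bz; exact: lt_le_trans y1.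
  by rewrite leNgt gtr_pMr// invf_lt1// ltr1n.
exists (x / 2); have x2 : 0 < x / 2 by exact: divr_gt0.
have x2x : x / 2 <= x by rewrite ler_pdivrMr// mulr_natr mulr2n lerDl ltW.
split => //.
  apply: (@lt_le_trans _ _ (\int[mu]_(y in `[x / 2 / 2, x / 2]) b x)).
    by rewrite cint_cst; [rewrite mulr_gt0//; lra|lra].
  apply: le_cint => //; first exact: bmeas_cst.
  by move=> y /andP[_ yx]; apply: b_ni; exact: le_trans x2x.
move=> v /andP[v0 vx]; rewrite subr_gt0.
have vx' : v <= x by exact: le_trans x2x.
apply: lt_le_trans (light_le bb b0 b_cvg x).
rewrite (cint_split bb v0 vx') ltrDl.
apply: (@lt_le_trans _ _ (\int[mu]_(y in `[v, x]) b x)).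
  by rewrite cint_cst// mulr_gt0// subr_gt0; lra.
by apply: le_cint => //; [exact: bmeas_cst|move=> y /andP[_ yx]; exact: b_ni].
Unshelve. all: by end_near. Qed.

End base_model.

Section base_model_tail.
Context {R : realType}.

Lemma same_law_ruin_prob d (T : measurableType d) (P : probability T R)
    d' (T' : measurableType d') (P' : probability T' R) rate F
    (N : R -> {RV P >-> nat}) (U : nat -> {RV P >-> R}) (M : {RV P' >-> \bar R}) (u : R) :
  cramer_lundberg rate F N U -> same_law P' M P (max_claim_surplus N U) ->
  P' [set w | (u%:E < M w)%E] = (ruin_prob N U u)%:E.
Proof.
move=> cl sl.
have mu_ : measurable [set x : \bar R | (u%:E < x)%E].
  by rewrite -[X in measurable X]setTI; apply: measurable_lte.
have := sl _ mu_; rewrite /preimage/= => ->.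
by rewrite /ruin_prob fineK// fin_num_measure//; exact: (measurable_ruin cl).
Qed.

Lemma same_law_ge0 d (T : measurableType d) (P : probability T R)
    d' (T' : measurableType d') (P' : probability T' R) rate F
    (N : R -> {RV P >-> nat}) (U : nat -> {RV P >-> R}) (M : {RV P' >-> \bar R}) :
  cramer_lundberg rate F N U -> same_law P' M P (max_claim_surplus N U) ->
  P' [set w | (0 <= M w)%E] = 1%E.
Proof.
move=> cl sl.
have m0 : measurable [set x : \bar R | (0 <= x)%E].
  by rewrite -[X in measurable X]setTI; apply: measurable_lee => //; exact: measurable_cst.
have := sl _ m0; rewrite /preimage/= => ->.
rewrite (_ : [set _ | _] = setT) ?probability_setT//.
by apply/seteqP; split => // w _; exact: (max_claim_surplus_ge0 cl).
Qed.

Lemma claim_rate_mixture (lambda eps : R) d (T : measurableType d) (P : probability T R)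
    (B C : {RV P >-> R}) :
  claim_rate lambda (mixture eps (distribution P B) (distribution P C)) =
  fun y => (1 - eps) * lambda * (1 - fine (distribution P B `]-oo, y]%classic)) +
           eps * lambda * (1 - fine (distribution P C `]-oo, y]%classic)).
Proof.
apply/funext => y; rewrite /claim_rate /mixture.
rewrite (nu_cdfE (distribution P B)) (nu_cdfE (distribution P C)) -!EFinM -EFinD/=.
by ring.
Qed.

Lemma relative_error_cvg (psi psib W K : R -> R) (kappa alpha : R) :
  (forall u, 0 < K u) -> alpha != 0 ->
  psi u / K u @[u --> +oo] --> alpha ->
  psib u / K u @[u --> +oo] --> (0 : R) ->
  W u / K u @[u --> +oo] --> (1 : R) ->
  1 - (psib u + kappa * (W u - psib u)) / psi u @[u --> +oo] --> 1 - kappa / alpha.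
Proof.
move=> K0 a0 Hpsi Hpsib HW.
have L : 1 - (psib u / K u + kappa * (W u / K u - psib u / K u)) / (psi u / K u)
    @[u --> +oo] --> 1 - (0 + kappa * (1 - 0)) / alpha.
  apply: cvgB; first exact: cvg_cst.
  apply: cvgM; last exact: cvgV.
  by apply: cvgD => //; apply: cvgMr; exact: cvgB.
rewrite add0r subr0 mulr1 in L; rewrite (_ : (fun u => _) = fun u =>
  1 - (psib u / K u + kappa * (W u / K u - psib u / K u)) / (psi u / K u))//.
apply/funext => u; congr (1 - _); rewrite -mulrBl mulrA -mulrDl invfM invrK.
by rewrite mulrACA mulVf ?gt_eqF// mulr1.
Qed.

End base_model_tail.

Unset Implicit Arguments.

Theorem lemma1 (R : realType) (lambda eps : R)
  (* claim sizes *)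
  (d0 : measure_display) (T0 : measurableType d0) (P0 : probability T0 R)
  (B C : {RV P0 >-> R})
  (* risk model *)
  (d1 : measure_display) (T1 : measurableType d1) (P1 : probability T1 R)
  (N : R -> {RV P1 >-> nat}) (U : nat -> {RV P1 >-> R})
  (* discard base model *)
  (d2 : measure_display) (T2 : measurableType d2) (P2 : probability T2 R)
  (Nb : R -> {RV P2 >-> nat}) (Ub : nat -> {RV P2 >-> R})
  (* independent copies *)
  (d3 : measure_display) (T3 : measurableType d3) (P3 : probability T3 R)
  (M0 M1 : {RV P3 >-> \bar R}) (Ce : {RV P3 >-> R}) :
  let delta := lambda * fine 'E_P0[B] in
  let theta := lambda * fine 'E_P0[C] in
  let rho := (1 - eps) * delta + eps * theta in
  let psi := ruin_prob N U in
  let psib := ruin_prob Nb Ub in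
  let psid := fun u : R =>
    psib u + eps * theta / (1 - delta + eps * delta) *
      (fine (P3 [set w | (u%:E < M0 w + M1 w + (Ce w)%:E)%E]) -
       fine (P3 [set w | (u%:E < M0 w)%E])) in
  0 < lambda -> 0 <= eps <= 1 ->
  {ae P0, forall w, 0 <= B w} -> {ae P0, forall w, 0 <= C w} ->
  phase_type (distribution P0 B) -> heavy_tailed C ->
  (0 < 'E_P0[B] < +oo)%E -> (0 < 'E_P0[C] < +oo)%E ->
  rho < 1 ->
  cramer_lundberg lambda
    (mixture eps (distribution P0 B) (distribution P0 C)) N U ->
  cramer_lundberg ((1 - eps) * lambda) (distribution P0 B) Nb Ub ->
  same_law P3 M0 P2 (max_claim_surplus Nb Ub) ->
  same_law P3 M1 P2 (max_claim_surplus Nb Ub) ->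
  (forall u : R, cdf Ce u = (excess_cdf C u)%:E) ->
  independent3 P3 M0 M1 Ce ->
  subexponential (distribution P3 Ce) ->
  1 - psid u / psi u @[u --> +oo] --> eps * theta / (1 - delta + eps * delta).
Proof.
move=> delta theta rho psi psib psid lam0 /andP[eps0 eps1] B0 C0 phB _ /andP[EB0 EB] /andP[EC0 EC].
move=> rho1 cl clb sl0 sl1 CeE ind sub.
pose FB := distribution P0 B; pose FC := distribution P0 C; pose nu := distribution P3 Ce.
pose b y := 1 - fine (FB `]-oo, y]%classic); pose c y := 1 - fine (FC `]-oo, y]%classic).
pose K u := 1 - fine (nu `]-oo, u]%classic).
pose beta := fine 'E_P0[B]; pose m := fine 'E_P0[C].
pose p := (1 - eps) * lambda; pose q := eps * lambda.
have beta0 : 0 < beta by rewrite /beta fine_gt0// EB0.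
have m0 : 0 < m by rewrite /m fine_gt0// EC0.
have p0 : 0 <= p by rewrite mulr_ge0 ?subr_ge0// ltW.
have q0 : 0 <= q by rewrite mulr_ge0// ltW.
have rhoE : rho = p * beta + q * m by rewrite /rho /delta /theta /p /q -/beta -/m; ring.
have pb_rho : p * beta <= rho by rewrite rhoE lerDl mulr_ge0// ltW.
have pb1 : p * beta < 1 by exact: le_lt_trans rho1.
have rho_lt1 : p * beta + q * m < 1 by rewrite -rhoE.
have denE : 1 - delta + eps * delta = 1 - p * beta.
  by rewrite /delta /p -/beta; ring.
have kapE : eps * theta / (1 - delta + eps * delta) = q * m / (1 - p * beta).
  by rewrite denE /theta /q -/m mulrA.
have tail01 (G : probability R R) y : 0 <= 1 - fine (G `]-oo, y]%classic) <= 1.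
  by have := nu_cdf_bounds G y; lra.
have b01 y : 0 <= b y <= 1 by exact: tail01.
have c01 y : 0 <= c y <= 1 by exact: tail01.
have b0 y : 0 <= b y by case/andP: (b01 y).
have c0 y : 0 <= c y by case/andP: (c01 y).
have b_ni : nonincreasing_fun b by move=> x y xy; rewrite lerD2l lerN2; exact: nu_cdf_nd.
have c_ni : nonincreasing_fun c by move=> x y xy; rewrite lerD2l lerN2; exact: nu_cdf_nd.
have bb : bmeas b by exact: bmeas_nonincreasing b_ni b01.
have bc : bmeas c by exact: bmeas_nonincreasing c_ni c01.
have b_cvg := tail_integral_cvg B0 EB; rewrite -/FB -/b -/beta in b_cvg.
have c_cvg := tail_integral_cvg C0 EC; rewrite -/FC -/c -/m in c_cvg.
have FB0 : FB `]-oo, 0[%classic = 0%E by exact: ae_ge0_distribution.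
have FC0 : FC `]-oo, 0[%classic = 0%E by exact: ae_ge0_distribution.
have [A [s [A0 s0 bA]]] := phase_type_tail phB.
have GE u : fine (nu `]-oo, u]%classic) = m^-1 * \int[@lebesgue_measure R]_(y in `[0, u]) c y.
  by have := CeE u; rewrite /cdf -/nu => ->.
have KE u : K u = 1 - m^-1 * \int[@lebesgue_measure R]_(y in `[0, u]) c y by rewrite /K GE.
have Kgt0 : forall u, 0 < K u := subexponential_tail_gt0 sub.
have Ksub : (m^-1 * conv K c u) / K u @[u --> +oo] --> (1 : R).
  exact: (subexponential_conv m0 bc c0 GE sub).
have K_cvg0 : K u @[u --> +oo] --> 0.
  have L : 1 - m^-1 * \int[@lebesgue_measure R]_(y in `[0, u]) c y @[u --> +oo] --> 1 - m^-1 * m.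
    by apply: cvgB; [exact: cvg_cst|exact: cvgMr].
  rewrite mulVf ?gt_eqF// subrr in L; rewrite (_ : (fun u => K u) = fun u =>
    1 - m^-1 * \int[@lebesgue_measure R]_(y in `[0, u]) c y)//.
  by apply/funext => u; exact: KE.
have K_exp := exp_tail_negligible m0 bc c0 KE Kgt0 K_cvg0 Ksub.
have bpb : bmeas (fun y => p * b y) by exact: bmeasZ.
have bqc : bmeas (fun y => q * c y) by exact: bmeasZ.
pose k y := p * b y + q * c y.
have bk : bmeas k by exact: bmeasD.
have kE : claim_rate lambda (mixture eps FB FC) = k by exact: claim_rate_mixture.
have kbE : claim_rate p FB = fun y => p * b y by [].
have k_cvg : \int[@lebesgue_measure R]_(y in `[0, v]) k y @[v --> +oo] --> rho.
  rewrite (_ : (fun v => _) = fun v => p * (\int[@lebesgue_measure R]_(y in `[0, v]) b y) +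
    q * (\int[@lebesgue_measure R]_(y in `[0, v]) c y)).
    by rewrite rhoE; apply: cvgD; exact: cvgMr.
  by apply/funext => v; rewrite cintD// !cintZ.
have kb_cvg : \int[@lebesgue_measure R]_(y in `[0, v]) (p * b y) @[v --> +oo] --> p * beta.
  rewrite (_ : (fun v => _) = fun v => p * (\int[@lebesgue_measure R]_(y in `[0, v]) b y)).
    exact: cvgMr.
  by apply/funext => v; rewrite cintZ.
have FBC0 : mixture eps FB FC `]-oo, 0[%classic = 0%E.
  by rewrite /mixture FB0 FC0 !mule0 adde0.
have Hpsi v : 0 <= v -> psi v = rho - \int[@lebesgue_measure R]_(y in `[0, v]) k y + conv psi k v.
  move=> v0; rewrite -kE; apply: (ruin_renewal cl) => //; first exact: ltW.
  by rewrite kE.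
have Hpsib v : 0 <= v -> psib v =
    p * beta - \int[@lebesgue_measure R]_(y in `[0, v]) (p * b y) + conv psib (fun y => p * b y) v.
  by move=> v0; apply: (ruin_renewal clb).
have bpsi : bmeas psi by exact: bmeas_nonincreasing (ruin_prob_ni cl) (ruin_prob_bounds cl).
have bpsib : bmeas psib by exact: bmeas_nonincreasing (ruin_prob_ni clb) (ruin_prob_bounds clb).
rewrite kapE.
(* For [eps = 0] the limit of [psi / K] is 0 and [relative_error_cvg] is out of reach; the two
   renewal equations coincide instead. Positivity matters because a quotient by 0 is 0 and would
   make the error 1. *)
have [eps_eq0|eps_neq0] := eqVneq eps 0.
  have q_eq0 : q = 0 by rewrite /q eps_eq0 mul0r.
  have pE : p = lambda by rewrite /p eps_eq0 subr0 mul1r.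
  have rhoE0 : rho = p * beta by rewrite rhoE q_eq0 mul0r addr0.
  have k_eq : k = fun y => p * b y.
    by apply/funext => y; rewrite /k q_eq0 mul0r addr0.
  have pb0 y : 0 <= p * b y by exact: mulr_ge0.
  have kle v : \int[@lebesgue_measure R]_(y in `[0, v]) (p * b y) <= p * beta.
    by rewrite cintZ// ler_wpM2l// (light_le bb b0 b_cvg).
  have psiE v : 0 <= v -> psi v = psib v.
    apply: (@renewal_unique _ (fun y => p * b y) _ _
      (fun v => p * beta - \int[@lebesgue_measure R]_(y in `[0, v]) (p * b y)) (p * beta)) => //.
      by rewrite pb1 mulr_ge0// ltW.
    by move=> w w0; rewrite {1}Hpsi// rhoE0 k_eq.
  have psi_gt0 v : 0 <= v -> 0 < psib v.
    have [e [e0 be1 be2]] := positive_tail_interval bb b_ni b01 b_cvg beta0.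
    apply: (@renewal_gt0 _ (fun y => p * b y) _
      (fun v => p * beta - \int[@lebesgue_measure R]_(y in `[0, v]) (p * b y)) e) => //.
    - by move=> y; case/andP: (ruin_prob_bounds clb y).
    - exact: (ruin_prob_ni clb).
    - by move=> w w0; rewrite subr_ge0.
    - by move=> w w0; rewrite cintZ// -mulrBr pE mulr_gt0// be2.
    - by rewrite cintZ// pE mulr_gt0.
  rewrite q_eq0 !mul0r; apply: cvg_near_cst; near=> u.
  have u0 : 0 <= u by near: u; apply: nbhs_pinfty_ge; exact: num_real.
  by rewrite /psid eps_eq0 !mul0r addr0 psiE// divff ?subrr// gt_eqF// psi_gt0.
have eps_gt0 : 0 < eps by rewrite lt0r eps_neq0.
have q_gt0 : 0 < q by exact: mulr_gt0.
have [r [D [r0 D0 psib_le]]] := renewal_light bb b0 A0 s0 bA b_cvg p0 pb1 bpsib Hpsib.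
have psiK : psi u / K u @[u --> +oo] --> q * m / (1 - (p * beta + q * m)).
  apply: (renewal_subexponential m0 bc c0 KE Kgt0 K_cvg0 Ksub bb b0 A0 s0 bA b_cvg p0 q0
    rho_lt1 bpsi).
  by rewrite -rhoE.
have psibK : psib u / K u @[u --> +oo] --> (0 : R).
  have up : D * (expR (- (r * u)) / K u) @[u --> +oo] --> D * 0.
    by apply: cvgMr; exact: K_exp.
  rewrite mulr0 in up; apply: (squeeze_cvgr _ (cvg_cst (0 : R)) up); near=> u.
  have u0 : 0 <= u by near: u; apply: nbhs_pinfty_ge; exact: num_real.
  rewrite divr_ge0 ?(ltW (Kgt0 _))//=; last by case/andP: (ruin_prob_bounds clb u).
  by rewrite mulrA ler_pM2r ?invr_gt0// psib_le.
have M0E u := same_law_ruin_prob u clb sl0.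
have M1E u := same_law_ruin_prob u clb sl1.
have WK : fine (P3 [set w | (u%:E < M0 w + M1 w + (Ce w)%:E)%E]) / K u @[u --> +oo] --> (1 : R).
  apply: (light_perturbation_cvg ind r0 D0) => //.
  - exact: same_law_ge0 clb sl0.
  - exact: same_law_ge0 clb sl1.
  - by move=> u u0; rewrite M0E lee_fin psib_le.
  - by move=> u u0; rewrite M1E lee_fin psib_le.
  - move=> u; rewrite /K EFinB -nu_cdfE -probability_setC// setCitvl.
    rewrite /nu /distribution /pushforward; congr (P3 _).
    by apply/seteqP; split => w /=; rewrite in_itv/= andbT.
  - exact: (long_tail m0 bc c0 KE Kgt0 K_cvg0 Ksub).
  - exact: (tail_shift_bound m0 bc c0 KE Kgt0 K_cvg0 Ksub).
have rho1' : 0 < 1 - (p * beta + q * m) by rewrite subr_gt0.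
have alpha0 : q * m / (1 - (p * beta + q * m)) != 0.
  by rewrite gt_eqF// divr_gt0// mulr_gt0.
(* With [rho = p * beta + q * m] the inner quotient is [(1 - rho) / (1 - p * beta) = 1 - q * m / (1
   - p * beta)]. *)
have -> : q * m / (1 - p * beta) =
    1 - q * m / (1 - p * beta) / (q * m / (1 - (p * beta + q * m))).
  by field; rewrite !gt_eqF//= subr_gt0.
have E : (fun u => 1 - psid u / psi u) = fun u => 1 - (psib u + q * m / (1 - p * beta) *
    (fine (P3 [set w | (u%:E < M0 w + M1 w + (Ce w)%:E)%E]) - psib u)) / psi u.
  by apply/funext => u; rewrite /psid kapE M0E.
rewrite E; exact: relative_error_cvg Kgt0 alpha0 psiK psibK WK.
Unshelve. all: by end_near. Qed.
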